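(* Let $G$ be a locally compact Hausdorff group. Then the Chu bidual group $G^{xx}$ is topologically isomorphic to the Bohr compactification $bG$ if and only if the space $G_n^x$ is discrete for every $n\in\mathbb{N}$, $n\geq 1$.
   Context: For $n\ge 1$, $\mathbb{U}(n)$ is the compact group of unitary $n\times n$ complex matrices. For a topological group $G$, $\mathrm{rep}_n(G)$ is the set of all continuous homomorphisms $G\to\mathbb{U}(n)$ with the compact-open topology, and $\mathrm{rep}(G)=\bigsqcup_{n\ge 1}\mathrm{rep}_n(G)$ is their topological sum (the Chu dual). Two representations $\rho,\psi\in\mathrm{rep}_n(G)$ are equivalent ($\rho\sim\psi$) if there is $M\in\mathbb{U}(n)$ with $\rho(x)=M^{-1}\psi(x)M$ for all $x\in G$. $G_n^x=\mathrm{rep}_n(G)/{\sim}$ is the set of equivalence classes of (all, not only irreducible) $n$-dimensional representations, with the quotient topology from $\mathrm{rep}_n(G)$. Let $\mathbb{U}=\bigsqcup_{n\ge 1}\mathbb{U}(n)$ (topological sum). A quasi-representation of $\mathrm{rep}(G)$ is a continuous map $p:\mathrm{rep}(G)\to\mathbb{U}$ such that $p(\mathrm{rep}_n(G))\subseteq\mathbb{U}(n)$ for all $n$, $p(D\oplus D')=p(D)\oplus p(D')$, $p(D\otimes D')=p(D)\otimes p(D')$ for all $D,D'\in\mathrm{rep}(G)$, and $p(M^{-1}DM)=M^{-1}p(D)M$ for all $D\in\mathrm{rep}_n(G)$, $M\in\mathbb{U}(n)$. The Chu bidual group (Chu quasi-dual) $G^{xx}$ is the set of all quasi-representations with pointwise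 multiplication and the compact-open topology on $\mathrm{rep}(G)$; it is a topological group. The Bohr compactification of $G$ is the pair $(bG,b)$, with $bG$ a compact Hausdorff group and $b:G\to bG$ a continuous homomorphism with dense range, such that for every continuous homomorphism $h$ from $G$ into a compact Hausdorff group $K$ there is a continuous homomorphism $h^b:bG\to K$ with $h=h^b\circ b$; it is unique up to equivalence. *)

(* Defs.v *)
From HB Require Import structures.
From mathcomp Require Import all_boot all_order all_algebra.
From mathcomp Require Import spectral.
From mathcomp Require Import all_classical all_reals all_analysis.
From mathcomp Require Import complex.
From mathcomp Require Import mxtens.

Set Implicit Arguments.
Unset Strict Implicit.
Unset Printing Implicit Defensive.

Import Order.TTheory GRing.Theory Num.Theory.
Import numFieldNormedType.Exports.

Local Open Scope classical_set_scope.
Local Open Scope ring_scope.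

#[short(type="preTopologicalGroupType")]
HB.structure Definition PreTopologicalGroup :=
  {G of Topological G & Group G}.

HB.mixin Record PreTopologicalGroup_isTopologicalGroup G
    & PreTopologicalGroup G := {
  mulg_continuous : continuous (fun x : G * G => (x.1 * x.2)%g) ;
  invg_continuous : continuous (fun x : G => (x^-1)%g)
}.

#[short(type="topologicalGroupType")]
HB.structure Definition TopologicalGroup :=
  {G of PreTopologicalGroup G & PreTopologicalGroup_isTopologicalGroup G}.

Definition topologically_isomorphic (G H : preTopologicalGroupType) : Prop :=
  exists (f : G -> H) (g : H -> G),
    [/\ {morph f : x y / (x * y)%g}, cancel f g, cancel g f,
        continuous f & continuous g].

Definition discrete_space (T : topologicalType) : Prop :=
  forall A : set T, open A.

(* R[i] has no topology in the library; R[i]^o has that of the modulus. *)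
HB.instance Definition _ (R : realType) := PseudoMetric.copy R[i] (R[i])^o.

Record unitary_group (R : realType) (n : nat) := UnitaryGroup {
  unitary_val :> 'M[R[i]]_n;
  unitary_valP : unitary_val \is unitarymx
}.

Notation "''U[' R ]_ n" := (unitary_group R n)
  (at level 8, n at level 2, format "''U[' R ]_ n") : type_scope.

HB.instance Definition _ R n := [isSub for @unitary_val R n].
HB.instance Definition _ R n := [Choice of 'U[R]_n by <:].
HB.instance Definition _ R n :=
  Topological.copy 'U[R]_n (initial_topology (@unitary_val R n)).

Section unitary_group_theory.
Context {R : realType}.

Fact unitary1_subproof n : (1%:M : 'M[R[i]]_n) \is unitarymx.
Proof. by apply/unitarymxP; rewrite trmx1 map_mx1 mulmx1. Qed.

Definition unitary1 n : 'U[R]_n := UnitaryGroup (unitary1_subproof n).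

Definition unitary_mul n (A B : 'U[R]_n) : 'U[R]_n :=
  UnitaryGroup (mul_unitarymx (unitary_valP A) (unitary_valP B)).

Fact unitary_inv_subproof n (A : 'U[R]_n) : map_mx Num.conj (unitary_val A)^T \is unitarymx.
Proof. by rewrite trmxC_unitary unitary_valP. Qed.

Definition unitary_inv n (A : 'U[R]_n) : 'U[R]_n :=
  UnitaryGroup (unitary_inv_subproof A).

Section group.
Variable n : nat.

Fact unitary_mulA : associative (@unitary_mul n).
Proof. by move=> A B C; apply: val_inj; rewrite /= mulmxA. Qed.

Fact unitary_mul1 : left_id (unitary1 n) (@unitary_mul n).
Proof. by move=> A; apply: val_inj; rewrite /= mul1mx. Qed.

Fact unitary_mulr1 : right_id (unitary1 n) (@unitary_mul n).
Proof. by move=> A; apply: val_inj; rewrite /= mulmx1. Qed.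

Fact unitary_mulV : right_inverse (unitary1 n) (@unitary_inv n) (@unitary_mul n).
Proof.
by move=> A; apply: val_inj; rewrite /=; apply/unitarymxP/unitary_valP.
Qed.

Fact unitary_mulVl : left_inverse (unitary1 n) (@unitary_inv n) (@unitary_mul n).
Proof.
by move=> A; apply: val_inj; apply: mulmx1C; have [] := unitary_mulV A.
Qed.

HB.instance Definition _ := isGroup.Build 'U[R]_n unitary_mulA unitary_mul1
  unitary_mulr1 unitary_mulVl unitary_mulV.
End group.

End unitary_group_theory.

Section unitary_group_topology.
Context {R : realType}.

Lemma mx_continuousP (T U : topologicalType) m n (f : T -> 'M[U]_(m, n)) :
  continuous f <-> forall i j, continuous (fun x => f x i j).
Proof.
split=> [cf i j x A nA|cf x A [P nP PA]].
  apply: (cf x [set M | A (M i j)]).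
  exists (fun i' j' => if (i' == i) && (j' == j) then A else setT).
    by move=> i' j'; case: ifP => [/andP[/eqP-> /eqP->]//|_]; exact: filterT.
  by move=> M /(_ i j) /=; rewrite !eqxx.
have : \forall y \near x, forall ij, P ij.1 ij.2 (f y ij.1 ij.2).
  by apply: filter_forall => -[i j]; exact: cf.
by apply: filterS => y Py; apply: PA => i j; exact: (Py (i, j)).
Qed.

Lemma complexD_continuous (T : topologicalType) (f g : T -> R[i]) :
  continuous f -> continuous g -> continuous (fun x => f x + g x).
Proof.
move=> cf cg x; exact: (cvg_comp2 (cf x) (cg x) (@add_continuous (R[i])^o (f x, g x))).
Qed.

Lemma complexM_continuous (T : topologicalType) (f g : T -> R[i]) :
  continuous f -> continuous g -> continuous (fun x => f x * g x).
Proof.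
move=> cf cg x; exact: (cvg_comp2 (cf x) (cg x) (@mul_continuous R[i] (f x, g x))).
Qed.

Lemma conj_continuous : continuous (@Num.conj R[i]).
Proof.
move=> x A /nbhs_ballP[e e0 eA]; apply/nbhs_ballP; exists e => // y xy.
by apply: eA; rewrite /ball/= /ball_ -rmorphB norm_conjC.
Qed.

Lemma complex_sum_continuous (T : topologicalType) I (r : seq I)
    (f : I -> T -> R[i]) :
  (forall i, continuous (f i)) -> continuous (fun x => \sum_(i <- r) f i x).
Proof.
move=> cf; elim: r => [|i r IHr].
  by rewrite (_ : (fun _ => _) = cst 0);
    [exact: cst_continuous|apply/funext => x; rewrite big_nil].
have -> : (fun x => \sum_(k <- i :: r) f k x) =
          (fun x => f i x + \sum_(k <- r) f k x).
  by apply/funext => x; rewrite big_cons.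
by apply: complexD_continuous; [exact: cf|exact: IHr].
Qed.

Lemma unitary_continuousP (T : topologicalType) n (f : T -> 'U[R]_n) :
  continuous f <-> forall i j, continuous (fun x => unitary_val (f x) i j).
Proof.
rewrite -(@mx_continuousP T R[i] n n (fun x => unitary_val (f x))).
split=> [cf x|cf]; last exact: continuous_comp_initial.
by apply: continuous_comp; [exact: cf|exact: initial_continuous].
Qed.

Lemma entry_continuous n i j :
  continuous (fun A : 'U[R]_n => unitary_val A i j).
Proof. by move: i j; apply/unitary_continuousP => A; exact: cvg_id. Qed.

Lemma unitary_mul_continuous n :
  continuous (fun x : 'U[R]_n * 'U[R]_n => (x.1 * x.2)%g).
Proof.
apply/unitary_continuousP => i j.
rewrite (_ : (fun _ => _) = (fun x : 'U[R]_n * 'U[R]_n =>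
  \sum_k unitary_val x.1 i k * unitary_val x.2 k j)); last first.
  by apply/funext => x; rewrite mxE.
apply: complex_sum_continuous => k; apply: complexM_continuous.
- move=> x; apply: (@continuous_comp _ _ _ fst (fun A => unitary_val A i k)).
    exact: cvg_fst.
  exact: entry_continuous.
- move=> x; apply: (@continuous_comp _ _ _ snd (fun A => unitary_val A k j)).
    exact: cvg_snd.
  exact: entry_continuous.
Qed.

Lemma unitary_inv_continuous n : continuous (fun A : 'U[R]_n => (A^-1)%g).
Proof.
apply/unitary_continuousP => i j.
rewrite (_ : (fun _ => _) = (fun A : 'U[R]_n => Num.conj (unitary_val A j i))).
  move=> A; apply: continuous_comp; last exact: conj_continuous.
  exact: entry_continuous.
by apply/funext => A; rewrite !mxE.
Qed.

HB.instance Definition _ n := PreTopologicalGroup_isTopologicalGroup.Build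
  'U[R]_n (@unitary_mul_continuous n) (@unitary_inv_continuous n).

End unitary_group_topology.

Section unitary_operations.
Context {R : realType}.

Fact unitary_dsum_subproof m n (A : 'U[R]_m) (B : 'U[R]_n) :
  block_mx (unitary_val A) 0 0 (unitary_val B) \is unitarymx.
Proof.
apply/unitarymxP; rewrite tr_block_mx map_block_mx mulmx_block.
rewrite !trmx0 !map_mx0 !mulmx0 !mul0mx !addr0 !add0r.
by rewrite !(unitarymxP (unitary_valP _)) -scalar_mx_block.
Qed.

Definition unitary_dsum m n (A : 'U[R]_m) (B : 'U[R]_n) : 'U[R]_(m + n) :=
  UnitaryGroup (unitary_dsum_subproof A B).

Fact unitary_tens_subproof m n (A : 'U[R]_m) (B : 'U[R]_n) :
  tensmx (unitary_val A) (unitary_val B) \is unitarymx.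
Proof.
apply/unitarymxP; rewrite trmx_tens map_mxT tensmx_mul.
rewrite !(unitarymxP (unitary_valP _)).
apply/matrixP => i j; case: (mxtens_indexP i) => i0 i1.
case: (mxtens_indexP j) => j0 j1; rewrite tensmxE !mxE -natrM mulnb.
by rewrite (can_eq (@mxtens_indexK m n)) xpair_eqE.
Qed.

Definition unitary_tens m n (A : 'U[R]_m) (B : 'U[R]_n) : 'U[R]_(m * n) :=
  UnitaryGroup (unitary_tens_subproof A B).

Lemma unitary_dsumM m n (A A' : 'U[R]_m) (B B' : 'U[R]_n) :
  unitary_dsum (A * A')%g (B * B')%g =
  (unitary_dsum A B * unitary_dsum A' B')%g.
Proof.
apply: val_inj => /=; rewrite mulmx_block.
by rewrite !mulmx0 !mul0mx !addr0 !add0r.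
Qed.

Lemma unitary_tensM m n (A A' : 'U[R]_m) (B B' : 'U[R]_n) :
  unitary_tens (A * A')%g (B * B')%g =
  (unitary_tens A B * unitary_tens A' B')%g.
Proof. by apply: val_inj => /=; rewrite tensmx_mul. Qed.

Lemma unitary_dsum1 m n : unitary_dsum 1%g 1%g = 1%g :> 'U[R]_(m + n).
Proof. by apply: val_inj => /=; rewrite -scalar_mx_block. Qed.

Lemma unitary_tens1 m n : unitary_tens 1%g 1%g = 1%g :> 'U[R]_(m * n).
Proof.
by apply: (@mulgI _ (unitary_tens 1 1)%g); rewrite -unitary_tensM !mulg1.
Qed.

Lemma unitary_dsumV m n (A : 'U[R]_m) (B : 'U[R]_n) :
  unitary_dsum A^-1%g B^-1%g = (unitary_dsum A B)^-1%g.
Proof.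
apply: (@mulgI _ (unitary_dsum A B)).
by rewrite -unitary_dsumM !mulgV unitary_dsum1.
Qed.

Lemma unitary_tensV m n (A : 'U[R]_m) (B : 'U[R]_n) :
  unitary_tens A^-1%g B^-1%g = (unitary_tens A B)^-1%g.
Proof.
apply: (@mulgI _ (unitary_tens A B)).
by rewrite -unitary_tensM !mulgV unitary_tens1.
Qed.

Lemma unitary_dsum_continuous (T : topologicalType) m n
    (f : T -> 'U[R]_m) (g : T -> 'U[R]_n) :
  continuous f -> continuous g ->
  continuous (fun x => unitary_dsum (f x) (g x)).
Proof.
move=> /unitary_continuousP cf /unitary_continuousP cg.
apply/unitary_continuousP => i j.
case: (split_ordP i) => i' ->; case: (split_ordP j) => j' ->.
- under eq_fun do rewrite /= block_mxEul; exact: cf.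
- under eq_fun do rewrite /= block_mxEur mxE; exact: cst_continuous.
- under eq_fun do rewrite /= block_mxEdl mxE; exact: cst_continuous.
- under eq_fun do rewrite /= block_mxEdr; exact: cg.
Qed.

Lemma unitary_tens_continuous (T : topologicalType) m n
    (f : T -> 'U[R]_m) (g : T -> 'U[R]_n) :
  continuous f -> continuous g ->
  continuous (fun x => unitary_tens (f x) (g x)).
Proof.
move=> /unitary_continuousP cf /unitary_continuousP cg.
apply/unitary_continuousP => i j.
case: (mxtens_indexP i) => i0 i1; case: (mxtens_indexP j) => j0 j1.
under eq_fun do rewrite /= tensmxE.
by apply: complexM_continuous; [exact: cf|exact: cg].
Qed.

Lemma mulg_continuous_comp (T : topologicalType) (G : topologicalGroupType)
    (f g : T -> G) :
  continuous f -> continuous g -> continuous (fun x => (f x * g x)%g).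
Proof.
by move=> cf cg x; exact: (cvg_comp2 (cf x) (cg x) (@mulg_continuous G (_, _))).
Qed.

End unitary_operations.

(* The topological sum of the U(n) over n >= 1: the summand with tag n is
   U(n.+1). *)
Definition unitary_sum (R : realType) : Type := {n : nat & 'U[R]_n.+1}.

HB.instance Definition _ R := Topological.on (unitary_sum R).

Section unitary_sum.
Context {R : realType}.
Implicit Types u v : unitary_sum R.

Definition unitary_of n (A : 'U[R]_n.+1) : unitary_sum R :=
  Tagged (fun k => 'U[R]_k.+1) A.

(* Below, (m.+1 + n.+1).-1.+1 and (m.+1 * n.+1).-1.+1 reduce to m.+1 + n.+1
   and m.+1 * n.+1. *)
Definition usum_dsum u v : unitary_sum R :=
  @unitary_of ((tag u).+1 + (tag v).+1).-1 (unitary_dsum (tagged u) (tagged v)).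

Definition usum_tens u v : unitary_sum R :=
  @unitary_of ((tag u).+1 * (tag v).+1).-1 (unitary_tens (tagged u) (tagged v)).

(* The product of U(n) when u and v both lie in U(n); its value when they lie
   in different summands is irrelevant. *)
Definition usum_mul u v : unitary_sum R :=
  unitary_of (tagged u * tagged_as u v)%g.

Definition usum_inv u : unitary_sum R := unitary_of (tagged u)^-1%g.

Lemma usum_mulE n (A B : 'U[R]_n.+1) :
  usum_mul (unitary_of A) (unitary_of B) = unitary_of (A * B)%g.
Proof. by rewrite /usum_mul tagged_asE. Qed.

Lemma unitary_of_inj n : injective (@unitary_of n).
Proof. by move=> A B /eqP; rewrite eq_Tagged => /eqP. Qed.

Lemma unitary_of_continuous n : continuous (@unitary_of n).
Proof. exact: (@existT_continuous nat (fun k => 'U[R]_k.+1)). Qed.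

Lemma continuous_unitary_of (T : topologicalType) n (f : T -> 'U[R]_n.+1) :
  continuous (fun x => unitary_of (f x)) -> continuous f.
Proof.
move=> /continuousP cf; apply/continuousP => A oA.
have := cf _ (@existT_open_map nat (fun k => 'U[R]_k.+1) n A oA).
congr open; apply/seteqP; split=> x /= => [[B AB /unitary_of_inj <-//]|Afx].
by exists (f x).
Qed.

End unitary_sum.

Section representations.
Variables (R : realType) (G : topologicalGroupType).

Definition is_rep n : set {compact-open, G -> 'U[R]_n} :=
  [set rho : G -> 'U[R]_n |
     continuous rho /\ {morph rho : x y / (x * y)%g}].

Definition rep n : Type := set_type (@is_rep n).

HB.instance Definition _ n := Topological.on (rep n).

Definition rep_fun n (rho : rep n) : G -> 'U[R]_n := set_val rho.

Definition rep_equivalent n (rho psi : rep n) : Prop :=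
  exists M : 'U[R]_n, forall x, rep_fun rho x = (M^-1 * rep_fun psi x * M)%g.

End representations.

Coercion rep_fun : rep >-> Funclass.

Section representation_theory.
Context {R : realType} {G : topologicalGroupType}.

Lemma rep_continuous n (rho : rep R G n) : continuous rho.
Proof. by have [] := set_mem (valP rho). Qed.

Lemma repM n (rho : rep R G n) : {morph rho : x y / (x * y)%g}.
Proof. by have [] := set_mem (valP rho). Qed.

Definition mk_rep n (f : G -> 'U[R]_n) (cf : continuous f)
  (fM : {morph f : x y / (x * y)%g}) : rep R G n :=
  exist _ (f : {compact-open, G -> 'U[R]_n}) (mem_set (conj cf fM)).

Lemma rep_eq n (rho psi : rep R G n) : rho =1 psi -> rho = psi.
Proof. by move=> e; apply: val_inj; exact/funext. Qed.

Fact rep_dsum_continuous m n (rho : rep R G m) (psi : rep R G n) :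
  continuous (fun x => unitary_dsum (rho x) (psi x)).
Proof. by apply: unitary_dsum_continuous; exact: rep_continuous. Qed.

Fact rep_dsumM m n (rho : rep R G m) (psi : rep R G n) :
  {morph (fun x => unitary_dsum (rho x) (psi x)) : x y / (x * y)%g}.
Proof. by move=> x y; rewrite !repM unitary_dsumM. Qed.

Definition rep_dsum m n (rho : rep R G m) (psi : rep R G n) :
  rep R G (m + n) :=
  mk_rep (@rep_dsum_continuous _ _ rho psi) (@rep_dsumM _ _ rho psi).

Fact rep_tens_continuous m n (rho : rep R G m) (psi : rep R G n) :
  continuous (fun x => unitary_tens (rho x) (psi x)).
Proof. by apply: unitary_tens_continuous; exact: rep_continuous. Qed.

Fact rep_tensM m n (rho : rep R G m) (psi : rep R G n) :
  {morph (fun x => unitary_tens (rho x) (psi x)) : x y / (x * y)%g}.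
Proof. by move=> x y; rewrite !repM unitary_tensM. Qed.

Definition rep_tens m n (rho : rep R G m) (psi : rep R G n) :
  rep R G (m * n) :=
  mk_rep (@rep_tens_continuous _ _ rho psi) (@rep_tensM _ _ rho psi).

Fact rep_conj_continuous n (M : 'U[R]_n) (rho : rep R G n) :
  continuous (fun x => (M^-1 * rho x * M)%g).
Proof.
apply: mulg_continuous_comp; last exact: cst_continuous.
by apply: mulg_continuous_comp; [exact: cst_continuous|exact: rep_continuous].
Qed.

Fact rep_conjM n (M : 'U[R]_n) (rho : rep R G n) :
  {morph (fun x => (M^-1 * rho x * M)%g) : x y / (x * y)%g}.
Proof. by move=> x y; rewrite repM !mulgA mulgK. Qed.

Definition rep_conj n (M : 'U[R]_n) (rho : rep R G n) : rep R G n :=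
  mk_rep (@rep_conj_continuous _ M rho) (@rep_conjM _ M rho).

End representation_theory.

Section rep_classes.
Variables (R : realType) (G : topologicalGroupType) (n : nat).

Definition rep_equivb : rel (rep R G n) :=
  fun rho psi => `[< rep_equivalent rho psi >].

Fact rep_equivb_refl : reflexive rep_equivb.
Proof.
by move=> rho; apply/asboolP; exists 1%g => x; rewrite invg1 mul1g mulg1.
Qed.

Fact rep_equivb_sym : symmetric rep_equivb.
Proof.
suff sub rho psi : rep_equivb rho psi -> rep_equivb psi rho.
  by move=> rho psi; apply/idP/idP; exact: sub.
move=> /asboolP[M rhoE]; apply/asboolP; exists M^-1%g => x.
by rewrite rhoE invgK !mulgA mulgV mul1g mulgK.
Qed.

Fact rep_equivb_trans : transitive rep_equivb.
Proof.
move=> psi rho phi /asboolP[M rhoE] /asboolP[N psiE]; apply/asboolP.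
by exists (N * M)%g => x; rewrite rhoE psiE invgM !mulgA.
Qed.

Canonical rep_equiv_rel :=
  EquivRel rep_equivb rep_equivb_refl rep_equivb_sym rep_equivb_trans.

Definition rep_classes : Type :=
  quotient_topology {eq_quot rep_equiv_rel}%qT.

HB.instance Definition _ := Topological.on rep_classes.

End rep_classes.

(* As for unitary_sum, the summand with tag n is rep_{n+1}(G). *)
Definition chu_dual (R : realType) (G : topologicalGroupType) : Type :=
  {n : nat & rep R G n.+1}.

HB.instance Definition _ R G := Topological.on (chu_dual R G).

Section chu_dual.
Context {R : realType} {G : topologicalGroupType}.

Definition rep_of n (rho : rep R G n.+1) : chu_dual R G :=
  Tagged (fun k => rep R G k.+1) rho.

Definition chu_dsum (D E : chu_dual R G) : chu_dual R G :=
  @rep_of ((tag D).+1 + (tag E).+1).-1 (rep_dsum (tagged D) (tagged E)).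

Definition chu_tens (D E : chu_dual R G) : chu_dual R G :=
  @rep_of ((tag D).+1 * (tag E).+1).-1 (rep_tens (tagged D) (tagged E)).

Lemma rep_of_continuous n : continuous (@rep_of n).
Proof. exact: (@existT_continuous nat (fun k => rep R G k.+1)). Qed.

Lemma chu_dual_continuous (T : topologicalType) (f : chu_dual R G -> T) :
  (forall n, continuous (fun rho : rep R G n.+1 => f (rep_of rho))) ->
  continuous f.
Proof.
move=> cf [n rho] A nA; exact: (cf n rho A nA).
Qed.

End chu_dual.

Section quasi_dual.
Variables (R : realType) (G : topologicalGroupType).

(* In the last clause, A is the value of p at D: since p preserves the
   dimension, p (rep_of D) always has the form unitary_of A. *)
Definition quasi_representation :
    set {compact-open, chu_dual R G -> unitary_sum R} :=
  [set p : chu_dual R G -> unitary_sum R |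
    [/\ continuous p,
        forall D, tag (p D) = tag D,
        forall D E, p (chu_dsum D E) = usum_dsum (p D) (p E),
        forall D E, p (chu_tens D E) = usum_tens (p D) (p E) &
        forall n (D : rep R G n.+1) (M A : 'U[R]_n.+1),
          p (rep_of D) = unitary_of A ->
          p (rep_of (rep_conj M D)) = unitary_of (M^-1 * A * M)%g]].

Definition quasi_dual : Type := set_type quasi_representation.

HB.instance Definition _ := Topological.on quasi_dual.

Definition quasi_dual_fun (p : quasi_dual) : chu_dual R G -> unitary_sum R :=
  set_val p.

End quasi_dual.

Coercion quasi_dual_fun : quasi_dual >-> Funclass.

Section quasi_dual_group.
Context {R : realType} {G : topologicalGroupType}.
Implicit Types p q : quasi_dual R G.

Lemma quasi_dualP p : quasi_representation (p : chu_dual R G -> unitary_sum R).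
Proof. exact: set_mem (valP p). Qed.

Lemma quasi_dual_eq p q : p =1 q -> p = q.
Proof. by move=> pq; apply: val_inj; exact/funext. Qed.

Definition quasi_comp p n (D : rep R G n.+1) : 'U[R]_n.+1 :=
  tagged_as (unitary_of (1%g : 'U[R]_n.+1)) (p (rep_of D)).

Lemma quasi_compE p n (D : rep R G n.+1) :
  p (rep_of D) = unitary_of (quasi_comp p D).
Proof.
have [_ /(_ (rep_of D)) + _ _ _] := quasi_dualP p; rewrite /quasi_comp.
case: (p (rep_of D)) => k A /= ek; rewrite {k}ek in A *.
congr unitary_of; symmetry.
exact: (@tagged_asE _ _ (unitary_of (1%g : 'U[R]_n.+1)) A).
Qed.

Lemma quasi_comp_continuous p n : continuous (@quasi_comp p n).
Proof.
apply: continuous_unitary_of.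
rewrite (_ : (fun _ => _) = p \o @rep_of R G n); last first.
  by apply/funext => D /=; rewrite quasi_compE.
have [cp _ _ _ _] := quasi_dualP p => D.
by apply: continuous_comp; [exact: rep_of_continuous|exact: cp].
Qed.

Lemma quasi_comp_dsum p m n (D : rep R G m.+1) (E : rep R G n.+1) :
  @quasi_comp p (m.+1 + n.+1).-1 (rep_dsum D E) =
  unitary_dsum (quasi_comp p D) (quasi_comp p E).
Proof.
apply: (@unitary_of_inj _ (m.+1 + n.+1).-1); rewrite -quasi_compE.
have [_ _ /(_ (rep_of D) (rep_of E)) + _ _] := quasi_dualP p.
by rewrite !quasi_compE.
Qed.

Lemma quasi_comp_tens p m n (D : rep R G m.+1) (E : rep R G n.+1) :
  @quasi_comp p (m.+1 * n.+1).-1 (rep_tens D E) =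
  unitary_tens (quasi_comp p D) (quasi_comp p E).
Proof.
apply: (@unitary_of_inj _ (m.+1 * n.+1).-1); rewrite -quasi_compE.
have [_ _ _ /(_ (rep_of D) (rep_of E)) + _] := quasi_dualP p.
by rewrite !quasi_compE.
Qed.

Lemma quasi_comp_conj p n (M : 'U[R]_n.+1) (D : rep R G n.+1) :
  quasi_comp p (rep_conj M D) = (M^-1 * quasi_comp p D * M)%g.
Proof.
apply: unitary_of_inj; rewrite -quasi_compE.
by have [_ _ _ _] := quasi_dualP p; apply; exact: quasi_compE.
Qed.

Lemma quasi_representation_comp
    (f : forall n, rep R G n.+1 -> 'U[R]_n.+1) :
  (forall n, continuous (f n)) ->
  (forall m n (D : rep R G m.+1) (E : rep R G n.+1),
    f (m.+1 + n.+1).-1 (rep_dsum D E) = unitary_dsum (f m D) (f n E)) ->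
  (forall m n (D : rep R G m.+1) (E : rep R G n.+1),
    f (m.+1 * n.+1).-1 (rep_tens D E) = unitary_tens (f m D) (f n E)) ->
  (forall n (M : 'U[R]_n.+1) (D : rep R G n.+1),
    f n (rep_conj M D) = (M^-1 * f n D * M)%g) ->
  quasi_representation
    (fun D : chu_dual R G => unitary_of (f (tag D) (tagged D))).
Proof.
move=> cf fD fT fJ; split.
- apply: chu_dual_continuous => n D /=.
  by apply: continuous_comp; [exact: cf|exact: unitary_of_continuous].
- by [].
- by move=> [m D] [n E]; congr (unitary_of _); exact: fD.
- by move=> [m D] [n E]; congr (unitary_of _); exact: fT.
- by move=> n D M A /= /unitary_of_inj <-; congr (unitary_of _); exact: fJ.
Qed.

Fact quasi_one_subproof :
  quasi_representation (fun D : chu_dual R G => unitary_of (1%g : 'U[R]_(tag D).+1)).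
Proof.
apply: (quasi_representation_comp (f := fun n _ => 1%g)) => *.
- exact: cst_continuous.
- by rewrite unitary_dsum1.
- by rewrite unitary_tens1.
- by rewrite mulg1 mulVg.
Qed.

Fact quasi_mul_subproof p q :
  quasi_representation (fun D : chu_dual R G => usum_mul (p D) (q D)).
Proof.
have := @quasi_representation_comp
  (fun n D => (quasi_comp p D * quasi_comp q D)%g).
rewrite (_ : (fun D : chu_dual R G => usum_mul _ _) = fun D : chu_dual R G =>
  unitary_of (quasi_comp p (tagged D) * quasi_comp q (tagged D))%g); last first.
  by apply/funext => -[n D]; rewrite -usum_mulE -!quasi_compE.
apply.
- by move=> n; apply: mulg_continuous_comp; exact: quasi_comp_continuous.
- by move=> m n D E; rewrite !quasi_comp_dsum unitary_dsumM.
- by move=> m n D E; rewrite !quasi_comp_tens unitary_tensM.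
- by move=> n M D; rewrite !quasi_comp_conj !mulgA mulgK.
Qed.

Fact quasi_inv_subproof p :
  quasi_representation (fun D : chu_dual R G => usum_inv (p D)).
Proof.
have := @quasi_representation_comp (fun n D => (quasi_comp p D)^-1%g).
rewrite (_ : (fun D : chu_dual R G => usum_inv _) = fun D : chu_dual R G =>
  unitary_of (quasi_comp p (tagged D))^-1%g); last first.
  by apply/funext => -[n D]; rewrite [p _]quasi_compE.
apply.
- move=> n D; apply: continuous_comp; first exact: quasi_comp_continuous.
  exact: invg_continuous.
- by move=> m n D E; rewrite quasi_comp_dsum unitary_dsumV.
- by move=> m n D E; rewrite quasi_comp_tens unitary_tensV.
- by move=> n M D; rewrite quasi_comp_conj !invgM invgK mulgA.
Qed.

Definition mk_quasi (p : chu_dual R G -> unitary_sum R)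
    (pP : quasi_representation p) : quasi_dual R G :=
  exist _ (p : {compact-open, chu_dual R G -> unitary_sum R}) (mem_set pP).

Definition quasi_one : quasi_dual R G := mk_quasi quasi_one_subproof.

Definition quasi_mul p q : quasi_dual R G := mk_quasi (quasi_mul_subproof p q).

Definition quasi_inv p : quasi_dual R G := mk_quasi (quasi_inv_subproof p).

Let mulE p q n (D : rep R G n.+1) : quasi_mul p q (rep_of D) =
  unitary_of (quasi_comp p D * quasi_comp q D)%g.
Proof. by rewrite -usum_mulE -!quasi_compE. Qed.

Let compM p q n (D : rep R G n.+1) :
  quasi_comp (quasi_mul p q) D = (quasi_comp p D * quasi_comp q D)%g.
Proof. by apply: unitary_of_inj; rewrite -mulE quasi_compE. Qed.

Let comp1 n (D : rep R G n.+1) : quasi_comp quasi_one D = 1%g.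
Proof. by apply: unitary_of_inj; rewrite -quasi_compE. Qed.

Let compV p n (D : rep R G n.+1) :
  quasi_comp (quasi_inv p) D = (quasi_comp p D)^-1%g.
Proof.
apply: unitary_of_inj; rewrite -quasi_compE.
by rewrite -[LHS]/(usum_inv (p (rep_of D))) quasi_compE.
Qed.

Lemma quasi_comp_eq p q :
  (forall n (D : rep R G n.+1), quasi_comp p D = quasi_comp q D) -> p = q.
Proof.
by move=> e; apply: quasi_dual_eq => -[n D]; rewrite !(@quasi_compE _ n D) e.
Qed.

Fact quasi_mulA : associative quasi_mul.
Proof. by move=> p q r; apply: quasi_comp_eq => n D; rewrite !compM mulgA. Qed.

Fact quasi_mul1g : left_id quasi_one quasi_mul.
Proof.
by move=> p; apply: quasi_comp_eq => n D; rewrite compM comp1 mul1g.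
Qed.

Fact quasi_mulg1 : right_id quasi_one quasi_mul.
Proof.
by move=> p; apply: quasi_comp_eq => n D; rewrite compM comp1 mulg1.
Qed.

Fact quasi_mulVg : left_inverse quasi_one quasi_inv quasi_mul.
Proof.
by move=> p; apply: quasi_comp_eq => n D; rewrite compM compV comp1 mulVg.
Qed.

Fact quasi_mulgV : right_inverse quasi_one quasi_inv quasi_mul.
Proof.
by move=> p; apply: quasi_comp_eq => n D; rewrite compM compV comp1 mulgV.
Qed.

HB.instance Definition _ := isGroup.Build (quasi_dual R G)
  quasi_mulA quasi_mul1g quasi_mulg1 quasi_mulVg quasi_mulgV.

End quasi_dual_group.

Record is_bohr_compactification (G bG : topologicalGroupType) (b : G -> bG) :
    Prop := IsBohrCompactification {
  bohr_compact : compact [set: bG];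
  bohr_hausdorff : hausdorff_space bG;
  bohr_continuous : continuous b;
  bohr_morphism : {morph b : x y / (x * y)%g};
  bohr_dense : closure (range b) = [set: bG];
  bohr_universal : forall (K : topologicalGroupType) (h : G -> K),
    compact [set: K] -> hausdorff_space K ->
    continuous h -> {morph h : x y / (x * y)%g} ->
    exists hb : bG -> K,
      [/\ continuous hb, {morph hb : x y / (x * y)%g} & h = hb \o b]
}.

(* Main.v *)
(* Every representation rho of G extends to bG. Both conditions are equivalent
   to: sigma near rho (compact-open) implies sigma uniformly near rho.

   If the bidual X is isomorphic to bG, it is compact. As U(n) has no small
   subgroups and G is locally compact, rho has a compact neighbourhood in
   rep_n(G), so evaluation on X x rep_n(G) is continuous near X x {rho}, and
   compactness of X makes the points of X, among them the evaluations at points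
   of G, equicontinuous at rho. If sigma is uniformly near rho, the mean over bG
   of sigma(x) rho(x)^-1 is an invertible intertwiner, and the unitary part of
   its polar decomposition conjugates sigma to rho: classes are open.

   If the classes are open, then representations near rho are conjugate to rho
   by matrices near the stabiliser of rho in the compact group U(n), hence are
   uniformly near rho, and y |-> (rho |-> rho(y)) is a continuous morphism from
   bG to X. It is injective by Peter-Weyl. For surjectivity, a
   quasi-representation p commutes with intertwiners (by the Cayley transform of
   a hermitian block matrix) and with conjugation, so that tr(p(E) E(.)) and
   tr E have the same mean over bG. If p(D) were not in D(bG), then
   |1 + tr(p(D) D(.))|^2 would be bounded by some r < (1 + n)^2, while the mean
   of |1 + tr D|^(2k) outgrows r^k; but these k-th powers are the characters of
   tensor powers and have equal means. Compactness of bG and direct sums give a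
   point that works for all D at once. *)

Require Import Defs.
From HB Require Import structures.
From mathcomp Require Import all_boot all_order all_algebra.
From mathcomp Require Import spectral.
From mathcomp Require Import all_classical all_reals all_analysis.
From mathcomp Require Import complex mxtens.
From mathcomp Require Import ring lra.

Set Implicit Arguments.
Unset Strict Implicit.
Unset Printing Implicit Defensive.

Import Order.TTheory GRing.Theory Num.Theory.
Import numFieldNormedType.Exports.
Import Normc.

Local Open Scope classical_set_scope.
Local Open Scope ring_scope.

(** * Uniform limits and the Haar mean on a compact group *)

(** All analysis on bG is done with continuous functions: the mean is an ultrafilter limit of finite
    averages of translates, and its invariance, faithfulness and Fubini property come from
    compactness. Ultrafilters also replace subsequences, since neither bG nor rep_n(G) has to be
    metrizable. Real functions suffice for Peter-Weyl: an orthonormal family of real functions that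
    spans a translation-invariant space yields orthogonal matrices, hence a unitary representation.
    As continuous functions are not complete for the inner product, eigenfunctions are obtained as
    uniform limits of maximizing sequences. The 1 in 1 + tr D is there because |tr u| is maximal at
    many scalar matrices u, whereas |1 + tr u| is maximal at u = 1 only. Continuity of the
    isomorphism is proved for bG -> X; the inverse is then continuous because bG is compact and X is
    Hausdorff. *)

Section compact_functions.
Context {R : realType} {X : topologicalType}.
Hypothesis cX : compact [set: X].
Implicit Types f g : X -> R.

(** Tube lemma, applied below both to a compact group and to the compact bidual. *)
Lemma compact_tube (V : topologicalType) (P : V -> X -> Prop) (v0 : V) :
  (forall x : X, \forall x' \near x & v \near v0, P v x') ->
  \forall v \near v0, forall x, P v x.
Proof.
move=> h; have /compact_near_coveringP/(_ V (nbhs v0) P _) := cX.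
by move=> /(_ (fun x _ => h x)); apply: filterS => v Pv x; exact: Pv.
Qed.

Lemma tube_dist (V : topologicalType) (h : V * X -> R) (v0 : V) (e : R) :
  continuous h -> 0 < e ->
  \forall v \near v0, forall x, `|h (v, x) - h (v0, x)| < e.
Proof.
move=> ch e0; apply: (compact_tube (P := fun v x => `|h (v, x) - h (v0, x)| < e)) => x.
have e20 : 0 < e / 2 by lra.
have /cvgrPdist_lt/(_ _ e20) [[A B] /= [A1 B1] AB] := ch (v0, x).
exists (B, A) => // -[x' v] /= [Bx' Av].
have h1 := AB (v, x') (conj Av Bx').
have h2 := AB (v0, x') (conj (nbhs_singleton A1) Bx').
rewrite /= in h1 h2.
have -> : h (v, x') - h (v0, x') =
  (h (v0, x) - h (v0, x')) - (h (v0, x) - h (v, x')) by ring.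
rewrite (le_lt_trans (ler_normB _ _))//; lra.
Qed.

Lemma continuous_bounded f : continuous f -> exists B, forall x, `|f x| <= B.
Proof.
move=> cf; have : compact (f @` setT).
  by apply: continuous_compact => //; apply: continuous_subspaceT.
move=> /compact_bounded [M [_ /(_ (M + 1))]]; rewrite ltrDl => /(_ ltr01) h.
by exists (M + 1) => x; apply: h; exists x.
Qed.

(** The image of an ultrafilter is an ultrafilter, so its cluster point in a compact interval is a
    limit. *)
Lemma ultra_bounded_cvg (I : Type) (U : set_system I) (UU : UltraFilter U)
    (h : I -> R) (B : R) :
  (\forall i \near U, `|h i| <= B) -> exists l : R, h i @[i --> U] --> l.
Proof.
move=> hB; have /(_ (h @ U)) : compact `[- B, B] by exact: segment_compact.
have UI : UltraFilter (h @ U).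
  split; first exact: fmap_proper_filter.
  move=> G PG sub.
  apply/seteqP; split=> // A GA /=.
  have [//|nA] := in_ultra_setVsetC (h @^-1` A) UU.
  have /sub GnA : (h @ U) (~` A) by rewrite /= -preimage_setC.
  by case: (filter_ex (@filterI _ G (@filter_filter _ _ PG) _ _ GA GnA)) => ? [].
case.
  by move: hB; apply: filterS => i; rewrite /= in_itv /= ler_norml.
move=> l [_]; rewrite (_ : cluster _ l = [set p | h @ U --> p] l); last first.
  by rewrite -ultra_cvg_clusterE.
by exists l.
Qed.

(** Arzela-Ascoli along an ultrafilter: boundedness gives pointwise limits, equicontinuity passes to
    the limit, and compactness of X makes the convergence uniform. *)
Lemma ultra_uniform_limit (I : Type) (U : set_system I) (UU : UltraFilter U)
    (h : I -> X -> R) (B : R) :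
  (forall i x, `|h i x| <= B) ->
  (forall x (e : R), 0 < e -> \forall x' \near x, forall i, `|h i x' - h i x| <= e) ->
  exists g : X -> R, continuous g /\
    forall e : R, 0 < e -> \forall i \near U, forall x, `|h i x - g x| < e.
Proof.
move=> hB heq.
have /choice[g gl] : forall x, exists l : R, h i x @[i --> U] --> l.
  by move=> x; apply: (@ultra_bounded_cvg _ _ UU _ B); exact: nearW.
have geq x (e : R) : 0 < e -> \forall x' \near x, `|g x' - g x| <= e.
  move=> e0; near=> x'.
  have hx' : forall i, `|h i x' - h i x| <= e by near: x'; exact: heq.
  have /cvg_norm h1 : h i x' - h i x @[i --> U] --> g x' - g x.
    by apply: cvgB; exact: gl.
  by apply: (cvgr_to_le h1); exact: nearW.
exists g; split=> [x|e e0].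
  apply/cvgrPdist_le => e e0; near=> x'.
  by rewrite distrC; near: x'; exact: geq.
have /compact_near_coveringP/(_ I U (fun i x => `|h i x - g x| < e) _) := cX.
have h4 : 0 < e / 4 by lra.
move=> H; have : \forall i \near U, [set: X] `<=` fun x => `|h i x - g x| < e.
  apply: H => x _.
  exists ([set x' | (forall i, `|h i x' - h i x| <= e / 4) /\ `|g x' - g x| <= e / 4],
          [set i | `|g x - h i x| < e / 4]).
    split=> /=; last by have /cvgrPdist_lt/(_ _ h4) := gl x.
    by apply: filterI; [exact: heq|exact: geq].
  move=> [x' i] /= [[/(_ i) h1 h2] h3].
  have -> : h i x' - g x' = (h i x' - h i x) - (g x - h i x) - (g x' - g x) by ring.
  rewrite (le_lt_trans (ler_normB _ _))//.
  have := ler_normB (h i x' - h i x) (g x - h i x).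
  lra.
by apply: filterS => i Hi x; exact: Hi.
Unshelve. all: by end_near. Qed.

End compact_functions.

(** * The Haar mean as a limit of finite averages *)

Section haar_mean.
Context {R : realType} {K : topologicalGroupType}.
Hypothesis cK : compact [set: K].
Implicit Types (f g : K -> R) (s t : seq K).

Definition translate (x : K) f : K -> R := fun y => f (x * y)%g.

(** The points of s multiply on the right, so averaging commutes with left translation; this is the
    source of left invariance in [haar_translate]. *)
Definition average s f (x : K) : R :=
  (size s)%:R^-1 * \sum_(a <- s) f (x * a)%g.

Lemma continuous_invg_comp (T : topologicalType) (u : T -> K) :
  continuous u -> continuous (fun x => (u x)^-1%g).
Proof. by move=> cu x; apply: continuous_comp; [exact: cu|exact: invg_continuous]. Qed.

Lemma fst_continuous (S T : topologicalType) : continuous (@fst S T).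
Proof. by move=> x; exact: cvg_fst. Qed.

Lemma snd_continuous (S T : topologicalType) : continuous (@snd S T).
Proof. by move=> x; exact: cvg_snd. Qed.

Lemma continuous_comp_fun (S T V : topologicalType) (u : S -> T) (v : T -> V) :
  continuous u -> continuous v -> continuous (fun x => v (u x)).
Proof. by move=> cu cv x; apply: continuous_comp; [exact: cu|exact: cv]. Qed.

Lemma continuous_scale (T : topologicalType) (c : R) (f : T -> R) :
  continuous f -> continuous (fun x => c * f x).
Proof.
move=> cf; apply: (@continuous_comp_fun _ _ _ f (fun r => c * r)) => // r.
exact: mulrl_continuous.
Qed.

Lemma translate_continuous x f : continuous f -> continuous (translate x f).
Proof.
move=> cf; apply: continuous_comp_fun cf.
by apply: mulg_continuous_comp; [exact: cst_continuous|move=> ?; exact: cvg_id].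
Qed.

Lemma sum_osc f (o : R) s t x y : size s = size t ->
  (forall x y, f x - f y <= o) ->
  \sum_(a <- s) f (x * a)%g - \sum_(b <- t) f (y * b)%g <= (size s)%:R * o.
Proof.
move=> + fo; elim: s t => [|a s IHs] [|b t] //=.
  by rewrite !big_nil subr0 mul0r.
move=> [/IHs IH]; rewrite !big_cons -natr1.
by have := fo (x * a)%g (y * b)%g; lra.
Qed.

(** Averages are closed under composition, so contraction steps can be iterated. *)
Lemma average_avg s t f x :
  average t (average s f) x = average [seq (a * b)%g | a <- t, b <- s] f x.
Proof.
rewrite /average size_allpairs natrM invfM -mulrA; congr (_ * _).
rewrite -mulr_sumr; congr (_ * _); rewrite big_allpairs_dep.
by apply: eq_bigr => a _; apply: eq_bigr => b _; rewrite mulgA.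
Qed.

Lemma average_osc s f (o : R) : s != [::] -> (forall x y, f x - f y <= o) ->
  forall x y, average s f x - average s f y <= o.
Proof.
move=> s0 fo x y; rewrite -mulrBr ler_pdivrMl ?ltr0n ?lt0n ?size_eq0//.
exact: sum_osc.
Qed.

(** The modulus of continuity under left translation survives averaging, so the same V and t serve
    every iteration in [average_small_osc]. *)
Lemma average_translate_le s f (v : K) (e : R) : s != [::] ->
  (forall x, `|f (v * x)%g - f x| <= e) ->
  forall x, `|average s f (v * x)%g - average s f x| <= e.
Proof.
move=> s0 fe x; rewrite -mulrBr normrM ger0_norm ?invr_ge0//.
rewrite ler_pdivrMl ?ltr0n ?lt0n ?size_eq0// -sumrB.
elim: s {s0} => [|a s IHs]; first by rewrite big_nil normr0 mul0r.
rewrite big_cons /= -natr1 mulrDl mul1r addrC (le_trans (ler_normD _ _))//.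
by rewrite lerD// -mulgA.
Qed.

(* Every translate of V meets the finite set t, so averaging over t pairs a
   value of f near any given value with it and contracts the oscillation. *)
Lemma average_contract t (V : set K) f (o e : R) :
  (forall x y, exists2 a, a \in t & V (x * a * y^-1)%g) ->
  (forall v x, V v -> `|f (v * x)%g - f x| <= e) ->
  (forall x y, f x - f y <= o) ->
  forall x y, average t f x - average t f y <=
    (1 - (size t)%:R^-1) * o + (size t)%:R^-1 * e.
Proof.
move=> tV fe fo x y; have [b bt _] := tV 1%g 1%g.
have [a at_ Va] := tV x (y * b)%g.
have t0 : 0 < (size t)%:R :> R by rewrite ltr0n; case: (t) bt.
have Sa : size (rem a t) = (size t).-1 by rewrite size_rem.
have Sb : size (rem b t) = (size t).-1 by rewrite size_rem.
rewrite -mulrBr (perm_big _ (perm_to_rem at_)) (perm_big (b :: rem b t) (perm_to_rem bt)) /=.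
rewrite !big_cons.
have := @sum_osc f o (rem a t) (rem b t) x y (etrans Sa (esym Sb)) fo.
have := fe _ (y * b)%g Va; rewrite mulgVK.
rewrite ler_norml => /andP[_ h1]; rewrite Sa.
have -> : (size t).-1%:R = (size t)%:R - 1 :> R.
  by rewrite -subn1 natrB//; case: (t) bt.
move=> h2.
have -> : (1 - (size t)%:R^-1) * o + (size t)%:R^-1 * e =
   (size t)%:R^-1 * (((size t)%:R - 1) * o + e).
  by rewrite mulrDr mulrA mulrBr mulVf ?gt_eqF// mulr1.
by rewrite ler_pM2l ?invr_gt0//; lra.
Qed.

Lemma average_continuous s f : continuous f -> continuous (average s f).
Proof.
move=> cf; apply: (@continuous_comp_fun _ _ _ (fun x => \sum_(a <- s) f (x * a)%g)
  (fun r => (size s)%:R^-1 * r)); last by move=> r; exact: mulrl_continuous.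
move=> x; elim: s => [|a s IHs].
  by under eq_fun do rewrite big_nil; exact: cvg_cst.
under eq_fun do rewrite big_cons.
apply: continuousD; last exact: IHs.
apply: (@continuous_comp_fun _ _ _ (fun y => (y * a)%g)) => //.
by apply: mulg_continuous_comp; [move=> ?; exact: cvg_id|exact: cst_continuous].
Qed.

Lemma finite_translate_cover (V : set K) : nbhs 1%g V ->
  exists t, forall x y : K, exists2 a, a \in t & V (x * a * y^-1)%g.
Proof.
move=> V1; pose O (a : K) := [set xy : K * K | (V^° (xy.1 * a * xy.2^-1)%g)].
have cKK : compact [set: K * K] by rewrite -setXTT; exact: compact_setX.
(* The filter of sequences containing any given finite set: with it, the near-covering form of
   compactness of [K * K] returns one t. Around (x, y) the point [x^-1 * y] does the job, as it
   sends [x * a * y^-1] to 1. *)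
pose F : set_system (seq K) := filter_from setT (fun s0 => [set s : seq K | {subset s0 <= s}]).
have FF : Filter F.
  apply: filter_from_filter; first by exists [::].
  move=> s t _ _; exists (s ++ t) => // u /= stu.
  by split=> a ain; apply: stu; rewrite mem_cat ain ?orbT.
have /compact_near_coveringP/(_ _ F
  (fun t xy => exists2 a, a \in t & V (xy.1 * a * xy.2^-1)%g) FF) := cKK.
case=> [[x y] _|t _ tV].
  exists (O (x^-1 * y)%g, [set t : seq K | (x^-1 * y)%g \in t]); last first.
    by move=> [xy t] /= [/interior_subset Oxy ty]; exists (x^-1 * y)%g.
  split; last by exists [:: (x^-1 * y)%g] => // t; apply; rewrite inE.
  apply: open_nbhs_nbhs; split; last first.
    by rewrite /O /= mulgA mulgV mul1g mulgV.
  have /continuousP : continuous (fun xy : K * K => (xy.1 * (x^-1 * y) * xy.2^-1)%g).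
    apply: mulg_continuous_comp; last first.
      by apply: continuous_invg_comp; exact: snd_continuous.
    by apply: mulg_continuous_comp; [exact: fst_continuous|exact: cst_continuous].
  by apply; exact: open_interior.
by exists t => x y; exact: (tV t (fun=> id) (x, y)).
Qed.

Lemma average_small_osc f (e : R) : continuous f -> 0 < e ->
  exists s, s != [::] /\ forall x y, average s f x - average s f y <= e.
Proof.
move=> cf e0; have e20 : 0 < e / 2 by lra.
pose V := [set v : K | forall x, `|f (v * x)%g - f x| <= e / 2].
have V1 : nbhs 1%g V.
  have ch : continuous (fun vx : K * K => f (vx.1 * vx.2)%g).
    by apply: continuous_comp_fun cf; exact: mulg_continuous.
  have := @tube_dist _ _ cK K _ 1%g _ ch e20.
  by apply: filterS => v Av x; have := Av x; rewrite /= mul1g => /ltW.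
have [t tV] := finite_translate_cover V1.
have t0 : t != [::] by have [a] := tV 1%g 1%g; case: (t).
have [B fB] := continuous_bounded cK cf.
pose r := 1 - (size t)%:R^-1 : R.
have st : 1 <= (size t)%:R :> R by rewrite ler1n lt0n size_eq0.
have r0 : 0 <= r by rewrite /r subr_ge0 invf_le1// (lt_le_trans ltr01).
have r1 : `|r| < 1.
  by rewrite ger0_norm// /r ltrBlDr ltrDl invr_gt0 (lt_le_trans ltr01).
(* The map [o |-> r * o + (1 - r) * (e / 2)] of [average_contract] has fixed point [e / 2] and ratio
   r; the initial oscillation is at most [2 * B]. *)
have H j : exists s, [/\ s != [::], (forall v x, V v -> `|average s f (v * x)%g - average s f x| <= e / 2)
   & forall x y, average s f x - average s f y <= (2 * B) * r ^+ j + e / 2].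
  elim: j => [|j [s [s0 sV so]]].
    exists [:: 1%g]; split=> // [v x Vv|x y].
      exact: average_translate_le.
    apply: average_osc => // {}x {}y; rewrite expr0 mulr1.
    have := fB x; have := fB y; rewrite !ler_norml; lra.
  exists [seq (a * b)%g | a <- t, b <- s].
  split.
  - by rewrite -size_eq0 size_allpairs muln_eq0 !size_eq0 negb_or t0.
  - move=> v x Vv; rewrite -!average_avg; apply: average_translate_le => // {}x.
    exact: sV.
  - move=> x y; rewrite -!average_avg.
    apply: le_trans (average_contract tV sV so x y) _.
    have -> : (size t)%:R^-1 = 1 - r by rewrite /r; ring.
    rewrite exprS le_eqVlt; apply/orP; left; apply/eqP; ring.
have : (2 * B) * r ^+ j @[j --> \oo] --> (2 * B) * 0.
  by apply: cvgMr; exact: cvg_expr.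
rewrite mulr0 => /cvgrPdist_lt/(_ _ e20)[j _ /(_ j (leqnn j))] /=.
rewrite sub0r normrN => hj; have [s [s0 _ so]] := H j.
exists s; split=> // x y; apply: le_trans (so x y) _.
have := ler_norm ((2 * B) * r ^+ j); lra.
Qed.

(** One mean has to serve all continuous functions, so the base consists of the sequences that
    flatten finitely many functions simultaneously. *)
Definition averaging_filter : set_system (seq K) :=
  filter_from [set le : seq (K -> R) * R |
      (forall f, f \in le.1 -> continuous f) /\ 0 < le.2]
    (fun le => [set s : seq K | s != [::] /\
      forall f, f \in le.1 -> forall x y, average s f x - average s f y <= le.2]).

(** If s flattens the functions of l and t flattens [average s f], the products flatten both: by
    [average_osc] a further averaging does not increase oscillation. *)
Lemma averaging_filter_proper : ProperFilter averaging_filter.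
Proof.
apply: filter_from_proper; last first.
  move=> [l e] /= [lc e0]; elim: l lc => [|f l IHl] lc.
    by exists [:: 1%g].
  have [s [s0 so]] : [set s : seq K | s != [::] /\
      forall f, f \in l -> forall x y, average s f x - average s f y <= e] !=set0.
    by apply: IHl => g gl; apply: lc; rewrite inE gl orbT.
  have cf : continuous (average s f).
    by apply: average_continuous; apply: lc; rewrite mem_head.
  have [t [t0 fo]] := average_small_osc cf e0.
  exists [seq (a * b)%g | a <- t, b <- s]; split.
    by rewrite -size_eq0 size_allpairs muln_eq0 !size_eq0 negb_or t0.
  move=> g; rewrite inE => /predU1P[->|gl] x y; rewrite -!average_avg//.
  by apply: average_osc => //; exact: so.
apply: filter_from_filter; first by exists ([::], 1); split=> //=.
move=> [l e] [l' e'] /= [lc e0] [lc' e0'].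
exists (l ++ l', Num.min e e'); first split=> /= [f|].
- by rewrite mem_cat => /orP[/lc|/lc'].
- by rewrite lt_min e0.
move=> s /= [s0 sl]; split; split=> // f fl x y.
  have := sl f; rewrite mem_cat fl => /(_ isT x y).
  by rewrite le_min => /andP[].
have := sl f; rewrite mem_cat fl orbT => /(_ isT x y).
by rewrite le_min => /andP[].
Qed.

Definition averaging_ultrafilter : set_system (seq K) :=
  sval (cid (@ultraFilterLemma _ _ averaging_filter_proper)).

Local Notation U := averaging_ultrafilter.

Lemma averaging_ultrafilterP : UltraFilter U.
Proof. by rewrite /U; case: cid => ? []. Qed.

Lemma averaging_ultrafilter_sub : averaging_filter `<=` U.
Proof. by rewrite /U; case: cid => ? []. Qed.

Local Instance averaging_ultrafilter_proper : ProperFilter U.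
Proof. by have [] := averaging_ultrafilterP. Qed.

Lemma averaging_nonempty : \forall s \near U, s != [::].
Proof.
apply: averaging_ultrafilter_sub; exists ([::], 1) => /=; first by split.
by move=> s [].
Qed.

Lemma averaging_osc f (e : R) : continuous f -> 0 < e ->
  \forall s \near U, forall x y, average s f x - average s f y <= e.
Proof.
move=> cf e0; apply: averaging_ultrafilter_sub; exists ([:: f], e) => /=.
  by split=> // g; rewrite inE => /eqP->.
by move=> s [_ /(_ f)]; rewrite mem_head => /(_ isT).
Qed.

Lemma average_bounded s f (B : R) x : (forall x, `|f x| <= B) ->
  s != [::] -> `|average s f x| <= B.
Proof.
move=> fB s0; rewrite /average normrM ger0_norm ?invr_ge0//.
rewrite ler_pdivrMl ?ltr0n ?lt0n ?size_eq0//.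
elim: s {s0} => [|a s IHs]; first by rewrite big_nil normr0 mul0r.
rewrite big_cons /= -natr1 mulrDl mul1r addrC (le_trans (ler_normD _ _))//.
by rewrite lerD.
Qed.

Definition haar f : R := lim (average s f 1%g @[s --> U]).

(** Along U the averages of f become nearly constant, so the limit taken at 1 in [haar] is the limit
    at every x. *)
Lemma haar_cvg f x : continuous f -> average s f x @[s --> U] --> haar f.
Proof.
move=> cf; have [B fB] := continuous_bounded cK cf.
have UU := averaging_ultrafilterP.
have [l ll] : exists l : R, average s f 1%g @[s --> U] --> l.
  apply: (@ultra_bounded_cvg _ _ _ UU _ B).
  by apply: filterS averaging_nonempty => s; exact: average_bounded.
have -> : haar f = l by apply/cvg_lim => //; exact: Rhausdorff.
apply/cvgrPdist_le => e e0; have e20 : 0 < e / 2 by lra.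
near=> s.
have h1 : `|l - average s f 1%g| <= e / 2.
  by near: s; move/cvgrPdist_le : ll; exact.
have h2 : forall x y, average s f x - average s f y <= e / 2.
  by near: s; exact: averaging_osc.
move: h1 (h2 x 1%g) (h2 1%g x); rewrite !ler_norml; lra.
Unshelve. all: by end_near. Qed.

Lemma haar_uniq f l x : continuous f ->
  average s f x @[s --> U] --> l -> haar f = l.
Proof.
move=> cf fl; apply: (cvg_unique (@Rhausdorff R) (haar_cvg x cf) fl).
Qed.

Lemma haarD f g : continuous f -> continuous g ->
  haar (fun x => f x + g x) = haar f + haar g.
Proof.
move=> cf cg; apply: (@haar_uniq _ _ 1%g).
  by move=> x; exact: (cvgD (cf x) (cg x)).
rewrite (_ : (fun s => _) = (fun s => average s f 1%g + average s g 1%g)).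
  by apply: cvgD; exact: haar_cvg.
by apply/funext => s; rewrite /average -mulrDr -big_split.
Qed.

Lemma haarZ (c : R) f : continuous f -> haar (fun x => c * f x) = c * haar f.
Proof.
move=> cf; apply: (@haar_uniq _ _ 1%g).
  exact: continuous_scale.
rewrite (_ : (fun s => _) = (fun s => c * average s f 1%g)).
  by apply: continuous_cvg; [exact: mulrl_continuous|exact: haar_cvg].
by apply/funext => s; rewrite /average mulrCA -mulr_sumr.
Qed.

Lemma haar_cst (c : R) : haar (fun=> c) = c.
Proof.
apply: (@haar_uniq _ _ 1%g); first exact: cst_continuous.
apply: cvg_near_cst; apply: filterS averaging_nonempty => s s0.
rewrite /average big_const_seq count_predT iter_addr_0 -[c *+ _]mulr_natl mulrA.
by rewrite mulVf ?mul1r// pnatr_eq0 size_eq0.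
Qed.

Lemma haar_sum I (r : seq I) (F : I -> K -> R) : (forall i, continuous (F i)) ->
  haar (fun x => \sum_(i <- r) F i x) = \sum_(i <- r) haar (F i) /\
  continuous (fun x => \sum_(i <- r) F i x).
Proof.
move=> cF; elim: r => [|i r [IH cIH]].
  have -> : (fun x => \sum_(i <- [::]) F i x) = fun=> 0.
    by apply/funext => x; rewrite big_nil.
  by rewrite haar_cst big_nil; split=> //; exact: cst_continuous.
have -> : (fun x => \sum_(j <- i :: r) F j x) =
    fun x => F i x + \sum_(j <- r) F j x.
  by apply/funext => x; rewrite big_cons.
split; first by rewrite haarD// IH big_cons.
by move=> x; exact: (cvgD (cF i x) (cIH x)).
Qed.

Lemma haar_ge0 f : continuous f -> (forall x, 0 <= f x) -> 0 <= haar f.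
Proof.
move=> cf f0; apply: (cvgr_to_ge (haar_cvg 1%g cf)); apply: nearW => s.
by rewrite mulr_ge0 ?invr_ge0// sumr_ge0.
Qed.

Lemma haarB f g : continuous f -> continuous g ->
  haar (fun x => f x - g x) = haar f - haar g.
Proof.
move=> cf cg; rewrite -[X in _ = _ + X]mulN1r -haarZ// -haarD//.
  by congr haar; apply/funext => x; rewrite mulN1r.
exact: continuous_scale.
Qed.

Lemma haar_le f g : continuous f -> continuous g ->
  (forall x, f x <= g x) -> haar f <= haar g.
Proof.
move=> cf cg fg; rewrite -subr_ge0 -haarB//; apply: haar_ge0.
  by move=> x; exact: (cvgB (cg x) (cf x)).
by move=> x; rewrite subr_ge0.
Qed.

Lemma haar_norm f (B : R) : continuous f -> (forall x, `|f x| <= B) ->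
  `|haar f| <= B.
Proof.
move=> cf fB; rewrite ler_norml -{2}(haar_cst B) -(haar_cst (- B)).
by apply/andP; split; apply: haar_le => //; (try exact: cst_continuous) => x;
   have := fB x; rewrite ler_norml => /andP[].
Qed.

Lemma haar_translate x f : continuous f -> haar (fun y => f (x * y)%g) = haar f.
Proof.
move=> cf; apply: (@haar_uniq _ _ 1%g); first exact: translate_continuous.
rewrite (_ : (fun s => _) = (fun s => average s f x)); first exact: haar_cvg.
by apply/funext => s; rewrite /average; under eq_bigr do rewrite mul1g.
Qed.

(** Finitely many left translates of f add up to a function that is everywhere at least [f x / 2],
    and they all have the mean of f. *)
Lemma haar_gt0 f x : continuous f -> (forall x, 0 <= f x) -> 0 < f x ->
  0 < haar f.
Proof.
move=> cf f0 fx0.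
have [|t tV] := @finite_translate_cover [set v | f x / 2 < f (v * x)%g].
  have : continuous (fun v => f (v * x)%g).
    apply: continuous_comp_fun cf.
    by apply: mulg_continuous_comp; [move=> ?; exact: cvg_id|exact: cst_continuous].
  move=> /(_ 1%g)/cvgrPdist_lt/(_ (f x / 2)); rewrite mul1g divr_gt0// => /(_ isT).
  by apply: filterS => v /=; rewrite ltr_norml; lra.
have ct a : continuous (fun y => f (a * y)%g) by exact: translate_continuous.
have [h1 h2] := @haar_sum _ t (fun a y => f (a * y)%g) ct.
have : f x / 2 <= haar (fun y => \sum_(a <- t) f (a * y)%g).
  rewrite -[leLHS]haar_cst; apply: haar_le => //; first exact: cst_continuous.
  move=> y; have [a at_] := tV 1%g (x * y^-1)%g.
  rewrite /= mul1g invgM invgK mulgA mulgVK => /ltW h.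
  rewrite (perm_big _ (perm_to_rem at_)) big_cons /= (le_trans h)//.
  by rewrite lerDl sumr_ge0.
rewrite h1; under eq_bigr do rewrite haar_translate//.
rewrite big_const_seq count_predT iter_addr_0.
have := haar_ge0 cf f0; rewrite le_eqVlt => /predU1P[<-|//].
by rewrite mul0rn; lra.
Qed.

Lemma haar_param_continuous (V : topologicalType) (h : V * K -> R) :
  continuous h -> continuous (fun v => haar (fun x => h (v, x))).
Proof.
move=> ch v; apply/cvgrPdist_le => e e0.
have c1 w : continuous (fun x => h (w, x)).
  apply: continuous_comp_fun ch => x; apply: cvg_pair => /=.
    exact: cvg_cst.
  exact: cvg_id.
have := @tube_dist _ _ cK V h v e ch e0; apply: filterS => w hw.
rewrite distrC -haarB//; apply: haar_norm.
  by move=> x; exact: (cvgB (c1 w x) (c1 v x)).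
by move=> x; exact/ltW/hw.
Qed.

(** Finite averages over y commute with the mean over x, and by compactness they converge to the
    mean over y uniformly in x. *)
Lemma haar_fubini (h : K * K -> R) : continuous h ->
  haar (fun x => haar (fun y => h (x, y))) = haar (fun y => haar (fun x => h (x, y))).
Proof.
move=> ch; pose h' (xy : K * K) := h (xy.2, xy.1).
have ch' : continuous h'.
  apply: continuous_comp_fun ch => x; apply: cvg_pair => /=.
    exact: cvg_snd.
  exact: cvg_fst.
have c1 x : continuous (fun y => h (x, y)).
  apply: continuous_comp_fun ch => y; apply: cvg_pair => /=.
    exact: cvg_cst.
  exact: cvg_id.
have c2 y : continuous (fun x => h (x, y)).
  apply: continuous_comp_fun ch => x; apply: cvg_pair => /=.
    exact: cvg_id.
  exact: cvg_cst.
have cH := haar_param_continuous ch.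
have cH' := haar_param_continuous ch'.
have cA s : continuous (fun x => average s (fun y => h (x, y)) 1%g).
  apply: (@continuous_comp_fun _ _ _ (fun x => \sum_(a <- s) h (x, 1 * a)%g)
    (fun r => (size s)%:R^-1 * r)); last by move=> r; exact: mulrl_continuous.
  by have [] := @haar_sum _ s (fun a x => h (x, 1 * a)%g).
apply/esym; apply: (@haar_uniq _ _ 1%g) => //.
apply/cvgrPdist_le => e e0; have e20 : 0 < e / 2 by lra.
have UU := averaging_ultrafilterP.
have : \forall s \near U, forall x, `|average s (fun y => h (x, y)) 1%g -
    haar (fun y => h (x, y))| <= e.
  suff : \forall s \near U, [set: K] `<=` (fun x => `|average s (fun y => h (x, y)) 1%g -
    haar (fun y => h (x, y))| <= e).
    by apply: filterS => s hs x; exact: hs.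
  have e30 : 0 < e / 3 by lra.
  have /compact_near_coveringP/(_ _ U (fun s x => `|average s (fun y => h (x, y)) 1%g -
    haar (fun y => h (x, y))| <= e) _) := cK; apply => x _.
  exists ([set x' | (forall y, `|h (x', y) - h (x, y)| < e / 3) /\
         `|haar (fun y => h (x, y)) - haar (fun y => h (x', y))| < e / 3],
    [set s | s != [::] /\
       `|haar (fun y => h (x, y)) - average s (fun y => h (x, y)) 1%g| < e / 3]) => /=.
    split; first apply: filterI.
    - exact: tube_dist.
    - by have /cvgrPdist_lt/(_ _ e30) := cH x.
    apply: filterI; first exact: averaging_nonempty.
    by have /cvgrPdist_lt/(_ _ e30) := haar_cvg 1%g (c1 x).
  move=> [x' s] /= [[h1 h2] [s0 h3]].
  have h4 : `|average s (fun y => h (x', y)) 1%g - average s (fun y => h (x, y)) 1%g| <= e / 3.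
    have -> : average s (fun y => h (x', y)) 1%g - average s (fun y => h (x, y)) 1%g =
      average s (fun y => h (x', y) - h (x, y)) 1%g.
      by rewrite /average -mulrBr -sumrB.
    by apply: average_bounded => // y; exact/ltW/h1.
  move: h2 h3 h4; rewrite !ler_norml !ltr_norml; lra.
apply: filterS => s hs.
have -> : average s (fun y => haar (fun x => h (x, y))) 1%g =
  haar (fun x => average s (fun y => h (x, y)) 1%g).
  rewrite /average haarZ; last by have [] := @haar_sum _ s (fun a x => h (x, 1 * a)%g).
  by congr (_ * _); have [|->] := @haar_sum _ s (fun a x => h (x, 1 * a)%g).
rewrite distrC -haarB//; apply: haar_norm => //.
by move=> x; exact: (cvgB (cA s x) (cH x)).
Qed.

End haar_mean.

(** * The inner product given by the mean, and uniform convergence *)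

Section uniform_limits.
Context {R : realType} {K : topologicalGroupType}.
Hypothesis cK : compact [set: K].
Implicit Types (f g : K -> R).
Local Notation E := (haar cK).

Lemma continuous_mulr (T : topologicalType) (f g : T -> R) :
  continuous f -> continuous g -> continuous (fun x => f x * g x).
Proof. by move=> cf cg x; exact: (cvgM (cf x) (cg x)). Qed.

Lemma continuous_addr (T : topologicalType) (f g : T -> R) :
  continuous f -> continuous g -> continuous (fun x => f x + g x).
Proof. by move=> cf cg x; exact: (cvgD (cf x) (cg x)). Qed.

Lemma continuous_subr (T : topologicalType) (f g : T -> R) :
  continuous f -> continuous g -> continuous (fun x => f x - g x).
Proof. by move=> cf cg x; exact: (cvgB (cf x) (cg x)). Qed.

Definition ucvg (I : Type) (U : set_system I) (h : I -> K -> R) g :=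
  forall e : R, 0 < e -> \forall i \near U, forall x, `|h i x - g x| < e.

Lemma haar_ucvg (I : Type) (U : set_system I) (FU : Filter U)
    (h : I -> K -> R) g : (forall i, continuous (h i)) -> continuous g ->
  ucvg U h g -> E (h i) @[i --> U] --> E g.
Proof.
move=> ch cg hg; apply/cvgrPdist_le => e e0.
apply: filterS (hg e e0) => i hi; rewrite distrC -haarB//.
apply: haar_norm; first exact: continuous_subr.
by move=> x; exact/ltW/hi.
Qed.

Lemma ucvgM (I : Type) (U : set_system I) (FU : Filter U)
    (h h' : I -> K -> R) g g' : continuous g -> continuous g' ->
  ucvg U h g -> ucvg U h' g' ->
  ucvg U (fun i x => h i x * h' i x) (fun x => g x * g' x).
Proof.
move=> cg cg' hg hg' e e0.
have [B gB] := continuous_bounded cK cg.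
have [B' gB'] := continuous_bounded cK cg'.
have B0 : 0 <= B by apply: le_trans (gB 1%g).
have B0' : 0 <= B' by apply: le_trans (gB' 1%g).
pose d := Num.min 1 (e / (2 * (B + B' + 1))).
have d0 : 0 < d by rewrite lt_min ltr01 /= divr_gt0// mulr_gt0//; lra.
have d1 : d <= 1 by rewrite ge_min lexx.
have de : d * (B + B' + 1) <= e / 2.
  have -> : e / 2 = e / (2 * (B + B' + 1)) * (B + B' + 1) by field; lra.
  by rewrite ler_pM2r; [rewrite ge_min lexx orbT|lra].
apply: filterS (filterI (hg d d0) (hg' d d0)) => i [h1 h2] x.
have {h1} h1 := h1 x; have {h2} h2 := h2 x.
have -> : h i x * h' i x - g x * g' x =
  (h i x - g x) * (h' i x - g' x) + (h i x - g x) * g' x + g x * (h' i x - g' x).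
  by ring.
move: (h i x - g x) (h' i x - g' x) h1 h2 => u v h1 h2.
apply: (@le_lt_trans _ _ (d * (1 + B' + B))); last by lra.
rewrite !mulrDr mulr1 (le_trans (ler_normD _ _))// lerD//; last first.
  by rewrite normrM mulrC ler_pM// ltW.
rewrite (le_trans (ler_normD _ _))// lerD//; last first.
  by rewrite normrM ler_pM// ltW.
by rewrite normrM -[leRHS]mulr1 ler_pM//; lra.
Qed.

Definition ip f g : R := E (fun x => f x * g x).

Lemma ip_ucvg (I : Type) (U : set_system I) (FU : Filter U)
    (h h' : I -> K -> R) g g' : (forall i, continuous (h i)) ->
  (forall i, continuous (h' i)) -> continuous g -> continuous g' ->
  ucvg U h g -> ucvg U h' g' -> ip (h i) (h' i) @[i --> U] --> ip g g'.
Proof.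
move=> ch ch' cg cg' hg hg'; apply: haar_ucvg.
- by move=> i; exact: continuous_mulr.
- exact: continuous_mulr.
- exact: ucvgM.
Qed.

Lemma ucvg_cst (I : Type) (U : set_system I) (FU : Filter U) g :
  ucvg U (fun=> g) g.
Proof. by move=> e e0; apply: nearW => i x; rewrite subrr normr0. Qed.

Lemma ipC f g : ip f g = ip g f.
Proof. by congr haar; apply/funext => x; rewrite mulrC. Qed.

Lemma ipZl (c : R) f g : continuous f -> continuous g ->
  ip (fun x => c * f x) g = c * ip f g.
Proof.
move=> cf cg; rewrite -haarZ; last exact: continuous_mulr.
by congr haar; apply/funext => x; rewrite mulrA.
Qed.

Lemma ipBl f g h : continuous f -> continuous g -> continuous h ->
  ip (fun x => f x - g x) h = ip f h - ip g h.
Proof.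
move=> cf cg ch; rewrite -haarB; try exact: continuous_mulr.
by congr haar; apply/funext => x; rewrite mulrBl.
Qed.

Lemma ip_suml n (c : 'I_n -> R) (e : 'I_n -> K -> R) g :
  (forall i, continuous (e i)) -> continuous g ->
  ip (fun x => \sum_i c i * e i x) g = \sum_i c i * ip (e i) g.
Proof.
move=> ce cg.
have [|h _] := @haar_sum _ _ cK _ (index_enum 'I_n) (fun i x => c i * (e i x * g x)).
  by move=> i; apply: continuous_scale; exact: continuous_mulr.
transitivity (\sum_i E (fun x => c i * (e i x * g x))).
  rewrite -h; congr haar; apply/funext => x; rewrite mulr_suml.
  by apply: eq_bigr => i _; rewrite mulrA.
by apply: eq_bigr => i _; rewrite haarZ//; exact: continuous_mulr.
Qed.

Lemma continuous_lincomb n (c : 'I_n -> R) (e : 'I_n -> K -> R) :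
  (forall i, continuous (e i)) -> continuous (fun x => \sum_i c i * e i x).
Proof.
move=> ce; have [|_ //] := @haar_sum _ _ cK _ (index_enum 'I_n) (fun i x => c i * e i x).
by move=> i; exact: continuous_scale.
Qed.

Lemma ip_ge0 f : continuous f -> 0 <= ip f f.
Proof.
move=> cf; apply: haar_ge0; first exact: continuous_mulr.
by move=> x; rewrite -expr2 sqr_ge0.
Qed.

Lemma ip_eq0 f : continuous f -> ip f f <= 0 -> f = fun=> 0.
Proof.
move=> cf f0; apply/funext => x; apply/eqP/negPn/negP => fx0.
have : 0 < ip f f.
  apply: (@haar_gt0 _ _ _ _ x) => [||]; first exact: continuous_mulr.
    by move=> y; rewrite -expr2 sqr_ge0.
  by rewrite -expr2 lt_neqAle sqr_ge0 eq_sym sqrf_eq0 fx0.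
by rewrite ltNge f0.
Qed.

Lemma ip_cauchy_schwarz f g : continuous f -> continuous g ->
  ip f g ^+ 2 <= ip f f * ip g g.
Proof.
move=> cf cg; have [g0|g0] := leP (ip g g) 0.
  have gE := ip_eq0 cg g0; have -> : ip f g = 0.
    by rewrite /ip gE -[RHS](haar_cst cK); congr haar; apply/funext => x; rewrite mulr0.
  by rewrite expr0n mulr_ge0 ?ip_ge0.
pose t := ip f g / ip g g.
have ctg : continuous (fun x => t * g x) by exact: continuous_scale.
have c1 : continuous (fun x => f x - t * g x) by exact: continuous_subr.
have := ip_ge0 c1; rewrite ipBl// ipZl// ![ip _ (fun x => f x - _)]ipC !ipBl// !ipZl//.
rewrite (ipC g f) => h.
have -> : ip f f * ip g g = ip f g ^+ 2 + ip g g * (ip f f - t * ip f g - t * (ip f g - t * ip g g)).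
  by rewrite /t; field; lra.
by rewrite lerDl mulr_ge0// ltW.
Qed.

Lemma ip_translate x f g : continuous f -> continuous g ->
  ip (translate x f) (translate x g) = ip f g.
Proof. by move=> cf cg; rewrite {2}/ip -(haar_translate cK x)//; exact: continuous_mulr. Qed.

End uniform_limits.

(** * The Peter-Weyl theorem *)

Section convolution.
Context {R : realType} {K : topologicalGroupType}.
Hypothesis cK : compact [set: K].
Implicit Types (f g : K -> R).
Variable k : K -> R.
Hypothesis ck : continuous k.
Hypothesis symk : forall x, k (x^-1)%g = k x.
Local Notation E := (haar cK).
Local Notation ip := (ip cK).

(** A kernel in [x^-1 * y] makes the operator commute with left translations, and [symk] makes it
    self-adjoint. *)
Definition conv f : K -> R := fun x => E (fun y => k (x^-1 * y)%g * f y).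

Let c2 f : continuous f ->
  continuous (fun xy : K * K => k (xy.1^-1 * xy.2)%g * f xy.2).
Proof.
move=> cf; apply: continuous_mulr.
  apply: continuous_comp_fun ck; apply: mulg_continuous_comp; last exact: snd_continuous.
  by apply: continuous_invg_comp; exact: fst_continuous.
by apply: continuous_comp_fun cf; exact: snd_continuous.
Qed.

Let ckx x : continuous (fun y => k (x^-1 * y)%g).
Proof. exact: translate_continuous. Qed.

Lemma conv_continuous f : continuous f -> continuous (conv f).
Proof. by move=> cf; exact: (@haar_param_continuous _ _ cK _ _ (c2 cf)). Qed.

Lemma conv_sym f g : continuous f -> continuous g -> ip (conv f) g = ip f (conv g).
Proof.
move=> cf cg.
transitivity (E (fun x => E (fun y => (k (x^-1 * y)%g * f y) * g x))).
  congr haar; apply/funext => x; rewrite mulrC -haarZ; last exact: continuous_mulr.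
  by congr haar; apply/funext => y; rewrite mulrC.
rewrite (@haar_fubini _ _ cK (fun xy => (k (xy.1^-1 * xy.2)%g * f xy.2) * g xy.1)).
  congr haar; apply/funext => y; rewrite -haarZ; last exact: continuous_mulr.
  congr haar; apply/funext => x /=.
  by rewrite -(symk (x^-1 * y)%g) invgM invgK; ring.
apply: continuous_mulr; first exact: c2.
by apply: continuous_comp_fun cg; exact: fst_continuous.
Qed.

Lemma conv_translate z f : continuous f ->
  conv (translate z f) = translate z (conv f).
Proof.
move=> cf; apply/funext => x; rewrite /translate /conv.
rewrite -[RHS](haar_translate cK z); last exact: continuous_mulr.
by congr haar; apply/funext => y; rewrite invgM -!mulgA mulKg.
Qed.

Lemma convB f g : continuous f -> continuous g ->
  conv (fun x => f x - g x) = fun x => conv f x - conv g x.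
Proof.
move=> cf cg; apply/funext => x; rewrite /conv -haarB; try exact: continuous_mulr.
by congr haar; apply/funext => y; rewrite mulrBr.
Qed.

Lemma convZ (c : R) f : continuous f ->
  conv (fun x => c * f x) = fun x => c * conv f x.
Proof.
move=> cf; apply/funext => x; rewrite /conv -haarZ; last exact: continuous_mulr.
by congr haar; apply/funext => y; rewrite mulrCA.
Qed.

Lemma conv_sqr_le f x : continuous f -> conv f x ^+ 2 <= ip k k * ip f f.
Proof.
move=> cf; rewrite -(ip_translate cK (x^-1)%g ck ck).
exact: ip_cauchy_schwarz.
Qed.

(** Compactness of the operator: by Cauchy-Schwarz the modulus of continuity of [conv f] is
    controlled by k and [ip f f]. *)
Lemma conv_equicontinuous x (e : R) : 0 < e ->
  \forall y \near x, forall f, continuous f -> ip f f <= 1 -> `|conv f y - conv f x| <= e.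
Proof.
move=> e0.
have ch : continuous (fun xy : K * K => k (xy.1^-1 * xy.2)%g).
  apply: continuous_comp_fun ck; apply: mulg_continuous_comp; last exact: snd_continuous.
  by apply: continuous_invg_comp; exact: fst_continuous.
have := tube_dist cK x ch e0; apply: filterS => y hy f cf f1.
have cd : continuous (fun z => k (y^-1 * z)%g - k (x^-1 * z)%g) by exact: continuous_subr.
rewrite -(ler_pXn2r (n := 2)) ?nnegrE ?normr_ge0 ?(ltW e0)// real_normK ?num_real//.
have -> : conv f y - conv f x = ip (fun z => k (y^-1 * z)%g - k (x^-1 * z)%g) f.
  by rewrite ipBl.
apply: (le_trans (ip_cauchy_schwarz cK cd cf)).
rewrite -[leRHS]mulr1 ler_pM ?ip_ge0// -[leRHS](haar_cst cK).
apply: haar_le; [exact: continuous_mulr|exact: cst_continuous|] => z.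
by rewrite -expr2 -[leLHS]real_normK ?num_real// ler_pXn2r ?nnegrE ?normr_ge0 ?(ltW e0)// ltW// hy.
Qed.

Lemma conv_ucvg (I : Type) (U : set_system I) (FU : Filter U)
    (h : I -> K -> R) g : (forall i, continuous (h i)) -> continuous g ->
  ucvg U h g -> ucvg U (fun i => conv (h i)) (conv g).
Proof.
move=> ch cg hg e e0.
have [B kB] := continuous_bounded cK ck.
have B0 : 0 <= B by apply: le_trans (kB 1%g).
have d0 : 0 < e / (B + 1) by rewrite divr_gt0//; lra.
apply: filterS (hg _ d0) => i hi x.
rewrite /conv -haarB; try exact: continuous_mulr.
apply: (@le_lt_trans _ _ (B * (e / (B + 1)))); last first.
  by rewrite mulrA ltr_pdivrMr; nra.
apply: haar_norm; first by apply: continuous_subr; exact: continuous_mulr.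
by move=> y; rewrite -mulrBr normrM ler_pM// ltW.
Qed.

End convolution.

(** * Extremal eigenfunctions of the squared convolution operator *)

Section top_eigenfunction.
Context {R : realType} {K : topologicalGroupType}.
Hypothesis cK : compact [set: K].
Implicit Types (f g : K -> R).
Variable k : K -> R.
Hypothesis ck : continuous k.
Hypothesis symk : forall x, k (x^-1)%g = k x.
Local Notation ip := (ip cK).
Local Notation T := (conv cK k).

Variable A : set (K -> R).
Hypothesis cA : forall a, A a -> continuous a.
Hypothesis TA : forall a, A a -> A (T a).

Definition orthocomplement : set (K -> R) :=
  [set w | continuous w /\ forall a, A a -> ip a w = 0].

Local Notation W := orthocomplement.

Lemma orthocomplement_conv w : W w -> W (T w).
Proof.
move=> [cw wA]; split; first exact: conv_continuous.
by move=> a Aa; rewrite -conv_sym//; [apply: wA; exact: TA|exact: cA].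
Qed.

Lemma orthocomplementZ (c : R) w : W w -> W (fun x => c * w x).
Proof.
move=> [cw wA]; split=> [|a Aa]; first exact: continuous_scale.
by rewrite ipC ipZl//; [rewrite ipC wA// mulr0|exact: cA].
Qed.

Lemma orthocomplementB w w' : W w -> W w' -> W (fun x => w x - w' x).
Proof.
move=> [cw wA] [cw' wA']; split=> [|a Aa]; first exact: continuous_subr.
have ca := cA Aa.
by rewrite ipC ipBl//; rewrite ipC wA// ipC wA'// subr0.
Qed.

Let ball := [set f | W f /\ ip f f <= 1].

Let S := [set ip (T f) (T f) | f in ball].

Let conv_norm_le f : continuous f -> ip (T f) (T f) <= ip k k * ip f f.
Proof.
move=> cf; have cTf : continuous (T f) by exact: conv_continuous.
rewrite -[leRHS](haar_cst cK).
apply: haar_le; [exact: continuous_mulr|exact: cst_continuous|move=> x].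
by rewrite -expr2 conv_sqr_le.
Qed.

Let W0 : W (fun=> 0).
Proof.
split=> [|a Aa]; first exact: cst_continuous.
by rewrite /ip -[RHS](haar_cst cK); congr haar; apply/funext => x; rewrite mulr0.
Qed.

Let ip00 : ip (fun=> 0) (fun=> 0) = 0 :> R.
Proof.
by rewrite /ip -[RHS](haar_cst cK); congr haar; apply/funext => x; rewrite mulr0.
Qed.

Let hasS : has_sup S.
Proof.
split.
  by exists (ip (T (fun=> 0)) (T (fun=> 0))), (fun=> 0) => //; split; rewrite ?ip00.
exists (ip k k) => _ [f [[cf _] f1] <-]; apply: le_trans (conv_norm_le cf) _.
by rewrite -[leRHS]mulr1 ler_wpM2l ?ip_ge0.
Qed.

Let L := sup S.

Let homog f : W f -> ip (T f) (T f) <= L * ip f f.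
Proof.
move=> Wf; have [cf _] := Wf; have [f0|f0] := leP (ip f f) 0.
  rewrite (ip_eq0 cf f0); apply: le_trans (conv_norm_le _) _; first exact: cst_continuous.
  by rewrite ip00 !mulr0.
pose c := (Num.sqrt (ip f f))^-1.
have c2 : c * (c * ip f f) = 1.
  have f0' : Num.sqrt (ip f f) != 0 by rewrite gt_eqF// sqrtr_gt0.
  by rewrite -[X in _ * (_ * X)](sqr_sqrtr (ltW f0)) /c; field.
have ccf : continuous (fun x => c * f x) by exact: continuous_scale.
have cTf : continuous (T f) by exact: conv_continuous.
have : S (c * (c * ip (T f) (T f))).
  exists (fun x => c * f x); last first.
    by rewrite convZ// ipZl ?(ipC _ (T f))// ?ipZl//; exact: continuous_scale.
  by split; [exact: orthocomplementZ|rewrite ipZl// (ipC _ f) ipZl// c2].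
move/(ub_le_sup (proj2 hasS)); rewrite -/L => h.
have {h} := ler_wpM2r (ltW f0) h.
by rewrite (_ : _ * _ * _ = c * (c * ip f f) * ip (T f) (T f)); [rewrite c2 mul1r|ring].
Qed.

(* g is a uniform limit of T f along a sequence f in the unit ball of W for
   which |T f|^2 tends to its supremum Lm. *)
Lemma top_eigenfunction w x : W w -> T w x != 0 ->
  exists g (Lm : R), [/\ W g, 0 < Lm, T (T g) = (fun x => Lm * g x) & 0 < ip g g].
Proof.
move=> Ww Twx; have [cw _] := Ww.
have cTw : continuous (T w) by exact: conv_continuous.
have L0 : 0 < L.
  have h1 : 0 < ip (T w) (T w).
    rewrite ltNge; apply/negP => /(ip_eq0 cTw) h.
    by rewrite h eqxx in Twx.
  rewrite ltNge; apply/negP => L0.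
  have := homog Ww; have := ip_ge0 cK cw; nra.
have /choice[f fP] : forall n : nat, exists f, ball f /\ L - n.+1%:R^-1 < ip (T f) (T f).
  move=> n; have n0 : 0 < n.+1%:R^-1 :> R by rewrite invr_gt0.
  have [_ [f bf <-] h] := sup_adherent n0 hasS.
  by exists f.
have [U [UU Uoo]] := @ultraFilterLemma _ _ (eventually_filter).
have cf n : continuous (f n) by have [[[]]] := fP n.
have cTf n : continuous (T (f n)) by exact: conv_continuous.
have f1 n : ip (f n) (f n) <= 1 by have [[]] := fP n.
have [||g [cg hg]] := @ultra_uniform_limit R K cK nat U UU (fun n => T (f n)) (ip k k + 1).
- move=> n y; have := conv_sqr_le cK ck y (cf n).
  have := ip_ge0 cK ck; have := f1 n; have := ip_ge0 cK (cf n).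
  rewrite -[_ ^+ 2]real_normK ?num_real//.
  have := normr_ge0 (T (f n) y); nra.
- move=> y e e0; apply: filterS (conv_equicontinuous cK ck y e0) => z hz n.
  exact: hz.
have FU : ProperFilter U by exact: ultra_proper.
have gg : ip g g = L.
  apply: (@cvg_unique _ (@Rhausdorff R) (ip (T (f n)) (T (f n)) @[n --> U])).
    by apply: ip_ucvg => //.
  apply: (@cvg_trans _ (ip (T (f n)) (T (f n)) @[n --> \oo])).
    by apply: cvg_app.
  apply/cvgrPdist_lt => e e0; near=> n.
  have h1 : L - n.+1%:R^-1 < ip (T (f n)) (T (f n)) by have [] := fP n.
  have h2 : ip (T (f n)) (T (f n)) <= L.
    by apply: ub_le_sup; [have [] := hasS|exists (f n) => //; have [] := fP n].
  have h3 : n.+1%:R^-1 < e :> R by near: n; exact: near_infty_natSinv_lt (PosNum e0).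
  rewrite ger0_norm ?subr_ge0//; apply: lt_trans h3.
  by rewrite ltrBlDr addrC -ltrBlDr.
have Wg : W g.
  split=> // a Aa; have ca := cA Aa.
  apply: (@cvg_unique _ (@Rhausdorff R) (ip a (T (f n)) @[n --> U])).
    by apply: ip_ucvg => //; exact: ucvg_cst.
  rewrite (_ : (fun n => _) = fun=> 0); first exact: cvg_cst.
  apply/funext => n; have [[Wf _] _] := fP n.
  by have [_ ->] := orthocomplement_conv Wf.
have cTg : continuous (T g) by exact: conv_continuous.
have cTTg : continuous (T (T g)) by exact: conv_continuous.
(* Since [ip (T f) (T f) = ip f (T (T f))], Cauchy-Schwarz on the unit ball gives |T f|^4 <= |T (T
   f)|^2; the limit along U yields the bound. *)
have TgL : L ^+ 2 <= ip (T g) (T g).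
  have c1 : ip (T (f n)) (T (f n)) @[n --> U] --> ip g g by apply: ip_ucvg.
  have c2 : ip (T (T (f n))) (T (T (f n))) @[n --> U] --> ip (T g) (T g).
    have cTT n : continuous (T (T (f n))) by exact: conv_continuous.
    by apply: ip_ucvg => //; apply: conv_ucvg.
  rewrite -gg expr2.
  have c3 : ip (T (f n)) (T (f n)) * ip (T (f n)) (T (f n)) @[n --> U] --> ip g g * ip g g.
    exact: (cvgM c1 c1).
  have := ler_cvg_to c3 c2; apply; apply: nearW => n /=.
  rewrite -expr2 conv_sym//; last first.
  have cTT : continuous (T (T (f n))) by exact: conv_continuous.
  apply: le_trans (ip_cauchy_schwarz cK (cf n) cTT) _.
  rewrite -[leRHS]mul1r ler_wpM2r// ip_ge0//.
exists g, L; split=> //; last by rewrite gg.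
have cLg : continuous (fun x => L * g x) by exact: continuous_scale.
have cd : continuous (fun x => T (T g) x - L * g x) by exact: continuous_subr.
(* Expanding the square gives |T T g|^2 - 2 L |T g|^2 + L^3. By [homog] at [T g] this is at most L
   (L^2 - |T g|^2), which [TgL] makes nonpositive. *)
have : ip (fun x => T (T g) x - L * g x) (fun x => T (T g) x - L * g x) <= 0.
  rewrite ipBl// ipZl// ![ip _ (fun x => T _ _ - _)]ipC !ipBl// !ipZl//.
  rewrite [ip g (T (T g))]ipC (conv_sym cK ck symk cTg cg) gg.
  have := homog (orthocomplement_conv Wg); nra.
move/(ip_eq0 cd) => h; apply/funext => y.
by apply/eqP; rewrite -subr_eq0; move: (congr1 (fun h => h y) h) => /= ->.
Unshelve. all: by end_near. Qed.

End top_eigenfunction.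

(** * Representations on finite-dimensional spaces of functions *)

Section orthonormal_representation.
Context {R : realType} {K : topologicalGroupType}.
Hypothesis cK : compact [set: K].
Local Notation ip := (ip cK).

Lemma real_complex_continuous : continuous (fun x : R => (x%:C)%C).
Proof.
move=> x A /nbhs_ballP[e /= e0 eA]; apply/nbhs_ballP.
(* Balls of [R[i]] have radii in [R[i]], and a positive one is real. *)
have [e1 e2] : complex.Im e = 0 /\ 0 < complex.Re e.
  by move: e0; rewrite ltcE /= => /andP[/eqP].
exists (complex.Re e) => //= y; rewrite /ball /= => xy; apply: eA.
rewrite /ball /= /ball_ -rmorphB normc_def /= expr0n addr0 sqrtr_sqr.
by rewrite ltcE /= e1 eqxx.
Qed.

Lemma conjC_real (x : R) : Num.conj (x%:C)%C = (x%:C)%C.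
Proof. exact: conjc_real. Qed.

(** The matrix is orthogonal because translation preserves [ip]. As [translate (x * y)] is
    [translate y] after [translate x], the coefficients are read along rows to obtain a morphism. *)
Lemma orthonormal_rep n (e : 'I_n -> K -> R) :
  (forall i, continuous (e i)) ->
  (forall i j, ip (e i) (e j) = (i == j)%:R) ->
  (forall x i, translate x (e i) =
     fun y => \sum_j ip (translate x (e i)) (e j) * e j y) ->
  exists rho : rep R K n, forall x, rho x = 1%g -> forall i, translate x (e i) = e i.
Proof.
move=> ce oe span.
pose c x : 'M[R[i]]_n := \matrix_(i, j) (ip (translate x (e i)) (e j))%:C%C.
have cte x i : continuous (translate x (e i)) by exact: translate_continuous.
have cU x : c x \is unitarymx.
  apply/unitarymxP/matrixP => i j; rewrite !mxE.
  under eq_bigr => k _ do rewrite !mxE conjC_real -rmorphM.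
  rewrite -rmorph_sum -[RHS](rmorph_nat (@real_complex_def R (Phant R))).
  congr (_%:C)%C; rewrite -oe -(ip_translate cK x (ce i) (ce j)) {2}span.
  rewrite ip_suml//; apply: eq_bigr => k _.
  by rewrite mulrC [ip (e k) _]ipC mulrC.
pose rho x := UnitaryGroup (cU x).
have cM : {morph rho : x y / (x * y)%g}.
  move=> x y; apply: val_inj; apply/matrixP => i j; rewrite /= !mxE.
  under eq_bigr => k _ do rewrite !mxE -rmorphM.
  rewrite -rmorph_sum; congr (_%:C)%C.
  have -> : translate (x * y)%g (e i) = fun z => \sum_k ip (translate x (e i)) (e k) * translate y (e k) z.
    by apply/funext => z; rewrite /translate -mulgA -[LHS]/(translate x (e i) (y * z)%g) span.
  by rewrite ip_suml.
have cc : continuous rho.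
  apply/unitary_continuousP => i j /=; under eq_fun do rewrite mxE.
  apply: (@continuous_comp_fun _ _ _ (fun x => ip (translate x (e i)) (e j)));
    last exact: real_complex_continuous.
  apply: (@haar_param_continuous _ _ cK _ (fun xy => e i (xy.1 * xy.2)%g * e j xy.2)).
  apply: continuous_mulr; first by apply: continuous_comp_fun (ce i); exact: mulg_continuous.
  by apply: continuous_comp_fun (ce j); exact: snd_continuous.
exists (mk_rep cc cM) => x /(congr1 val) /= cx i.
rewrite span; apply/funext => y.
rewrite (bigD1 i)//= big1 ?addr0 => [|j ji].
  have := congr1 (fun M : 'M[R[i]]_n => M i i) cx; rewrite !mxE eqxx => -[->].
  by rewrite mul1r.
have := congr1 (fun M : 'M[R[i]]_n => M i j) cx; rewrite !mxE eq_sym (negbTE ji) => -[->].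
by rewrite mul0r.
Qed.

End orthonormal_representation.

Lemma rep1 (R : realType) (G : topologicalGroupType) n (rho : rep R G n) :
  rho 1%g = 1%g.
Proof. by apply: (@mulgI _ (rho 1%g)); rewrite -repM !mulg1. Qed.

(** * Points killed by all representations *)

Section peter_weyl.
Context {R : realType} {K : topologicalGroupType}.
Hypothesis cK : compact [set: K].
Local Notation ip := (ip cK).
Variable x0 : K.
Hypothesis trivial_x0 : forall n (rho : rep R K n.+1), rho x0 = 1%g.

(* The functions invariant under the normal closure of x0. *)
Let A := [set a : K -> R | continuous a /\
  forall z, translate (z * x0 * z^-1)%g a = a].

Let W := orthocomplement cK A.

Let cA a : A a -> continuous a. Proof. by case. Qed.

Variable k : K -> R.
Hypothesis ck : continuous k.
Hypothesis symk : forall x, k (x^-1)%g = k x.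
Local Notation T := (conv cK k).

Let TA a : A a -> A (T a).
Proof.
move=> [ca aA]; split; first exact: conv_continuous.
by move=> z; rewrite -conv_translate// aA.
Qed.

Let translateA w a : A a -> A (translate w a).
Proof.
move=> [ca aA]; split=> [|z]; first exact: translate_continuous.
apply/funext => y; have := congr1 (fun f => f (w * y)%g) (aA (w * z)%g).
by rewrite /translate invgM !mulgA mulgVK.
Qed.

Let translateW w f : W f -> W (translate w f).
Proof.
move=> [cf fA]; split=> [|a Aa]; first exact: translate_continuous.
have ca := cA Aa; have := translateA (w^-1)%g Aa => /fA <-.
rewrite -[RHS](ip_translate cK w)//; last exact: translate_continuous.
by congr ip; apply/funext => y; rewrite /translate mulKg.
Qed.

Section eigenspace.
Variable L : R.
Hypothesis L0 : 0 < L.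

Let Eig := [set f | W f /\ T (T f) = fun x => L * f x].

Let translateEig w f : Eig f -> Eig (translate w f).
Proof.
move=> [Wf fL]; split; first exact: translateW.
have [cf _] := Wf.
by rewrite !conv_translate ?fL//; exact: conv_continuous.
Qed.

Let EigZ (c : R) f : Eig f -> Eig (fun x => c * f x).
Proof.
move=> [Wf fL]; split; first exact: orthocomplementZ.
have [cf _] := Wf; rewrite !convZ//; last exact: conv_continuous.
by rewrite fL; apply/funext => x; rewrite mulrCA.
Qed.

Let EigB f g : Eig f -> Eig g -> Eig (fun x => f x - g x).
Proof.
move=> [Wf fL] [Wg gL]; split; first exact: orthocomplementB.
have [cf _] := Wf; have [cg _] := Wg.
rewrite !convB//; [|exact: conv_continuous|exact: conv_continuous].
by rewrite fL gL; apply/funext => x; rewrite mulrBr.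
Qed.

Definition orthonormal_in n (e : 'I_n -> K -> R) :=
  (forall i, Eig (e i)) /\ (forall i j, ip (e i) (e j) = (i == j)%:R).

Let project f n (e : 'I_n -> K -> R) := fun y => f y - \sum_j ip f (e j) * e j y.

Let project_ip f n (e : 'I_n -> K -> R) : continuous f ->
  (forall i, continuous (e i)) -> (forall i j, ip (e i) (e j) = (i == j)%:R) ->
  [/\ continuous (project f e), forall i, ip (project f e) (e i) = 0 &
      ip (project f e) (project f e) = ip f f - \sum_i ip f (e i) ^+ 2].
Proof.
move=> cf ce oe.
have cs : continuous (fun y => \sum_j ip f (e j) * e j y) by exact: continuous_lincomb.
have pe i : ip (project f e) (e i) = 0.
  rewrite ipBl// ip_suml// (bigD1 i)//= big1 ?addr0 ?oe ?eqxx ?mulr1 ?subrr// => j ji.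
  by rewrite oe (negbTE ji) mulr0.
have cp : continuous (project f e) by exact: continuous_subr.
split=> //; rewrite {1}/project ipBl// ip_suml//.
rewrite [X in _ - X]big1 => [|i _]; last by rewrite [ip (e i) _]ipC pe mulr0.
rewrite subr0 ipC ipBl// ip_suml//; congr (_ - _); apply: eq_bigr => i _.
by rewrite expr2 [ip (e i) f]ipC.
Qed.

Let project_eigen f n (e : 'I_n -> K -> R) : Eig f ->
  (forall i, Eig (e i)) -> Eig (project f e).
Proof.
move=> Ef Ee; suff H c : Eig (fun y => \sum_j c j * e j y) by exact: EigB.
elim: n e Ee c => [|n IHn] e Ee c.
  have := EigZ 0 Ef; congr Eig.
  by apply/funext => y; rewrite big_ord0 mul0r.
have h1 : Eig (fun y => c ord0 * e ord0 y) by exact: EigZ.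
have h2 : Eig (fun y => \sum_j c (lift ord0 j) * e (lift ord0 j) y).
  exact: (IHn (fun j => e (lift ord0 j))).
have := EigB h1 (EigZ (-1) h2); congr Eig; apply/funext => y.
by rewrite big_ord_recl mulN1r opprK.
Qed.

(** Eigenspaces are finite-dimensional: [T (e i) x] is the coefficient of a translate of k on [e i],
    so Bessel's inequality bounds the sum of squares at each x, and its mean is [n%:R * L]. *)
Let orthonormal_bound n (e : 'I_n -> K -> R) :
  orthonormal_in e -> n%:R * L <= ip k k.
Proof.
move=> [Ee oe]; have ce i : continuous (e i) by have [[]] := Ee i.
have cTe i : continuous (T (e i)) by exact: conv_continuous.
have cTe2 i : continuous (fun x => T (e i) x * T (e i) x) by exact: continuous_mulr.
have [h1 h2] := haar_sum cK (index_enum 'I_n) cTe2.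
have -> : n%:R * L = haar cK (fun x => \sum_i T (e i) x * T (e i) x).
  rewrite h1 (eq_bigr (fun=> L)) => [|i _].
    by rewrite sumr_const card_ord mulr_natl.
  have [_ TT] := Ee i.
  transitivity (ip (T (e i)) (T (e i))); first by [].
  by rewrite conv_sym// TT ipC ipZl// oe eqxx mulr1.
rewrite -[leRHS](haar_cst cK); apply: haar_le => //; first exact: cst_continuous.
move=> x; have ckx : continuous (translate (x^-1)%g k) by exact: translate_continuous.
have [cp _] := project_ip ckx ce oe; rewrite ip_translate// => h.
have := ip_ge0 cK cp; rewrite h subr_ge0; apply: le_trans.
by rewrite le_eqVlt; apply/orP; left; apply/eqP; apply: eq_bigr.
Qed.

(** A maximal orthonormal family spans the eigenspace, on which translations act by a
    representation. All conjugates of x0 act trivially there, so the eigenfunctions lie both in A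
    and in its orthocomplement. *)
Lemma eigenspace_trivial f : Eig f -> f = fun=> 0.
Proof.
move=> Ef; pose P n := `[< exists e : 'I_n -> K -> R, orthonormal_in e >].
have P0 : exists n, P n by exists 0; apply/asboolP; exists (fun=> f); split; case.
have Pb n : P n -> (n <= Num.bound (ip k k / L))%N.
  move=> /asboolP[e /orthonormal_bound h].
  rewrite -(ler_nat R) ltW// (le_lt_trans _ (archi_boundP _))//.
    by rewrite ler_pdivlMr.
  by rewrite divr_ge0 ?ip_ge0// ltW.
case: (ex_maxnP P0 Pb) => N /asboolP[e oe] Nmax.
have [Ee ee] := oe; have ce i : continuous (e i) by have [[]] := Ee i.
have span g : Eig g -> g = fun y => \sum_j ip g (e j) * e j y.
  move=> Eg; have [cg _] := Eg.1.
  have [cp pe _] := project_ip cg ce ee; have Ep := project_eigen Eg Ee.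
  have [p0|p0] := leP (ip (project g e) (project g e)) 0.
    apply/funext => y; apply/eqP; rewrite -subr_eq0.
    by apply/eqP; exact: (congr1 (fun h => h y) (ip_eq0 cp p0)).
  pose c := (Num.sqrt (ip (project g e) (project g e)))^-1.
  have c2 : c * (c * ip (project g e) (project g e)) = 1.
    have p0' : Num.sqrt (ip (project g e) (project g e)) != 0 by rewrite gt_eqF// sqrtr_gt0.
    by rewrite -[X in _ * (_ * X)](sqr_sqrtr (ltW p0)) /c; field.
  pose e' := fun i : 'I_N.+1 => if unlift ord0 i is Some j then e j else
     fun y => c * project g e y.
  suff /Nmax : P N.+1 by rewrite ltnn.
  have ccp : continuous (fun y => c * project g e y) by exact: continuous_scale.
  apply/asboolP; exists e'; split=> [i|i j]; rewrite /e'.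
    by case: unliftP => [j _|_]; [exact: Ee|exact: EigZ].
  case: unliftP => [i' ->|->]; case: unliftP => [j' ->|->].
  - by rewrite ee (inj_eq lift_inj).
  - by rewrite ipC ipZl// pe mulr0 eq_sym (negbTE (neq_lift _ _)).
  - by rewrite ipZl// pe mulr0 (negbTE (neq_lift _ _)).
  - by rewrite ipZl// ipC ipZl// c2 eqxx.
have [rho rho1] : exists rho : rep R K N, forall x, rho x = 1%g ->
    forall i, translate x (e i) = e i.
  by apply: orthonormal_rep => // x i; apply: span; exact: translateEig.
have Ae i : A (e i).
  split=> // z; apply: rho1.
  (* [trivial_x0] speaks of positive dimensions; in dimension 0 there is no index i. *)
  case: N rho {P0 Nmax e oe Ee ee ce span} i => [? []//|N rho _].
  by rewrite !repM trivial_x0 mulg1 -repM mulgV rep1.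
rewrite (span f Ef); apply/funext => y; rewrite big1// => i _.
have := ee i i; rewrite eqxx; have [[_ ->//]] := Ee i.
by move=> _ /eqP; rewrite eq_sym oner_eq0.
Qed.

End eigenspace.

Lemma orthocomplement_conv_trivial w x : W w -> T w x = 0.
Proof.
move=> Ww; apply/eqP/negPn/negP => Twx.
have [g [L [Wg L0 TT g0]]] := top_eigenfunction ck symk cA TA Ww Twx.
have gE := eigenspace_trivial L0 (conj Wg TT).
by move: g0; rewrite gE /ip; under eq_fun do rewrite mulr0; rewrite haar_cst ltxx.
Qed.

End peter_weyl.

(** It suffices to find w orthogonal to the x0-invariant functions and a symmetric kernel k with
    [conv cK k w] nonzero at 1, against [orthocomplement_conv_trivial]. *)
Theorem peter_weyl (R : realType) (K : topologicalGroupType) (x0 : K) :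
  compact [set: K] -> hausdorff_space K ->
  (forall n (rho : rep R K n.+1), rho x0 = 1%g) -> x0 = 1%g.
Proof.
move=> cK hK tx0; apply/eqP/negPn/negP => x01.
have closed1 (x : K) : closed [set x].
  exact: (accessible_closed_set1 (hausdorff_accessible hK)).
have : uniform_separator [set (x0^-1)%g] [set (1%g : K)].
  apply: (iffLR (@normal_separatorP R K)); rewrite -?disjoints_subset//.
    exact: compact_normal.
  by apply/seteqP; split=> // y [/= -> /(congr1 (fun u => u^-1%g))/eqP]; rewrite invgK invg1 (negbTE x01).
move=> sep; pose f := Urysohn (R := R) [set (x0^-1)%g] [set (1%g : K)].
have cf : continuous f by exact: Urysohn_continuous.
have f0 : f (x0^-1)%g = 0 by apply: (Urysohn_sub0 sep); exists (x0^-1)%g.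
have f1 : f 1%g = 1 by apply: (Urysohn_sub1 sep); exists 1%g.
(* A function minus its translate by [x0^-1] is orthogonal to all functions that x0 fixes; the
   values of f give [w 1 = 1]. *)
pose w x := f x - f (x0^-1 * x)%g.
have cw : continuous w by apply: continuous_subr => //; exact: translate_continuous.
(* Built from the positive part of w, the kernel is symmetric and vanishes where w is negative, so
   [k y * w y] is nonnegative, and positive at 1. *)
pose phi x := Num.max 0 (w x).
have cphi : continuous phi.
  by move=> x; apply: continuous_max; [exact: cvg_cst|exact: cw].
pose k x := phi x * phi (x^-1)%g.
have ck : continuous k.
  apply: continuous_mulr => //; apply: continuous_comp_fun cphi.
  exact: invg_continuous.
have symk x : k (x^-1)%g = k x by rewrite /k invgK mulrC.
have Ww : orthocomplement cK [set a : K -> R | continuous a /\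
  forall z, translate (z * x0 * z^-1)%g a = a] w.
  split=> // a [ca aA].
  have ctf : continuous (translate (x0^-1)%g f) by exact: translate_continuous.
  rewrite ipC ipBl// -[X in _ - X](ip_translate cK x0)//.
  have := aA 1%g; rewrite invg1 mul1g mulg1 => ->.
  rewrite (_ : translate x0 _ = f) ?subrr//.
  by apply/funext => y; rewrite /translate mulKg.
have := orthocomplement_conv_trivial tx0 ck symk 1%g Ww.
apply/eqP; rewrite gt_eqF// /conv invg1.
apply: (@haar_gt0 _ _ _ _ 1%g).
- by apply: continuous_mulr => //; apply: translate_continuous.
- move=> y; rewrite mul1g /k /phi; case: (lerP 0 (w y)) => h.
    by rewrite !mulr_ge0// le_max lexx.
  by rewrite !mul0r.
- by rewrite mul1g /k invg1 /phi /w mulg1 f0 f1 subr0 maxEle ler01 !mulr1 ltr01.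
Qed.

(** * Unitary matrices and nearby representations *)

Section matrix_norm.
Context {R : realType}.
Local Notation C := R[i].

(** Entrywise l1 norm: submultiplicative but not unitarily invariant, whence the factors
    [(n * n)%:R] when multiplying by unitary matrices. *)
Definition mxnorm m n (A : 'M[C]_(m, n)) : R := \sum_i \sum_j normc (A i j).

Lemma normc_ge0 (x : C) : 0 <= normc x.
Proof. by case: x => a b; exact: sqrtr_ge0. Qed.

Lemma normcE (x : C) : `|x| = (normc x)%:C%C.
Proof. by case: x. Qed.

Lemma normc_sum I (r : seq I) (F : I -> C) :
  normc (\sum_(i <- r) F i) <= \sum_(i <- r) normc (F i).
Proof.
elim: r => [|i r IHr]; first by rewrite !big_nil normc0.
by rewrite !big_cons (le_trans (le_normcD _ _))// lerD2l.
Qed.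

Lemma normc_le (x : C) : normc x <= `|complex.Re x| + `|complex.Im x|.
Proof.
case: x => a b /=; rewrite -(ler_pXn2r (n := 2)) ?nnegrE ?sqrtr_ge0 ?addr_ge0//.
rewrite sqr_sqrtr ?addr_ge0 ?sqr_ge0// -(real_normK (num_real a)) -(real_normK (num_real b)).
by rewrite sqrrD -addrA lerD2l lerDr mulrn_wge0// mulr_ge0.
Qed.

Lemma normc_geRe (x : C) : `|complex.Re x| <= normc x.
Proof.
by case: x => a b /=; rewrite -[leLHS]sqrtr_sqr ler_sqrt ?addr_ge0 ?sqr_ge0// lerDl sqr_ge0.
Qed.

Lemma normc_geIm (x : C) : `|complex.Im x| <= normc x.
Proof.
by case: x => a b /=; rewrite -[leLHS]sqrtr_sqr ler_sqrt ?addr_ge0 ?sqr_ge0// lerDr sqr_ge0.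
Qed.

Lemma mxnorm_ge0 m n (A : 'M[C]_(m, n)) : 0 <= mxnorm A.
Proof. by apply: sumr_ge0 => i _; apply: sumr_ge0 => j _; exact: normc_ge0. Qed.

Lemma mxnorm0 m n : mxnorm (0 : 'M[C]_(m, n)) = 0.
Proof.
by rewrite /mxnorm big1// => i _; rewrite big1// => j _; rewrite mxE normc0.
Qed.

Lemma mxnorm_entry m n (A : 'M[C]_(m, n)) i j : normc (A i j) <= mxnorm A.
Proof.
rewrite /mxnorm (bigD1 i)//= (bigD1 j)//= -addrA lerDl addr_ge0//.
  by apply: sumr_ge0 => k _; exact: normc_ge0.
by apply: sumr_ge0 => k _; apply: sumr_ge0 => l _; exact: normc_ge0.
Qed.

Lemma mxnormD m n (A B : 'M[C]_(m, n)) : mxnorm (A + B) <= mxnorm A + mxnorm B.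
Proof.
rewrite /mxnorm -big_split; apply: ler_sum => i _ /=.
by rewrite -big_split; apply: ler_sum => j _; rewrite mxE; exact: le_normcD.
Qed.

Lemma mxnormN m n (A : 'M[C]_(m, n)) : mxnorm (- A) = mxnorm A.
Proof.
by apply: eq_bigr => i _; apply: eq_bigr => j _; rewrite mxE normcN.
Qed.

Lemma mxnorm_sub m n (A B : 'M[C]_(m, n)) : mxnorm (A - B) = mxnorm (B - A).
Proof. by rewrite -mxnormN opprB. Qed.

Lemma mxnorm_triangle m n (B A D : 'M[C]_(m, n)) :
  mxnorm (A - D) <= mxnorm (A - B) + mxnorm (B - D).
Proof. by rewrite -[A - D](subrKA B) mxnormD. Qed.

Lemma mxnormM m n p (A : 'M[C]_(m, n)) (B : 'M[C]_(n, p)) :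
  mxnorm (A *m B) <= mxnorm A * mxnorm B.
Proof.
rewrite /mxnorm mulr_suml; apply: ler_sum => i _; rewrite mulr_suml.
under eq_bigr => j _ do rewrite mxE.
apply: (@le_trans _ _ (\sum_j \sum_k normc (A i k) * normc (B k j))).
  apply: ler_sum => j _; apply: le_trans (normc_sum _ _) _.
  by apply: ler_sum => k _; rewrite normcM.
rewrite exchange_big; apply: ler_sum => k _; rewrite -mulr_sumr.
rewrite ler_wpM2l ?normc_ge0// (bigD1 k)//= lerDl.
by apply: sumr_ge0 => l _; apply: sumr_ge0 => j _; exact: normc_ge0.
Qed.

Lemma mxnorm_eq0 m n (A : 'M[C]_(m, n)) : mxnorm A <= 0 -> A = 0.
Proof.
move=> A0; apply/matrixP => i j; rewrite mxE; apply: eq0_normc.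
by apply/eqP; rewrite eq_le normc_ge0 (le_trans (mxnorm_entry A i j)).
Qed.

Lemma unitary_row_norm n (A : 'U[R]_n) i : \sum_k normc (unitary_val A i k) ^+ 2 = 1.
Proof.
have := unitary_valP A => /unitarymxP/matrixP/(_ i i); rewrite !mxE eqxx.
move=> /(congr1 (@complex.Re _)); rewrite (raddf_sum (@complex.Re R : {additive Rcomplex R -> R})).
move=> h; rewrite -[RHS]h; apply: eq_bigr => k _; rewrite !mxE.
case: (unitary_val A i k) => a b /=.
by rewrite sqr_sqrtr ?addr_ge0 ?sqr_ge0// mulrN opprK -!expr2.
Qed.

Lemma unitary_entry_le1 n (A : 'U[R]_n) i j : normc (unitary_val A i j) <= 1.
Proof.
rewrite -(ler_pXn2r (n := 2)) ?nnegrE ?normc_ge0// expr1n -(unitary_row_norm A i).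
rewrite (bigD1 j)//= lerDl.
by apply: sumr_ge0 => k _; rewrite sqr_ge0.
Qed.

Lemma mxnorm_unitary n (A : 'U[R]_n) : mxnorm (unitary_val A) <= (n * n)%:R.
Proof.
apply: (@le_trans _ _ (\sum_(i < n) \sum_(j < n) 1)).
  by apply: ler_sum => i _; apply: ler_sum => j _; exact: unitary_entry_le1.
by under eq_bigr do rewrite sumr_const card_ord; rewrite sumr_const card_ord natrM mulr_natl.
Qed.

Lemma continuous_normc : continuous (@normc R : C -> R).
Proof.
move=> x A /nbhs_ballP[e /= e0 eA]; apply/nbhs_ballP.
exists e%:C%C; rewrite /= ?ltcR// => y; rewrite /ball /= /ball_ normcE ltcR => xy.
apply: eA; rewrite /ball /= /ball_; move: xy.
apply: le_lt_trans; rewrite ler_norml; apply/andP; split.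
  by rewrite lerNl opprB lerBlDr -(normcN (x - y)) opprB (le_trans _ (le_normcD _ _))// subrK.
by rewrite lerBlDr (le_trans _ (le_normcD _ _))// subrK.
Qed.

Lemma continuous_opp (T : topologicalType) (f : T -> C) :
  continuous f -> continuous (fun x => - f x).
Proof.
move=> cf; under eq_fun do rewrite -mulN1r.
by apply: complexM_continuous; [exact: cst_continuous|exact: cf].
Qed.

Lemma continuous_sumr (T : topologicalType) I (r : seq I) (f : I -> T -> R) :
  (forall i, continuous (f i)) -> continuous (fun x => \sum_(i <- r) f i x).
Proof.
move=> cf; elim: r => [|i r IHr].
  under eq_fun do rewrite big_nil; exact: cst_continuous.
by under eq_fun do rewrite big_cons; exact: continuous_addr.
Qed.

Lemma continuous_mxnorm (T : topologicalType) m n (F : T -> 'M[C]_(m, n)) :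
  (forall i j, continuous (fun x => F x i j)) -> continuous (fun x => mxnorm (F x)).
Proof.
move=> cF; apply: continuous_sumr => i; apply: continuous_sumr => j.
exact: (continuous_comp_fun (cF i j) continuous_normc).
Qed.

Lemma continuous_unitary_dist (T : topologicalType) n (f g : T -> 'U[R]_n) :
  continuous f -> continuous g ->
  continuous (fun x => mxnorm (unitary_val (f x) - unitary_val (g x))).
Proof.
move=> /unitary_continuousP cf /unitary_continuousP cg.
apply: continuous_mxnorm => i j; under eq_fun do rewrite !mxE.
by apply: complexD_continuous; [exact: cf|apply: continuous_opp; exact: cg].
Qed.

Definition uball n (A : 'U[R]_n) (e : R) : set 'U[R]_n :=
  [set B | mxnorm (unitary_val B - unitary_val A) < e].

Lemma open_uball n (A : 'U[R]_n) (e : R) : open (uball A e).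
Proof.
have /continuousP : continuous (fun B : 'U[R]_n => mxnorm (unitary_val B - unitary_val A)).
  apply: (@continuous_unitary_dist _ _ (fun B => B) (fun=> A)); last exact: cst_continuous.
  by move=> ?; exact: cvg_id.
by move=> /(_ [set r | r < e]); apply; exact: num_normedtype.open_lt.
Qed.

Lemma uball_center n (A : 'U[R]_n) (e : R) : 0 < e -> uball A e A.
Proof.
by move=> e0; rewrite /uball /= subrr mxnorm0.
Qed.

Lemma nbhs_uball n (A : 'U[R]_n) (e : R) : 0 < e -> nbhs A (uball A e).
Proof.
by move=> e0; apply: open_nbhs_nbhs; split; [exact: open_uball|exact: uball_center].
Qed.

Lemma nbhs_unitaryP n (A : 'U[R]_n) (V : set 'U[R]_n) : nbhs A V ->
  exists2 e : R, 0 < e & uball A e `<=` V.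
Proof.
case=> _ [[W oW <-] /= WA] WV.
have : nbhs (unitary_val A) W by exact: open_nbhs_nbhs.
case=> P PA PW.
have [e e0 eP] : exists2 e : R, 0 < e & forall ij : 'I_n * 'I_n, forall y : C,
    normc (unitary_val A ij.1 ij.2 - y) < e -> P ij.1 ij.2 y.
  have /choice[e eP] : forall ij : 'I_n * 'I_n, exists e : R, 0 < e /\ forall y : C,
     normc (unitary_val A ij.1 ij.2 - y) < e -> P ij.1 ij.2 y.
    move=> [i j]; have /nbhs_ballP[d /= d0 dP] := PA i j.
    have [d1 d2] : complex.Im d = 0 /\ 0 < complex.Re d.
      by move: d0; rewrite ltcE /= => /andP[/eqP].
    exists (complex.Re d); split=> // y yd; apply: dP; rewrite /ball /= /ball_ normcE.
    by rewrite ltcE /= d1 eqxx.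
  exists (\big[Num.min/1]_ij e ij).
    by apply: lt_bigmin => // ij _; have [] := eP ij.
  move=> ij y yd; have [_] := eP ij; apply; apply: lt_le_trans yd _.
  exact: bigmin_le_cond.
exists e => // B; rewrite /uball /= mxnorm_sub => AB; apply: WV; apply: PW => i j.
apply: (eP (i, j)) => /=; apply: le_lt_trans AB.
by rewrite (le_trans _ (mxnorm_entry _ i j))// !mxE.
Qed.

Lemma unitary_cvgP (T : Type) n (F : set_system T) (FF : Filter F)
    (f : T -> 'U[R]_n) (A : 'U[R]_n) :
  f @ F --> A <-> forall e : R, 0 < e -> \forall x \near F, uball A e (f x).
Proof.
split=> [fA e e0|fA V /nbhs_unitaryP[e e0 eV]]; first by apply: fA; exact: nbhs_uball.
by apply: filterS (fA e e0) => x; exact: eV.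
Qed.

Lemma unitary_hausdorff n : hausdorff_space 'U[R]_n.
Proof.
move=> A B AB; apply: val_inj; apply/eqP; rewrite -subr_eq0; apply/eqP.
apply: mxnorm_eq0; rewrite leNgt; apply/negP => d0.
have d20 : 0 < mxnorm (unitary_val A - unitary_val B) / 2 by lra.
have [D [DA DB]] := AB _ _ (nbhs_uball A d20) (nbhs_uball B d20).
have := mxnorm_triangle (unitary_val D) (unitary_val A) (unitary_val B).
by move: DA DB; rewrite /uball /= mxnorm_sub; lra.
Qed.

Lemma complex_cvg (T : Type) (F : set_system T) (FF : Filter F) (f : T -> C) (l : C) :
  complex.Re (f x) @[x --> F] --> complex.Re l ->
  complex.Im (f x) @[x --> F] --> complex.Im l ->
  forall e : R, 0 < e -> \forall x \near F, normc (f x - l) < e.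
Proof.
move=> /cvgrPdist_lt hR /cvgrPdist_lt hI e e0; have e20 : 0 < e / 2 by lra.
near=> x; apply: le_lt_trans (normc_le _) _.
have h1 : `|complex.Re l - complex.Re (f x)| < e / 2 by near: x; exact: hR.
have h2 : `|complex.Im l - complex.Im (f x)| < e / 2 by near: x; exact: hI.
move: h1 h2; case: (f x) => a b; case: (l) => c d /=.
by rewrite -(distrC a) -(distrC b); lra.
Unshelve. all: by end_near. Qed.

(** The entries are bounded by 1, hence converge along any ultrafilter; it remains to see that the
    limit matrix is unitary. *)
Lemma unitary_compact n : compact [set: 'U[R]_n].
Proof.
rewrite compact_ultra => F UF _.
have FF : ProperFilter F by exact: ultra_proper.
have hl (g : C -> R) : (forall x, `|g x| <= normc x) ->
  forall ij : 'I_n * 'I_n, exists l : R, g (unitary_val B ij.1 ij.2) @[B --> F] --> l.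
  move=> g1 ij; apply: (@ultra_bounded_cvg _ _ _ UF _ 1); apply: nearW => B.
  by rewrite (le_trans (g1 _))// unitary_entry_le1.
have /choice[a aP] := hl _ normc_geRe; have /choice[b bP] := hl _ normc_geIm.
pose A : 'M[C]_n := \matrix_(i, j) Complex (a (i, j)) (b (i, j)).
(* The successor in the denominator keeps the bound strict and covers n = 0. *)
have AP e : 0 < e -> \forall B \near F, mxnorm (unitary_val B - A) < e.
  move=> e0; pose d := e / (n * n).+1%:R.
  have d0 : 0 < d by rewrite divr_gt0.
  have : \forall B \near F, forall ij : 'I_n * 'I_n, normc (unitary_val B ij.1 ij.2 - A ij.1 ij.2) < d.
    apply: filter_forall => -[i j]; apply: complex_cvg => //; rewrite mxE /=.
      exact: (aP (i, j)).
    exact: (bP (i, j)).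
  apply: filterS => B hB.
  apply: (@le_lt_trans _ _ (\sum_(i < n) \sum_(j < n) d)).
    by apply: ler_sum => i _; apply: ler_sum => j _; rewrite !mxE; have := hB (i, j); rewrite mxE => /ltW.
  under eq_bigr do rewrite sumr_const card_ord.
  rewrite sumr_const card_ord -mulrnA -mulr_natr /d mulrAC ltr_pdivrMr//.
  by rewrite ltr_pM2l// ltr_nat.
have Ainv (B : 'U[R]_n) : mxnorm (map_mx Num.conj A^T - map_mx Num.conj (unitary_val B)^T) =
    mxnorm (unitary_val B - A).
  rewrite /mxnorm exchange_big; apply: eq_bigr => i _; apply: eq_bigr => j _.
  rewrite !mxE -rmorphB -normcN -rmorphN opprB.
  by case: (_ - _) => x y /=; rewrite sqrrN.
have AU : A \is unitarymx.
  apply/unitarymxP/eqP; rewrite -subr_eq0; apply/eqP/mxnorm_eq0.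
  apply/ler_addgt0Pl => e e0; rewrite addr0.
  pose m : R := (n * n)%:R; have m0 : 0 <= m by rewrite ler0n.
  (* The three terms of the difference are at most [d * d], [d * m] and [m * d]; with [d <= 1] their
     sum is at most [d * (m + m + 1)]. *)
  pose d := Num.min 1 (e / (m + m + 1)).
  have d0 : 0 < d by rewrite lt_min ltr01 divr_gt0//; lra.
  have [B hB] := filter_ex (AP d d0).
  have := unitary_valP B => /unitarymxP <-.
  set A' := map_mx _ _; set B' := map_mx _ (unitary_val B)^T.
  have -> : A *m A' - unitary_val B *m B' =
     (A - unitary_val B) *m (A' - B') + (A - unitary_val B) *m B' + unitary_val B *m (A' - B').
    by rewrite -mulmxDr subrK mulmxBl mulmxBr addrA subrK.
  have B'm : mxnorm B' <= m by exact: (mxnorm_unitary (B^-1)%g).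
  have Bm : mxnorm (unitary_val B) <= m by exact: mxnorm_unitary.
  have h1 := mxnormM (A - unitary_val B) (A' - B').
  have h2 := mxnormM (A - unitary_val B) B'.
  have h3 := mxnormM (unitary_val B) (A' - B').
  rewrite Ainv in h1 h3; rewrite mxnorm_sub in h1 h2.
  have hd1 : d <= 1 by rewrite ge_min lexx.
  have hde : d * (m + m + 1) <= e.
    by rewrite -ler_pdivlMr ?ge_min ?lexx ?orbT//; lra.
  apply: le_trans (mxnormD _ _) _; apply: le_trans (lerD (mxnormD _ _) (lexx _)) _.
  have := mxnorm_ge0 (unitary_val B - A); nra.
exists (UnitaryGroup AU); split=> //; apply/(@unitary_cvgP _ n F _ id) => e e0.
exact: AP.
Qed.

End matrix_norm.

(** * Means of complex and matrix-valued functions *)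

Section complex_mean.
Context {R : realType} {K : topologicalGroupType}.
Hypothesis cK : compact [set: K].
Local Notation C := R[i].

Lemma continuous_Re : continuous (@complex.Re R : C -> R).
Proof.
move=> x A /nbhs_ballP[e /= e0 eA]; apply/nbhs_ballP.
exists e%:C%C; rewrite /= ?ltcR// => y; rewrite /ball /= /ball_ normcE ltcR => xy.
apply: eA; rewrite /ball /= /ball_; apply: le_lt_trans xy.
by apply: le_trans (normc_geRe _); case: (x) => a b; case: (y) => c d.
Qed.

Lemma continuous_Im : continuous (@complex.Im R : C -> R).
Proof.
move=> x A /nbhs_ballP[e /= e0 eA]; apply/nbhs_ballP.
exists e%:C%C; rewrite /= ?ltcR// => y; rewrite /ball /= /ball_ normcE ltcR => xy.
apply: eA; rewrite /ball /= /ball_; apply: le_lt_trans xy.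
by apply: le_trans (normc_geIm _); case: (x) => a b; case: (y) => c d.
Qed.

Definition cmean (f : K -> C) : C :=
  Complex (haar cK (fun x => complex.Re (f x))) (haar cK (fun x => complex.Im (f x))).

Let cRe (f : K -> C) : continuous f -> continuous (fun x => complex.Re (f x)).
Proof. by move=> cf; exact: continuous_comp_fun cf continuous_Re. Qed.

Let cIm (f : K -> C) : continuous f -> continuous (fun x => complex.Im (f x)).
Proof. by move=> cf; exact: continuous_comp_fun cf continuous_Im. Qed.

Lemma cmeanD (f g : K -> C) : continuous f -> continuous g ->
  cmean (fun x => f x + g x) = cmean f + cmean g.
Proof.
move=> cf cg; rewrite /cmean.
have -> : (fun x => complex.Re (f x + g x)) = fun x => complex.Re (f x) + complex.Re (g x).
  by apply/funext => x; case: (f x) => a b; case: (g x).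
have -> : (fun x => complex.Im (f x + g x)) = fun x => complex.Im (f x) + complex.Im (g x).
  by apply/funext => x; case: (f x) => a b; case: (g x).
by rewrite !haarD//; by [exact: cRe|exact: cIm].
Qed.

Lemma cmeanZ (c : C) (f : K -> C) : continuous f ->
  cmean (fun x => c * f x) = c * cmean f.
Proof.
case: c => a b cf; rewrite /cmean.
have -> : (fun x => complex.Re (Complex a b * f x)) =
    fun x => a * complex.Re (f x) - b * complex.Im (f x).
  by apply/funext => x; case: (f x).
have -> : (fun x => complex.Im (Complex a b * f x)) =
    fun x => a * complex.Im (f x) + b * complex.Re (f x).
  by apply/funext => x; case: (f x).
rewrite haarB ?haarD ?haarZ//; by [exact: cRe|exact: cIm|apply: continuous_scale; exact: cRe|apply: continuous_scale; exact: cIm].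
Qed.

Lemma cmean_cst (c : C) : cmean (fun=> c) = c.
Proof. by rewrite /cmean !haar_cst; case: c. Qed.

Lemma cmean_translate x (f : K -> C) : continuous f ->
  cmean (fun y => f (x * y)%g) = cmean f.
Proof.
move=> cf; rewrite /cmean; congr Complex.
  by rewrite (haar_translate cK x (cRe cf)).
by rewrite (haar_translate cK x (cIm cf)).
Qed.

Lemma cmean_sum I (r : seq I) (F : I -> K -> C) : (forall i, continuous (F i)) ->
  cmean (fun x => \sum_(i <- r) F i x) = \sum_(i <- r) cmean (F i).
Proof.
move=> cF; elim: r => [|i r IHr].
  by under eq_fun do rewrite big_nil; rewrite big_nil cmean_cst.
under eq_fun do rewrite big_cons; rewrite big_cons -IHr cmeanD//.
exact: complex_sum_continuous.
Qed.

(** The factor 2 comes from estimating real and imaginary parts separately. *)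
Lemma cmean_near (f : K -> C) (c : C) (B : R) : continuous f ->
  (forall x, normc (f x - c) <= B) -> normc (cmean f - c) <= 2 * B.
Proof.
move=> cf fB; apply: le_trans (normc_le _) _; rewrite mulr2n mulrDl mul1r.
case: c fB => a b fB /=; apply: lerD.
  rewrite -{1}(haar_cst cK a) -haarB; [|exact: cRe|exact: cst_continuous].
  apply: haar_norm.
    by apply: continuous_subr; [exact: cRe|exact: cst_continuous].
  move=> x; apply: le_trans (fB x); apply: le_trans (normc_geRe _).
  by case: (f x).
rewrite -{1}(haar_cst cK b) -haarB; [|exact: cIm|exact: cst_continuous].
apply: haar_norm.
  by apply: continuous_subr; [exact: cIm|exact: cst_continuous].
move=> x; apply: le_trans (fB x); apply: le_trans (normc_geIm _).
by case: (f x).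
Qed.

Definition mxmean m n (F : K -> 'M[C]_(m, n)) : 'M[C]_(m, n) :=
  \matrix_(i, j) cmean (fun x => F x i j).

Lemma mulmx_mxmean m n p (A : 'M[C]_(m, n)) (F : K -> 'M[C]_(n, p)) :
  (forall i j, continuous (fun x => F x i j)) ->
  A *m mxmean F = mxmean (fun x => A *m F x).
Proof.
move=> cF; apply/matrixP => i j; rewrite !mxE.
under [in RHS]eq_fun do rewrite mxE.
rewrite cmean_sum => [|k]; last first.
  by apply: complexM_continuous; [exact: cst_continuous|exact: cF].
by apply: eq_bigr => k _; rewrite mxE cmeanZ.
Qed.

Lemma mxmean_mulmx m n p (F : K -> 'M[C]_(m, n)) (A : 'M[C]_(n, p)) :
  (forall i j, continuous (fun x => F x i j)) ->
  mxmean F *m A = mxmean (fun x => F x *m A).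
Proof.
move=> cF; apply/matrixP => i j; rewrite !mxE.
under [in RHS]eq_fun do rewrite mxE.
rewrite cmean_sum => [|k]; last first.
  by apply: complexM_continuous; [exact: cF|exact: cst_continuous].
apply: eq_bigr => k _; rewrite mxE mulrC -cmeanZ//.
by congr cmean; apply/funext => x; rewrite mulrC.
Qed.

Lemma mxmean_translate m n x (F : K -> 'M[C]_(m, n)) :
  (forall i j, continuous (fun x => F x i j)) ->
  mxmean (fun y => F (x * y)%g) = mxmean F.
Proof.
move=> cF; apply/matrixP => i j; rewrite !mxE.
by rewrite (cmean_translate x (cF i j)).
Qed.

Lemma mxmean_near m n (F : K -> 'M[C]_(m, n)) (A : 'M[C]_(m, n)) (e : R) :
  (forall i j, continuous (fun x => F x i j)) ->
  (forall x, mxnorm (F x - A) <= e) -> mxnorm (mxmean F - A) <= (m * n)%:R * (2 * e).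
Proof.
move=> cF Fe; apply: (@le_trans _ _ (\sum_(i < m) \sum_(j < n) (2 * e))).
  apply: ler_sum => i _; apply: ler_sum => j _; rewrite !mxE.
  apply: cmean_near => // x; apply: le_trans (Fe x).
  by rewrite (le_trans _ (mxnorm_entry _ i j))// !mxE.
under eq_bigr do rewrite sumr_const card_ord.
by rewrite sumr_const card_ord -mulrnA [(m * n)%:R * _]mulr_natl mulnC.
Qed.

Lemma mxmean_tr n (F : K -> 'M[C]_n) : (forall i j, continuous (fun x => F x i j)) ->
  \tr (mxmean F) = cmean (fun x => \tr (F x)).
Proof.
by move=> cF; rewrite /mxtrace cmean_sum//; apply: eq_bigr => i _; rewrite mxE.
Qed.

End complex_mean.

(** * From invertible to unitary intertwiners *)

Section intertwiners.
Context {R : realType}.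
Local Notation C := R[i].

Lemma near1_unitmx n (T : 'M[C]_n) : mxnorm (T - 1%:M) < 1 -> T \in unitmx.
Proof.
move=> T1; rewrite -row_free_unit -kermx_eq0; apply/rowV0P => v.
move/sub_kermxP => vT; apply: mxnorm_eq0; rewrite leNgt; apply/negP => v0.
have : mxnorm v <= mxnorm v * mxnorm (T - 1%:M).
  apply: le_trans (mxnormM _ _); rewrite mulmxBr vT sub0r mulmx1 mxnormN.
  exact: lexx.
by rewrite leNgt -[ltRHS]mulr1 ltr_pM2l// T1.
Qed.

Local Notation "M ^*t" := (map_mx Num.conj M^T) (at level 2, format "M ^*t").

Lemma adjmxK m n (A : 'M[C]_(m, n)) : (A^*t)^*t = A.
Proof. by apply/matrixP => i j; rewrite !mxE conjCK. Qed.

Lemma adjmxM m n p (A : 'M[C]_(m, n)) (B : 'M[C]_(n, p)) : (A *m B)^*t = B^*t *m A^*t.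
Proof. by rewrite trmx_mul map_mxM. Qed.

Lemma unitary_valV n (A : 'U[R]_n) : unitary_val A^-1%g = (unitary_val A)^*t.
Proof. by []. Qed.

Lemma unitary_mulVmx n (A : 'U[R]_n) : (unitary_val A)^*t *m unitary_val A = 1%:M.
Proof. by have := congr1 val (mulVg A). Qed.

Lemma unitary_mulmxV n (A : 'U[R]_n) : unitary_val A *m (unitary_val A)^*t = 1%:M.
Proof. by have := congr1 val (mulgV A). Qed.

(* The unitary part of the polar decomposition of T. *)
Lemma unitary_intertwiner n (T : 'M[C]_n) : T \in unitmx ->
  exists M : 'U[R]_n, forall A B : 'U[R]_n,
    unitary_val A *m T = T *m unitary_val B -> (B = M^-1 * A * M)%g.
Proof.
move=> uT; pose P := T^*t *m T.
have PH : P^*t = P by rewrite adjmxM adjmxK.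
have uTa : T^*t \in unitmx by rewrite map_unitmx unitmx_tr.
have uP : P \in unitmx by rewrite unitmx_mul uTa.
have Pn : P \is normalmx by apply/eqP; rewrite PH.
have /orthomx_spectralP := Pn; set V := spectralmx P; set d := spectral_diag P => PE.
have VU : V \is unitarymx by exact: spectral_unitarymx.
have VVa : V *m V^*t = 1%:M by apply/unitarymxP.
have VaV : V^*t *m V = 1%:M by exact: mulmx1C.
have Vi : invmx V = V^*t by rewrite -[RHS](mulKmx (unitarymx_unit VU)) VVa mulmx1.
rewrite Vi in PE.
have dE : diag_mx d = (T *m V^*t)^*t *m (T *m V^*t).
  rewrite adjmxM adjmxK -mulmxA (mulmxA (T^*t)) -/P [X in _ *m (X *m _)]PE.
  by rewrite -!mulmxA VVa mulmx1 mulmxA VVa mul1mx.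
have d0 i : 0 <= d ord0 i.
  have := congr1 (fun M : 'M[C]_n => M i i) dE; rewrite !mxE eqxx mulr1n => ->.
  by apply: sumr_ge0 => j _; rewrite !mxE mulrC mul_conjC_ge0.
pose s : 'rV[C]_n := \row_i sqrtC (d ord0 i).
have sE i : s ord0 i = sqrtC (d ord0 i) by rewrite mxE.
pose S := V^*t *m diag_mx s *m V.
have SE : S = V^*t *m diag_mx s *m V by [].
have SS : S *m S = P.
  rewrite /S PE -!mulmxA (mulmxA V) VVa mul1mx (mulmxA (diag_mx s) (diag_mx s)).
  congr (_ *m (_ *m _)); apply/matrixP => i j; rewrite mul_diag_mx !mxE.
  by case: eqP => [->|_]; rewrite ?mulr0n ?mulr0// !mulr1n -expr2 sqrtCK.
have SH : S^*t = S.
  rewrite /S !adjmxM adjmxK -mulmxA; congr (_ *m (_ *m _)).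
  apply/matrixP => i j; rewrite !mxE eq_sym; case: eqP => [->|_].
    by rewrite !mulr1n geC0_conj// sqrtC_ge0.
  by rewrite !mulr0n conjC0.
have uS : S \in unitmx by move: uP; rewrite -SS unitmx_mul => /andP[].
have SiH : (invmx S)^*t = invmx S.
  have : (invmx S)^*t *m S = 1%:M by rewrite -{2}SH -adjmxM mulmxV// trmx1 map_mx1.
  by move/(congr1 (mulmx^~ (invmx S))); rewrite mulmxK// mul1mx.
pose M := T *m invmx S.
have MU : M \is unitarymx.
  have : M^*t *m M = 1%:M.
    by rewrite adjmxM SiH -mulmxA (mulmxA (T^*t)) -/P -SS mulmxK// mulVmx.
  by move/mulmx1C => h; apply/unitarymxP.
exists (UnitaryGroup MU) => A B AB.
have ABa : T^*t *m unitary_val A = unitary_val B *m T^*t.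
  have := congr1 (fun X => X^*t) AB; rewrite !adjmxM => h.
  rewrite -[LHS]mul1mx -(unitary_mulmxV B) -!mulmxA; congr (_ *m _).
  by rewrite mulmxA -h -mulmxA unitary_mulVmx mulmx1.
have BP : P *m unitary_val B = unitary_val B *m P.
  by rewrite /P -mulmxA -AB mulmxA ABa mulmxA.
have BS : S *m unitary_val B = unitary_val B *m S.
  have PV : diag_mx d *m V = V *m P by rewrite PE !mulmxA VVa mul1mx.
  have VP : V^*t *m diag_mx d = P *m V^*t by rewrite PE -!mulmxA VVa mulmx1.
  clearbody P d V s S.
  pose X := V *m unitary_val B *m V^*t.
  have XV : X *m V = V *m unitary_val B by rewrite /X -mulmxA VaV mulmx1.
  have VX : V^*t *m X = unitary_val B *m V^*t by rewrite /X !mulmxA VaV mul1mx.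
  have DX : diag_mx d *m X = X *m diag_mx d.
    rewrite /X 2!mulmxA PV -(mulmxA V P) BP -(mulmxA _ (V^*t)) VP.
    by rewrite !mulmxA.
  clearbody X.
  (* X commutes with [diag_mx d] only if [X i j] vanishes wherever d i and d j differ, and equal
     eigenvalues have equal square roots. *)
  have SX : diag_mx s *m X = X *m diag_mx s.
    apply/matrixP => i j; have := congr1 (fun M : 'M[C]_n => M i j) DX.
    rewrite !mul_diag_mx !mul_mx_diag !mxE mulrC => h.
    have [->|X0] := eqVneq (X i j) 0; first by rewrite mul0r mulr0.
    by rewrite !sE (mulfI X0 h) mulrC.
  by rewrite SE -(mulmxA _ V) -XV mulmxA -(mulmxA (V^*t)) SX mulmxA VX -!mulmxA.
apply: (@mulgI _ (UnitaryGroup MU)); rewrite !mulgA mulgV mul1g.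
apply: val_inj => /=; rewrite /M mulmxA AB -!mulmxA; congr (_ *m _).
by rewrite -[LHS](mulmxK uS) -[invmx S *m _ *m S]mulmxA -BS mulKmx.
Qed.

End intertwiners.

(** The hypothesis on e puts the mean of sigma rho^-1 within 1 of the identity: the inner
    [(n * n)%:R] bounds the norm of rho(x)^-1, the 2 is that of [cmean_near], and the outer factor
    counts the entries. *)
Lemma rep_near_equivalent (R : realType) (K : topologicalGroupType) n
    (cK : compact [set: K]) (rho sigma : rep R K n) (e : R) :
  (n * n)%:R * (2 * (e * (n * n)%:R)) < 1 ->
  (forall x, mxnorm (unitary_val (sigma x) - unitary_val (rho x)) <= e) ->
  rep_equivalent rho sigma.
Proof.
move=> e1 sre; pose F x := unitary_val (sigma x * (rho x)^-1)%g.
have cF i j : continuous (fun x => F x i j).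
  move: i j; apply/unitary_continuousP; apply: mulg_continuous_comp.
    exact: rep_continuous.
  by apply: continuous_invg_comp; exact: rep_continuous.
have FT x y : F (x * y)%g = unitary_val (sigma x) *m F y *m unitary_val (rho x)^-1%g.
  transitivity (unitary_val (sigma x * (sigma y * (rho y)^-1) * (rho x)^-1)%g) => //.
  by rewrite /F !repM invgM !mulgA.
have h1 : mxmean cK F \in unitmx.
  apply: near1_unitmx; apply: le_lt_trans e1; apply: mxmean_near => // x.
  have -> : F x - 1%:M =
      (unitary_val (sigma x) - unitary_val (rho x)) *m unitary_val (rho x)^-1%g.
    by rewrite mulmxBl unitary_mulmxV.
  apply: le_trans (mxnormM _ _) _; apply: ler_pM; rewrite ?mxnorm_ge0//.
  exact: mxnorm_unitary.
have [M MP] := unitary_intertwiner h1; exists M => x; apply: MP.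
have cl i j : continuous (fun y => (unitary_val (sigma x) *m F y) i j).
  under eq_fun do rewrite mxE; apply: complex_sum_continuous => k.
  by apply: complexM_continuous; [exact: cst_continuous|exact: cF].
have h2 : mxmean cK F =
    unitary_val (sigma x) *m mxmean cK F *m unitary_val (rho x)^-1%g.
  rewrite -[LHS](mxmean_translate cK x cF) (mulmx_mxmean cK _ cF).
  rewrite (mxmean_mulmx cK _ cl); congr mxmean; apply/funext => y; exact: FT.
by rewrite [in RHS]h2 -mulmxA unitary_mulVmx mulmx1.
Qed.

(** * Compactness in the space of representations *)

Section local_compactness.
Context {R : realType} {G : topologicalGroupType}.
Variable n : nat.
Implicit Types rho sigma tau : rep R G n.

Lemma rep_cvg (F : set_system (rep R G n)) (FF : Filter F) tau :
  (forall (K : set G) (O : set 'U[R]_n), compact K -> open O ->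
    (forall x, K x -> O (tau x)) ->
    F [set sigma : rep R G n | forall x, K x -> O (sigma x)]) -> F --> tau.
Proof.
move=> h A [_ [[W oW <-] /= Wt] WA].
have : set_val @ F --> (set_val tau : {compact-open, G -> 'U[R]_n}).
  apply/compact_open_cvgP => K O cK oO tO.
  have hF := h K O cK oO (fun x Kx => tO _ (ex_intro2 _ _ x Kx erefl)).
  apply: (@filterS _ F _ _ _ _ hF) => sigma sO _ [x Kx <-]; exact: sO.
move=> /(_ W (open_nbhs_nbhs (conj oW Wt))) hF.
by apply: (@filterS _ F _ _ _ _ hF) => sigma; exact: WA.
Qed.

Lemma rep_compact_open rho (K : set G) (O : set 'U[R]_n) : compact K -> open O ->
  (forall x, K x -> O (rho x)) -> nbhs rho [set sigma : rep R G n | forall x, K x -> O (sigma x)].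
Proof.
move=> cK oO rO.
have : nbhs (set_val rho : {compact-open, G -> 'U[R]_n}) [set g | g @` K `<=` O].
  apply: open_nbhs_nbhs; split; first exact: compact_open_open.
  by move=> _ [x Kx <-]; exact: rO.
move=> /(@initial_continuous _ _ (set_val : rep R G n -> _)) hF.
by apply: (@filterS _ (nbhs rho) _ _ _ _ hF) => sigma sO x Kx; apply: sO; exists x.
Qed.

Lemma rep_eval_continuous x : continuous (fun tau : rep R G n => tau x).
Proof.
move=> tau A; rewrite {1}nbhsE => -[V [oV Vtx] VA].
have : nbhs tau [set sigma : rep R G n | forall y, [set x] y -> V (sigma y)].
  by apply: rep_compact_open => //; [exact: compact_set1|move=> y ->].
by apply: filterS => sigma sV; apply: VA; exact: sV.
Qed.

Lemma rep_hausdorff : hausdorff_space (rep R G n).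
Proof.
move=> rho sigma rs; apply: rep_eq => x; apply: (@unitary_hausdorff R n).
move=> A B Ax Bx.
have [tau [h1 h2]] := rs _ _ (rep_eval_continuous Ax) (rep_eval_continuous Bx).
by exists ((tau : rep R G n) x).
Qed.

(** With [D = u - 1] one has [u * u - 1 = 2 D + D ^ 2]. The bound 1/2 lets |D|^2 <= |D| / 2 be
    absorbed on the left, which leaves 3/2 |D|. *)
Lemma double_dist (u : 'U[R]_n) : mxnorm (unitary_val u - 1%:M) <= 1 / 2 ->
  mxnorm (unitary_val u - 1%:M) <= 2 / 3 * mxnorm (unitary_val (u * u)%g - 1%:M).
Proof.
set D := unitary_val u - 1%:M => hD.
have : D *+ 2 = unitary_val (u * u)%g - 1%:M - D *m D.
  rewrite /D mulmxBl mul1mx mulmxBr mulmx1 /=.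
  by rewrite mulr2n opprB [in RHS]addrC addrA addrC; apply/matrixP => i j; rewrite !mxE; ring.
move/(congr1 (@mxnorm R n n)) => h.
have h2 : mxnorm (D *+ 2) = 2 * mxnorm D.
  rewrite mulr_sumr; apply: eq_bigr => i _; rewrite mulr_sumr; apply: eq_bigr => j _.
  by rewrite mulrS mulr1n !mxE -mulr2n normcMn mulr_natl.
have := mxnormD (unitary_val (u * u)%g - 1%:M) (- (D *m D)).
rewrite -h h2 mxnormN; have := mxnormM D D; have := mxnorm_ge0 D.
nra.
Qed.

(** The threshold is that of [double_dist]; the non-strict inequality survives pointwise limits. *)
Definition near_one (V : set G) : set (rep R G n) :=
  [set sigma | forall x, V x -> mxnorm (unitary_val (sigma x) - 1%:M) <= 1 / 2].

(* The unitary group has no small subgroups: if all [sigma x ^+ (2 ^ j)] stay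
   close to 1 then [sigma x] is very close to 1, uniformly in sigma. *)
Lemma near_one_equicontinuous (V : set G) (k : nat) : nbhs 1%g V ->
  \forall x \near (1%g : G), forall sigma, near_one V sigma ->
    mxnorm (unitary_val (sigma x) - 1%:M) <= (2 / 3) ^+ k.
Proof.
move=> V1; elim: k => [|k IHk].
  apply: filterS V1 => x Vx sigma /(_ x Vx); rewrite expr0; lra.
have sq : (x * x)%g @[x --> (1%g : G)] --> (1%g : G).
  rewrite -[X in _ --> X](mulg1 1%g).
  by apply: (@mulg_continuous_comp G G id id) => ?; exact: cvg_id.
apply: filterS (filterI V1 (sq _ IHk)) => x [Vx hx] sigma sV.
rewrite exprS; apply: le_trans (double_dist (sV x Vx)) _.
by rewrite ler_wpM2l//; have := hx sigma sV; rewrite repM.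
Qed.

Lemma near_one_equicontinuous_at (V : set G) (x : G) (e : R) : nbhs 1%g V -> 0 < e ->
  \forall y \near x, forall sigma, near_one V sigma -> uball (sigma x) e (sigma y).
Proof.
move=> V1 e0; pose m : R := (n * n)%:R; have m0 : 0 <= m by exact: ler0n.
have [k hk] : exists k, m * (2 / 3) ^+ k < e.
  have : m * (2 / 3 : R) ^+ j @[j --> \oo] --> m * 0.
    apply: continuous_cvg; first exact: mulrl_continuous.
    by apply: cvg_expr; rewrite ger0_norm; lra.
  rewrite mulr0 => /cvgrPdist_lt/(_ e e0)[j _ /(_ j (leqnn j))] /=.
  by rewrite sub0r normrN => h; exists j; apply: le_lt_trans h; exact: ler_norm.
have tr : (x^-1 * y)%g @[y --> x] --> (1%g : G).
  rewrite -[X in _ --> X](mulVg x).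
  apply: (@mulg_continuous_comp G G (fun=> x^-1)%g id); first exact: cst_continuous.
  by move=> ?; exact: cvg_id.
near=> y => sigma sV.
have hy : forall sigma, near_one V sigma ->
    mxnorm (unitary_val (sigma (x^-1 * y)%g) - 1%:M) <= (2 / 3) ^+ k.
  by near: y; exact: (tr _ (near_one_equicontinuous k V1)).
have -> : sigma y = (sigma x * sigma (x^-1 * y))%g by rewrite -repM mulgA mulgV mul1g.
apply: le_lt_trans hk; have {hy} := hy sigma sV; rewrite /uball /=.
have -> : unitary_val (sigma x) *m unitary_val (sigma (x^-1 * y)%g) - unitary_val (sigma x) =
  unitary_val (sigma x) *m (unitary_val (sigma (x^-1 * y)%g) - 1%:M).
  by rewrite mulmxBr mulmx1.
move=> hy; apply: le_trans (mxnormM _ _) _; apply: ler_pM; rewrite ?mxnorm_ge0//.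
exact: mxnorm_unitary.
Unshelve. all: by end_near. Qed.

(** Arzela-Ascoli for representations: the pointwise limit along an ultrafilter is a morphism,
    equicontinuity makes it continuous, and it makes the convergence uniform on compact sets. *)
Lemma near_one_compact (V : set G) : nbhs 1%g V -> compact (near_one V).
Proof.
move=> V1; rewrite compact_ultra => F UF FV.
have FF : ProperFilter F by exact: ultra_proper.
have /choice[t tP] : forall x : G, exists u : 'U[R]_n,
    (fun sigma : rep R G n => sigma x) @ F --> u.
  move=> x; pose H := (fun sigma : rep R G n => sigma x) @ F.
  have [u [_ Hu]] := @unitary_compact R n H (fmap_proper_filter _ FF) (@filterT _ F _).
  exists u; suff UH : UltraFilter H.
    by move: Hu; rewrite (_ : cluster _ u = [set p | H --> p] u)// -ultra_cvg_clusterE.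
  split; first exact: fmap_proper_filter.
  move=> D PD sub; apply/seteqP; split=> // A DA.
  have [//|nA] := in_ultra_setVsetC ((fun sigma : rep R G n => sigma x) @^-1` A) UF.
  have /sub DnA : H (~` A) by rewrite /H /= -preimage_setC.
  by case: (filter_ex (@filterI _ D (@filter_filter _ _ PD) _ _ DA DnA)) => ? [].
have tM : {morph t : x y / (x * y)%g}.
  move=> x y; apply: (@cvg_unique _ (@unitary_hausdorff R n) _ _ _ _ (tP (x * y)%g)).
  have -> : (fun sigma : rep R G n => sigma (x * y)%g) =
      fun sigma : rep R G n => (sigma x * sigma y)%g.
    by apply/funext => sigma; exact: repM.
  exact: (cvg_comp2 (tP x) (tP y) (@mulg_continuous _ (t x, t y))).
have tball x (e : R) : 0 < e -> F [set sigma : rep R G n | uball (t x) e (sigma x)].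
  by move=> e0; exact: (tP x _ (nbhs_uball (t x) e0)).
have tc : continuous t.
  move=> x; apply/unitary_cvgP => e e0; have e30 : 0 < e / 3 by lra.
  apply: filterS (near_one_equicontinuous_at x V1 e30) => y hy.
  have [sigma [sV [h1 h2]]] := filter_ex (filterI FV (filterI (tball x _ e30) (tball y _ e30))).
  have := hy sigma sV; move: h1 h2; rewrite /uball /=.
  have := mxnorm_triangle (unitary_val (sigma y)) (unitary_val (t y)) (unitary_val (t x)).
  have := mxnorm_triangle (unitary_val (sigma x)) (unitary_val (sigma y)) (unitary_val (t x)).
  by rewrite (mxnorm_sub (unitary_val (t y)) (unitary_val (sigma y))); lra.
exists (mk_rep tc tM); split.
  move=> x Vx; apply/ler_addgt0Pl => e e0.
  have [sigma [sV]] := filter_ex (filterI FV (tball x _ e0)).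
  rewrite /uball /= mxnorm_sub.
  have := mxnorm_triangle (unitary_val (sigma x)) (unitary_val (t x)) 1%:M.
  by have := sV x Vx; lra.
apply: rep_cvg => K O cK oO tO.
have /compact_near_coveringP/near_covering_withinP := cK.
move=> /(_ _ F (fun sigma x => O (sigma x)) _); apply => x Kx.
have [e e0 eO] : exists2 e : R, 0 < e & uball (t x) e `<=` O.
  by apply: nbhs_unitaryP; apply: open_nbhs_nbhs; split=> //; exact: tO.
have e20 : 0 < e / 2 by lra.
exists ([set y | forall sigma, near_one V sigma -> uball (sigma x) (e / 2) (sigma y)],
  [set sigma | near_one V sigma /\ uball (t x) (e / 2) (sigma x)]) => /=.
  split; first exact: near_one_equicontinuous_at.
  by apply: filterI => //; exact: tball.
move=> [y sigma] /= [h1 [sV h2]] Ky; apply: eO.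
have := h1 _ sV; move: h2; rewrite /uball /=.
have := mxnorm_triangle (unitary_val (sigma x)) (unitary_val (sigma y)) (unitary_val (t x)).
lra.
Qed.

(** V is cut out of a compact neighbourhood of 1 by a closed condition with 1/4, so that it keeps a
    compact-open neighbourhood of rho inside the threshold 1/2. *)
Lemma near_one_nbhs rho : locally_compact [set: G] ->
  exists2 V : set G, nbhs 1%g V & nbhs rho (near_one V).
Proof.
move=> lcG; have [B] := @lcG 1%g I; rewrite withinET => B1 [cB clB].
pose D := [set x | mxnorm (unitary_val (rho x) - 1%:M) <= 1 / 4].
have cD : continuous (fun x => mxnorm (unitary_val (rho x) - unitary_val (1%g : 'U[R]_n))).
  by apply: continuous_unitary_dist; [exact: rep_continuous|exact: cst_continuous].
have clD : closed D.
  by apply: (iffLR (continuous_closedP _) cD [set r | r <= 1 / 4]); exact: num_normedtype.closed_le.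
have D1 : nbhs (1%g : G) D.
  have e0 : 0 < 1 / 4 :> R by lra.
  have /cvgrPdist_lt/(_ _ e0) := cD 1%g; apply: filterS => x.
  by rewrite rep1 subrr mxnorm0 sub0r normrN ger0_norm ?mxnorm_ge0// => /ltW.
exists (B `&` D); first exact: filterI.
have : nbhs rho [set sigma : rep R G n | forall x, (B `&` D) x -> uball 1%g (1 / 2) (sigma x)].
  apply: rep_compact_open; [exact: compact_closedI|exact: open_uball|].
  by move=> x [_]; rewrite /D /uball /=; lra.
by apply: filterS => sigma h x Vx; apply/ltW/h.
Qed.

End local_compactness.

(** * Equicontinuity of a compact bidual *)

Section equicontinuous_bidual.
Context {R : realType} {G : topologicalGroupType}.
Hypothesis lcG : locally_compact [set: G].
Hypothesis cX : compact [set: quasi_dual R G].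

Lemma quasi_dual_equicontinuous n (rho : rep R G n.+1) (e : R) : 0 < e ->
  \forall sigma \near rho, forall p : quasi_dual R G,
    uball (quasi_comp p rho) e (quasi_comp p sigma).
Proof.
move=> e0; have e20 : 0 < e / 2 by lra.
apply: (compact_tube cX (P := fun sigma (p : quasi_dual R G) =>
  uball (quasi_comp p rho) e (quasi_comp p sigma))) => p.
have [V V1 rV] := near_one_nbhs rho lcG.
have cV := @near_one_compact R G n.+1 V V1.
have [N rN NV] : exists2 N, nbhs rho N & closure N `<=`
    [set sigma | uball (quasi_comp p rho) (e / 2) (quasi_comp p sigma)].
  apply: (compact_regular (@rep_hausdorff R G n.+1) cV rV).
  by apply: (@quasi_comp_continuous _ _ p n rho); exact: nbhs_uball.
(* The compact-open topology controls q near p on compact sets only; K is compact and contains the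
   representations of a whole neighbourhood of rho. *)
pose K := @rep_of R G n @` (near_one V `&` closure N).
have cK : compact K.
  apply: continuous_compact; last first.
    by apply: compact_closedI => //; exact: closed_closure.
  by apply: continuous_subspaceT; exact: rep_of_continuous.
pose O := @unitary_of R n @` uball (quasi_comp p rho) (e / 2).
have oO : open O by apply: existT_open_map; exact: open_uball.
exists ([set q : quasi_dual R G | forall D, K D -> O (q D)], near_one V `&` N) => /=.
  split; last exact: filterI.
  have : nbhs (set_val p : {compact-open, chu_dual R G -> unitary_sum R})
      [set g | g @` K `<=` O].
    apply: open_nbhs_nbhs; split; first exact: compact_open_open.
    move=> _ [_ [sigma [_ sN] <-] <-].
    rewrite [X in O X](_ : _ = unitary_of (quasi_comp p sigma)); last exact: quasi_compE.
    by exists (quasi_comp p sigma) => //; exact: NV.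
  move=> /(@initial_continuous _ _ (set_val : quasi_dual R G -> _)) hF.
  by apply: (@filterS _ (nbhs p) _ _ _ _ hF) => q qO D KD; apply: qO; exists D.
move=> [q sigma] /= [qO [sV sN]].
have hO tau : near_one V tau -> N tau -> uball (quasi_comp p rho) (e / 2) (quasi_comp q tau).
  move=> tV tN; have [|u up] := qO (rep_of tau).
    by exists tau => //; split=> //; exact: subset_closure.
  by rewrite quasi_compE => /unitary_of_inj <-.
have := hO sigma sV sN; have := hO rho (nbhs_singleton rV) (nbhs_singleton rN).
rewrite /uball /= mxnorm_sub.
have := mxnorm_triangle (unitary_val (quasi_comp p rho)) (unitary_val (quasi_comp q sigma))
  (unitary_val (quasi_comp q rho)).
lra.
Qed.

End equicontinuous_bidual.

(** * Representations of the Bohr compactification *)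

Section bohr_extension.
Context {R : realType} {G bG : topologicalGroupType} {b : G -> bG}.
Hypothesis bohrG : is_bohr_compactification b.

Lemma bohr_closed (P : set bG) : closed P -> (forall x, P (b x)) -> forall y, P y.
Proof.
move=> cP Pb y; have : closure (range b) y by rewrite (bohr_dense bohrG).
by rewrite [P](iffLR (closure_id P) cP); apply: closure_subset => _ [x _ <-].
Qed.

Lemma bohr_eq (T : topologicalType) (f g : bG -> T) : hausdorff_space T ->
  continuous f -> continuous g -> (forall x, f (b x) = g (b x)) -> f =1 g.
Proof.
move=> hT cf cg fg; apply: bohr_closed => // y yP; apply: hT => A B Ay By.
have [z [/= zP [Az Bz]]] := yP _ (@filterI _ (nbhs y) _ _ _ (cf y A Ay) (cg y B By)).
by exists (f z); split=> //; rewrite zP.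
Qed.

Fact bohr_rep_subproof n (rho : rep R G n) :
  exists rho' : rep R bG n, forall x, rho' (b x) = rho x.
Proof.
have [hb [cb bM ->]] := bohr_universal bohrG (@unitary_compact R n)
  (@unitary_hausdorff R n) (rep_continuous (rho := rho)) (repM rho).
by exists (mk_rep cb bM).
Qed.

Definition bohr_rep n (rho : rep R G n) : rep R bG n := sval (cid (bohr_rep_subproof rho)).

Lemma bohr_repE n (rho : rep R G n) x : bohr_rep rho (b x) = rho x.
Proof. exact: (svalP (cid (bohr_rep_subproof rho))). Qed.

Lemma bohr_rep_uniq n (rho : rep R G n) (rho' : rep R bG n) :
  (forall x, rho' (b x) = rho x) -> bohr_rep rho = rho'.
Proof.
move=> h; apply: rep_eq; apply: bohr_eq; first exact: unitary_hausdorff.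
- exact: rep_continuous.
- exact: rep_continuous.
- by move=> x; rewrite bohr_repE h.
Qed.

Lemma bohr_rep_dsum m n (D : rep R G m) (E : rep R G n) y :
  bohr_rep (rep_dsum D E) y = unitary_dsum (bohr_rep D y) (bohr_rep E y).
Proof.
rewrite (@bohr_rep_uniq _ _ (rep_dsum (bohr_rep D) (bohr_rep E)))// => x.
by rewrite -[LHS]/(unitary_dsum _ _) !bohr_repE.
Qed.

Lemma bohr_rep_tens m n (D : rep R G m) (E : rep R G n) y :
  bohr_rep (rep_tens D E) y = unitary_tens (bohr_rep D y) (bohr_rep E y).
Proof.
rewrite (@bohr_rep_uniq _ _ (rep_tens (bohr_rep D) (bohr_rep E)))// => x.
by rewrite -[LHS]/(unitary_tens _ _) !bohr_repE.
Qed.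

Lemma bohr_rep_conj n (M : 'U[R]_n) (D : rep R G n) y :
  bohr_rep (rep_conj M D) y = (M^-1 * bohr_rep D y * M)%g.
Proof.
rewrite (@bohr_rep_uniq _ _ (rep_conj M (bohr_rep D)))// => x.
by rewrite -[LHS]/(M^-1 * _ * M)%g bohr_repE.
Qed.

(** Density transfers closed conditions, so the strict bound on G becomes non-strict on bG. *)
Lemma bohr_rep_uball n (rho sigma : rep R G n) (e : R) :
  (forall x, uball (rho x) e (sigma x)) ->
  forall y, mxnorm (unitary_val (bohr_rep sigma y) - unitary_val (bohr_rep rho y)) <= e.
Proof.
move=> h; apply: (@bohr_closed [set y | mxnorm (unitary_val (bohr_rep sigma y) -
  unitary_val (bohr_rep rho y)) <= e]) => [|x /=]; last by rewrite !bohr_repE; exact/ltW/h.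
have cd : continuous (fun y => mxnorm (unitary_val (bohr_rep sigma y) - unitary_val (bohr_rep rho y))).
  by apply: continuous_unitary_dist; exact: rep_continuous.
by apply: (iffLR (continuous_closedP _) cd [set r | r <= e]); exact: num_normedtype.closed_le.
Qed.

End bohr_extension.

Section evaluation.
Context {R : realType} {G : topologicalGroupType}.

Fact eval_subproof (x : G) : quasi_representation
  (fun D : chu_dual R G => unitary_of (rep_fun (tagged D) x)).
Proof.
apply: (@quasi_representation_comp R G (fun n (D : rep R G n.+1) => D x)) => //.
by move=> n; exact: rep_eval_continuous.
Qed.

Definition evaluation (x : G) : quasi_dual R G := mk_quasi (eval_subproof x).

Lemma quasi_comp_evaluation x n (D : rep R G n.+1) : quasi_comp (evaluation x) D = D x.
Proof. by apply: unitary_of_inj; rewrite -quasi_compE. Qed.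

End evaluation.

Section classes.
Context {R : realType} {G : topologicalGroupType}.
Variable n : nat.

Lemma discrete_rep_classesP : discrete_space (rep_classes R G n) <->
  forall rho : rep R G n, nbhs rho [set sigma | rep_equivalent rho sigma].
Proof.
split=> [dG rho|h A].
  have : open ((\pi_(rep_classes R G n)%qT : rep R G n -> _) @^-1` [set \pi_(rep_classes R G n)%qT rho]).
    exact: dG.
  rewrite openE => /(_ rho erefl); apply: filterS => sigma /= /eqmodP h.
  by apply/asboolP; rewrite -[asbool _]/(rep_equivb rho sigma) rep_equivb_sym.
suff : open ((\pi_(rep_classes R G n)%qT : rep R G n -> _) @^-1` A) by [].
rewrite openE => rho Ar; apply: filterS (h rho) => sigma rs.
rewrite /preimage /=; suff -> : \pi_(rep_classes R G n)%qT sigma = \pi_(rep_classes R G n)%qT rho by [].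
by apply/esym/eqmodP/asboolP.
Qed.

End classes.

(** * An isomorphism forces discrete classes *)

Section discrete_of_isomorphic.
Context {R : realType} {G bG : topologicalGroupType} {b : G -> bG}.
Hypothesis bohrG : is_bohr_compactification b.
Hypothesis lcG : locally_compact [set: G].

Lemma isomorphic_discrete : topologically_isomorphic (quasi_dual R G) bG ->
  forall n, (1 <= n)%N -> discrete_space (rep_classes R G n).
Proof.
move=> [f [g [_ fK _ _ cg]]] [//|n] _; apply/discrete_rep_classesP => rho.
have cX : compact [set: quasi_dual R G].
  have -> : [set: quasi_dual R G] = g @` [set: bG].
    by apply/seteqP; split=> // p _; exists (f p).
  apply: continuous_compact; last exact: (bohr_compact bohrG).
  exact: continuous_subspaceT.
pose N : R := (n.+1 * n.+1)%:R.
have N0 : 0 < N by rewrite ltr0n.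
(* Makes the quantity that [rep_near_equivalent] wants below 1 equal to 2/3. *)
pose e : R := (3 * N * N)^-1.
have e0 : 0 < e by rewrite invr_gt0 !mulr_gt0.
apply: filterS (quasi_dual_equicontinuous lcG cX rho e0) => sigma h.
have [||M MP] := @rep_near_equivalent R bG n.+1 (bohr_compact bohrG)
   (bohr_rep bohrG rho) (bohr_rep bohrG sigma) e.
- rewrite -/N (_ : _ * _ = 2 / 3); first lra.
  by rewrite /e; field; rewrite gt_eqF.
- apply: bohr_rep_uball => x.
  by have := h (evaluation x); rewrite !quasi_comp_evaluation.
by exists M => x; have := MP (b x); rewrite !bohr_repE.
Qed.

End discrete_of_isomorphic.

(** * The map from bG to the bidual when classes are open *)

Section dual_map.
Context {R : realType} {G bG : topologicalGroupType} {b : G -> bG}.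
Hypothesis bohrG : is_bohr_compactification b.
Hypothesis discG : forall n, (1 <= n)%N -> discrete_space (rep_classes R G n).
Local Notation ext := (bohr_rep bohrG).
Let cK := bohr_compact bohrG.

Lemma rep_conj_param_continuous n (rho : rep R G n) : continuous (fun M : 'U[R]_n => rep_conj M rho).
Proof.
move=> M0; have FF : Filter ((fun M : 'U[R]_n => rep_conj M rho) @ M0) by exact: (fmap_filter _ (nbhs_filter M0)).
apply: (rep_cvg FF) => K O cKK oO rO.
have /compact_near_coveringP/near_covering_withinP := cKK.
move=> /(_ _ (nbhs M0) (fun M x => O (M^-1 * rho x * M)%g) _) h.
apply: h => x Kx.
have cc : continuous (fun xM : G * 'U[R]_n => (xM.2^-1 * rho xM.1 * xM.2)%g).
  apply: mulg_continuous_comp; last exact: snd_continuous.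
  apply: mulg_continuous_comp.
    by apply: continuous_invg_comp; exact: snd_continuous.
  apply: (continuous_comp_fun (@fst_continuous _ _)); exact: rep_continuous.
have [[A B] /= [Ax BM] AB] := cc (x, M0) O (open_nbhs_nbhs (conj oO (rO x Kx))).
by exists (A, B) => // -[y M] /= h _; exact: (AB (y, M)).
Qed.

(* A class is open, and it is the quotient of the compact unitary group by the
   stabiliser of rho: near rho, a representation is conjugate to rho by a
   unitary matrix close to that stabiliser. *)
Lemma bohr_rep_near n (rho : rep R G n.+1) (e : R) : 0 < e ->
  nbhs rho [set sigma | forall y, uball (ext rho y) e (ext sigma y)].
Proof.
move=> e0; pose O := [set M : 'U[R]_n.+1 | forall y, uball (ext rho y) e (M^-1 * ext rho y * M)%g].
have OS M : rep_conj M rho = rho -> O^° M.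
  move=> Mrho.
  have hM y : (M^-1 * ext rho y * M)%g = ext rho y by rewrite -bohr_rep_conj Mrho.
  pose h (Ny : 'U[R]_n.+1 * bG) := mxnorm (unitary_val (Ny.1^-1 * ext rho Ny.2 * Ny.1)%g -
     unitary_val (ext rho Ny.2)).
  have cc : continuous (fun Ny : 'U[R]_n.+1 * bG => ext rho Ny.2).
    apply: (continuous_comp_fun (@snd_continuous _ _)); exact: rep_continuous.
  have ch : continuous h.
    apply: continuous_unitary_dist => //.
    apply: mulg_continuous_comp; last exact: fst_continuous.
    apply: mulg_continuous_comp => //.
    by apply: continuous_invg_comp; exact: fst_continuous.
  apply: filterS (tube_dist cK M ch e0) => N hN y; have := hN y.
  have -> : h (M, y) = 0 by rewrite /h hM subrr mxnorm0.
  by rewrite subr0 ger0_norm ?mxnorm_ge0.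
(* The conjugates of rho by matrices outside the interior of O form a compact set, which misses rho
   by [OS]. A representation off C but in the open class of rho has its conjugator in O. *)
pose C := [set rep_conj M rho | M in ~` O^°].
have cC : compact C.
  apply: continuous_compact; first exact/continuous_subspaceT/rep_conj_param_continuous.
  apply: (subclosed_compact _ (@unitary_compact R n.+1)) => //.
  by apply: open_closedC; exact: open_interior.
have : nbhs rho (~` C).
  apply: open_nbhs_nbhs; split.
    by apply: closed_openC; apply: compact_closed => //; exact: rep_hausdorff.
  by move=> [M nO Mrho]; apply: nO; exact: OS.
have dn := iffLR (discrete_rep_classesP _) (discG (ltn0Sn n)) rho.
move=> hC; apply: filterS (filterI hC dn) => sigma /= [nC [N rhoE]].
have sE : sigma = rep_conj N^-1%g rho.
  by apply: rep_eq => x; rewrite -[RHS]/(N^-1^-1 * _ * N^-1)%g rhoE invgK !mulgA mulgV mul1g mulgK.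
move=> y; rewrite sE bohr_rep_conj.
have /interior_subset : O^° N^-1%g.
  by apply: contrapT => nO; apply: nC; exists N^-1%g.
by apply.
Qed.

(** Open classes enter through continuity in D; the algebraic clauses hold by uniqueness of
    extensions from G to bG. *)
Fact dual_map_subproof (y : bG) : quasi_representation
  (fun D : chu_dual R G => unitary_of (rep_fun (ext (tagged D)) y)).
Proof.
apply: (@quasi_representation_comp R G (fun n (D : rep R G n.+1) => ext D y)).
- move=> n rho.
  apply/(@unitary_cvgP R _ _ (nbhs rho) (nbhs_filter rho) (fun D => ext D y)) => e e0.
  by apply: filterS (bohr_rep_near rho e0) => sigma; exact.
- by move=> m n D E; exact: (bohr_rep_dsum bohrG D E y).
- by move=> m n D E; exact: (bohr_rep_tens bohrG D E y).
- by move=> n M D; exact: (bohr_rep_conj bohrG M D y).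
Qed.

Definition dual_map (y : bG) : quasi_dual R G := mk_quasi (dual_map_subproof y).

Lemma quasi_comp_dual_map y n (D : rep R G n.+1) : quasi_comp (dual_map y) D = ext D y.
Proof. by apply: unitary_of_inj; rewrite -quasi_compE. Qed.

Lemma quasi_comp_mul (p q : quasi_dual R G) n (D : rep R G n.+1) :
  quasi_comp (p * q)%g D = (quasi_comp p D * quasi_comp q D)%g.
Proof.
apply: unitary_of_inj; rewrite -quasi_compE.
by rewrite -[LHS]/(usum_mul (p (rep_of D)) (q (rep_of D))) !quasi_compE usum_mulE.
Qed.

Lemma dual_mapM : {morph dual_map : x y / (x * y)%g}.
Proof.
by move=> x y; apply: quasi_comp_eq => n D; rewrite quasi_comp_mul !quasi_comp_dual_map repM.
Qed.

(** Uniform nearness of extensions makes [ext D y] jointly continuous in D and y, as convergence on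
    compact sets of representations requires. *)
Lemma dual_map_continuous : continuous dual_map.
Proof.
move=> y0 A [_ [[W oW <-] /= Wt] WA].
have : set_val (dual_map y) @[y --> y0] -->
    (set_val (dual_map y0) : {compact-open, chu_dual R G -> unitary_sum R}).
  apply/compact_open_cvgP => K O cKK oO tO.
  have /compact_near_coveringP/near_covering_withinP := cKK.
  move=> /(_ _ (nbhs y0) (fun y D => O (dual_map y D)) _) h.
  have {h} h : \forall y \near y0, K `<=` (fun D => O (dual_map y D)).
    apply: h => -[n rho] Krho.
    have : O (unitary_of (ext rho y0)) by apply: tO; exists (rep_of rho).
    move=> /(conj oO)/open_nbhs_nbhs/unitary_of_continuous/nbhs_unitaryP[e e0 eO].
    have e20 : 0 < e / 2 by lra.
    exists ([set D | exists sigma : rep R G n.+1, D = rep_of sigma /\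
         forall y, uball (ext rho y) (e / 2) (ext sigma y)],
      [set y | uball (ext rho y0) (e / 2) (ext rho y)]) => /=.
      split.
        apply: (@filterS _ (nbhs (existT _ n rho : chu_dual R G)) _
          (@rep_of R G n @` [set sigma : rep R G n.+1 | forall y, uball (ext rho y) (e / 2) (ext sigma y)])).
          by move=> _ [sigma h <-]; exists sigma.
        have := bohr_rep_near rho e20; rewrite nbhsE => -[B [oB Brho] BV].
        apply: (@filterS _ (nbhs (existT _ n rho : chu_dual R G)) _ (@rep_of R G n @` B)).
          by move=> _ [sigma h <-]; exists sigma => //; exact: BV.
        apply: open_nbhs_nbhs; split; first exact: existT_open_map.
        by exists rho.
      exact: (rep_continuous (rho := ext rho) (nbhs_uball (ext rho y0) e20)).
    move=> [_ y] /= [[sigma [-> h1]] h2] _.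
    apply: (eO (ext sigma y)); have := h1 y; move: h2; rewrite /uball /=.
    have := mxnorm_triangle (unitary_val (ext rho y)) (unitary_val (ext sigma y)) (unitary_val (ext rho y0)).
    lra.
  by apply: filterS h => y h _ [D KD <-]; exact: h.
move=> /(_ W (open_nbhs_nbhs (conj oW Wt))) hF.
by apply: (@filterS _ (nbhs y0) _ _ _ _ hF) => y; exact: WA.
Qed.

Lemma dual_map_inj : injective dual_map.
Proof.
move=> y z yz; apply/eqP; rewrite -(can_eq (mulgK z^-1%g)) mulgV; apply/eqP.
apply: (@peter_weyl R bG _ cK (bohr_hausdorff bohrG)) => n rho.
(* Every representation of bG is the extension of its pullback to G, so the hypothesis of
   [peter_weyl] holds at [y * z^-1]. *)
pose D : rep R G n.+1 := mk_rep
  (continuous_comp_fun (bohr_continuous bohrG) (rep_continuous (rho := rho)))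
  (fun x y => etrans (congr1 rho (bohr_morphism bohrG x y)) (repM rho (b x) (b y))).
have -> : rho = ext D by symmetry; apply: bohr_rep_uniq.
have := congr1 (fun p => quasi_comp p D) yz; rewrite !quasi_comp_dual_map => h.
by rewrite repM h -repM mulgV rep1.
Qed.

End dual_map.

(** * Reconstruction of points of bG from quasi-representations *)

Section cayley_transform.
Context {R : realType}.
Local Notation C := R[i].
Local Notation "M ^*t" := (map_mx Num.conj M^T) (at level 2, format "M ^*t").

Lemma adjmx_eq0 m (v : 'rV[C]_m) : v *m v^*t = 0 -> v = 0.
Proof.
move=> /matrixP/(_ ord0 ord0); rewrite !mxE => /eqP.
rewrite psumr_eq0 => [/allP h|i _]; last by rewrite !mxE mul_conjC_ge0.
apply/matrixP => i j; rewrite (ord1 i) mxE; have := h j (mem_index_enum _).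
by rewrite !mxE mul_conjC_eq0 => /eqP.
Qed.

Lemma adjmxZi m n (A : 'M[C]_(m, n)) : ('i *: A)^*t = - ('i *: A^*t).
Proof. by apply/matrixP => i j; rewrite !mxE rmorphM /= conjCi mulNr. Qed.

(** A nonzero v in the kernel would satisfy [v = 'i *: (v *m H)]; then v v^* would be both i times a
    self-adjoint scalar and its negative. *)
Lemma hermitian_sub1_unit n (H : 'M[C]_n) : H^*t = H -> (1%:M - 'i *: H) \in unitmx.
Proof.
move=> HH; rewrite -row_free_unit -kermx_eq0; apply/rowV0P => v.
move=> /sub_kermxP; rewrite mulmxBr mulmx1 => /eqP; rewrite subr_eq0 => /eqP vE.
apply: adjmx_eq0; pose s := v *m v^*t.
have s1 : s = 'i *: (v *m H *m v^*t) by rewrite /s {1}vE -scalemxAr -scalemxAl.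
have s2 : s = - ('i *: (v *m H *m v^*t)).
  have : s^*t = s by rewrite /s adjmxM adjmxK.
  move=> <-; rewrite {1}s1 adjmxZi; congr (- (_ *: _)).
  by rewrite !adjmxM adjmxK HH mulmxA.
have : s *+ 2 = 0 by rewrite mulr2n {1}s1 s2 subrr.
by rewrite -scaler_nat => /eqP; rewrite scaler_eq0 pnatr_eq0 => /eqP.
Qed.

(* Unitary matrices suffice to detect the matrices commuting with a hermitian
   one, through its Cayley transform. *)
Lemma cayley_transform n (H : 'M[C]_n) : H^*t = H ->
  exists U : 'U[R]_n, forall A : 'M[C]_n,
    A *m unitary_val U = unitary_val U *m A <-> A *m H = H *m A.
Proof.
move=> HH; pose Z := 1%:M - 'i *: H; pose Y := 1%:M + 'i *: H.
have uZ : Z \in unitmx by exact: hermitian_sub1_unit.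
have ZY : Z^*t = Y.
  by rewrite /Z /Y linearB /= trmx1 map_mxB map_mx1 adjmxZi HH opprK.
have YZa : Y^*t = Z by rewrite -ZY adjmxK.
have uY : Y \in unitmx by rewrite -ZY map_unitmx unitmx_tr.
(* Hence [Y *m invmx Z = 2 invmx Z - 1]: commuting with it amounts to commuting with [invmx Z], so
   with Z, so with H. *)
have YE : Y = 2%:R *: 1%:M - Z by rewrite scaler_nat mulr2n opprB addrACA subrr addr0.
have YZ : Y *m Z = Z *m Y.
  rewrite YE; move: (Z) => X.
  by rewrite mulmxBl mulmxBr -scalemxAl -scalemxAr mul1mx mulmx1.
have ZE : Z = 1%:M - 'i *: H by [].
have YD : Y = 1%:M + 'i *: H by [].
clearbody Y Z.
have ViZ : (invmx Z)^*t = invmx Y.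
  have : (invmx Z)^*t *m Y = 1%:M by rewrite -{1}ZY -adjmxM mulmxV// trmx1 map_mx1.
  by move/(congr1 (mulmx^~ (invmx Y))); rewrite mulmxK// mul1mx.
have MU : Y *m invmx Z \is unitarymx.
  apply/unitarymxP; rewrite adjmxM ViZ YZa !mulmxA.
  have -> : Y *m invmx Z *m invmx Y = invmx Z.
    apply: (can_inj (mulmxK uY)); rewrite mulmxKV//.
    apply: (can_inj (mulKmx uZ)); rewrite !mulmxA -YZ mulmxK// mulmxV// mul1mx.
    by [].
  by rewrite mulVmx.
exists (UnitaryGroup MU) => A /=; split=> [AU|AH].
  have AZi : A *m invmx Z = invmx Z *m A.
    move: AU; rewrite YE mulmxBl mulmxV// -scalemxAl mul1mx mulmxBr mulmxBl mulmx1 mul1mx.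
    move/(congr1 (fun X => X + A)); rewrite !subrK -scalemxAr -scalemxAl.
    by apply: scalerI; rewrite pnatr_eq0.
  have : A *m Z = Z *m A.
    by rewrite -[LHS](mulKVmx uZ) [invmx Z *m _]mulmxA -AZi mulmxKV.
  rewrite ZE mulmxBr mulmxBl mulmx1 mul1mx => /addrI/oppr_inj.
  by rewrite -scalemxAr -scalemxAl; apply: scalerI; rewrite neq0Ci.
have AZ : A *m Z = Z *m A.
  by rewrite ZE mulmxBr mulmxBl mulmx1 mul1mx -scalemxAr -scalemxAl AH.
have AY : A *m Y = Y *m A.
  by rewrite YD mulmxDr mulmxDl mulmx1 mul1mx -scalemxAr -scalemxAl AH.
have AZi : A *m invmx Z = invmx Z *m A.
  by rewrite -[LHS](mulKmx uZ) [Z *m _]mulmxA -AZ mulmxK.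
by rewrite mulmxA AY -mulmxA AZi mulmxA.
Qed.

End cayley_transform.

(** * Quasi-representations respect intertwiners and duals *)

Section naturality.
Context {R : realType} {G : topologicalGroupType}.
Variable p : quasi_dual R G.
Local Notation C := R[i].
Local Notation P := (quasi_comp p).
Local Notation "M ^*t" := (map_mx Num.conj M^T) (at level 2, format "M ^*t").

(** Compatibility with conjugation concerns unitary matrices of one size. A rectangular T is placed
    with its adjoint off the diagonal of a hermitian H, whose Cayley transform fixes the direct sum
    of D and E under conjugation; p then gives back commutation with H. *)
Lemma quasi_comp_natural m n (D : rep R G m.+1) (E : rep R G n.+1) (T : 'M[C]_(n.+1, m.+1)) :
  (forall x, T *m unitary_val (D x) = unitary_val (E x) *m T) ->
  T *m unitary_val (P D) = unitary_val (P E) *m T.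
Proof.
move=> TDE; pose H : 'M[C]_(m.+1 + n.+1) := block_mx 0 T^*t T 0.
have HH : H^*t = H by rewrite tr_block_mx map_block_mx !trmx0 !map_mx0 adjmxK.
have TDEa x : unitary_val (D x) *m T^*t = T^*t *m unitary_val (E x).
  have := congr1 (fun X => X^*t) (TDE x^-1%g).
  rewrite !adjmxM -!unitary_valV => h.
  have rV k (rho : rep R G k) : (rho x^-1 = (rho x)^-1)%g.
    by apply: (@mulgI _ (rho x)); rewrite -repM !mulgV rep1.
  by move: h; rewrite !rV !invgK => ->.
have [U UP] := cayley_transform HH.
pose F : rep R G ((m.+1 + n.+1).-1).+1 := rep_dsum D E.
have UF : rep_conj U F = F.
  apply: rep_eq => x; apply: (@mulgI _ U); rewrite -[rep_conj U F x]/(U^-1 * F x * U)%g.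
  rewrite !mulgA mulgV mul1g; apply: val_inj; apply/(UP _).
  by rewrite /= !mulmx_block !mul0mx !mulmx0 !addr0 !add0r TDE TDEa.
have := quasi_comp_conj p U F; rewrite UF => /(congr1 (fun u => U * u)%g).
rewrite !mulgA mulgV mul1g => /(congr1 val) /= /esym /UP.
rewrite [quasi_comp p F](quasi_comp_dsum p D E) /= !mulmx_block !mul0mx !mulmx0 !addr0 !add0r.
by move/eq_block_mx => [_ _ ->].
Qed.

Definition trivial_rep : rep R G 1 :=
  mk_rep (@cst_continuous G 'U[R]_1 1%g) (fun x y => esym (mulg1 1%g)).

(** [trivial_rep] is its own tensor square, so its value is an idempotent scalar, nonzero by
    unitarity. *)
Lemma quasi_comp_trivial : P trivial_rep = 1%g.
Proof.
have h : @rep_tens R G 1 1 trivial_rep trivial_rep = trivial_rep.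
  by apply: rep_eq => x; exact: (@unitary_tens1 R 1 1).
have := quasi_comp_tens p trivial_rep trivial_rep; rewrite [X in quasi_comp p X]h.
move=> /(congr1 (fun u : 'U[R]_1 => unitary_val u ord0 ord0)) /=; rewrite !mxE.
rewrite !(ord1 (mxtens_unindex _).1) !(ord1 (mxtens_unindex _).2) => aa.
have a0 : unitary_val (P trivial_rep) ord0 ord0 != 0.
  apply/eqP => a0; have := unitary_mulmxV (P trivial_rep) => /matrixP/(_ ord0 ord0).
  by rewrite !mxE big_ord1 a0 mul0r => /eqP; rewrite eq_sym oner_eq0.
apply: val_inj; apply/matrixP => i j; rewrite (ord1 i) (ord1 j) !mxE /= mulr1n.
by apply: (mulfI a0); rewrite -aa mulr1.
Qed.

(** A fixed vector is an intertwiner from [trivial_rep]. *)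
Lemma quasi_comp_fixed n (E : rep R G n.+1) (v : 'cV[C]_n.+1) :
  (forall x, unitary_val (E x) *m v = v) -> unitary_val (P E) *m v = v.
Proof.
move=> Ev; have := @quasi_comp_natural 0 n trivial_rep E v.
by rewrite quasi_comp_trivial /= mulmx1 => h; symmetry; apply: h => x; rewrite Ev.
Qed.

Fact unitary_conj_subproof n (A : 'U[R]_n) : map_mx Num.conj (unitary_val A) \is unitarymx.
Proof.
apply/unitarymxP; rewrite map_trmx -map_mxM.
by rewrite (unitarymxP (unitary_valP A)) map_mx1.
Qed.

Definition unitary_conj n (A : 'U[R]_n) : 'U[R]_n := UnitaryGroup (unitary_conj_subproof A).

Fact contragredient_continuous n (D : rep R G n) : continuous (fun x => unitary_conj (D x)).
Proof.
apply/unitary_continuousP => i j; under eq_fun do rewrite mxE.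
apply: (@continuous_comp_fun _ _ _ (fun x => unitary_val (D x) i j) Num.conj).
  by move: i j; apply/unitary_continuousP; exact: rep_continuous.
exact: conj_continuous.
Qed.

Fact contragredientM n (D : rep R G n) :
  {morph (fun x => unitary_conj (D x)) : x y / (x * y)%g}.
Proof. by move=> x y; apply: val_inj; rewrite /= repM map_mxM. Qed.

Definition contragredient n (D : rep R G n) : rep R G n :=
  mk_rep (@contragredient_continuous _ D) (@contragredientM _ D).

(** With columns of size n * n read as square matrices, v is the identity and [tensmx A B] acts by
    [X |-> A *m X *m B^T]. *)
Lemma tens_diagonal n (A B : 'M[C]_n) (v : 'cV[C]_(n * n)) :
  v = \col_k ((mxtens_unindex k).1 == (mxtens_unindex k).2)%:R ->
  A *m B^T = 1%:M <-> tensmx A B *m v = v.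
Proof.
move=> ->; have E i j : (tensmx A B *m \col_k ((mxtens_unindex k).1 == (mxtens_unindex k).2)%:R)
     (mxtens_index (i, j)) ord0 = (A *m B^T) i j.
  rewrite !mxE (reindex (@mxtens_index n n)); last first.
    by exists (@mxtens_unindex n n) => k _; [exact: mxtens_indexK|exact: mxtens_unindexK].
  transitivity (\sum_k \sum_l A i k * B j l * (k == l)%:R).
    rewrite pair_bigA; apply: eq_bigr => -[k l] _.
    by rewrite tensmxE mxE mxtens_indexK.
  apply: eq_bigr => k _; rewrite (bigD1 k)//= big1 ?addr0 => [|l lk].
    by rewrite eqxx mulr1 mxE.
  by rewrite eq_sym (negbTE lk) mulr0.
split=> [AB|AB]; last first.
  by apply/matrixP => i j; rewrite -E AB !mxE mxtens_indexK.
apply/matrixP => k l; rewrite (ord1 l); case: (mxtens_indexP k) => i j.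
by rewrite E AB !mxE mxtens_indexK.
Qed.

(** The diagonal vector is fixed by D tensored with its conjugate, hence by their values under p; by
    [tens_diagonal] this determines the second value from the first. *)
Lemma quasi_comp_contragredient n (D : rep R G n.+1) : P (contragredient D) = unitary_conj (P D).
Proof.
pose v : 'cV[C]_(n.+1 * n.+1) := \col_k ((mxtens_unindex k).1 == (mxtens_unindex k).2)%:R.
have h x : tensmx (unitary_val (D x)) (unitary_val (contragredient D x)) *m v = v.
  by apply/(tens_diagonal _ _ erefl); rewrite /= map_trmx; exact: unitary_mulmxV.
have := @quasi_comp_fixed (n.+1 * n.+1).-1 (rep_tens D (contragredient D)) v h.
rewrite (quasi_comp_tens p D (contragredient D)) => hP.
have AB := iffRL (tens_diagonal (unitary_val (P D)) (unitary_val (P (contragredient D))) erefl) hP.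
have AB' := mulmx1C AB.
apply: val_inj; apply: (can_inj (@trmxK _ _ _)) => /=.
rewrite -[LHS]mulmx1 -(unitary_mulmxV (P D)) mulmxA AB' mul1mx.
by rewrite map_trmx.
Qed.

End naturality.

(** * A character that detects the identity *)

Section character_bound.
Context {R : realType}.
Local Notation C := R[i].

Definition qtrace n (u : 'M[C]_n) : R := normc (1 + \tr u) ^+ 2.

Lemma qtrace_ge0 n (u : 'M[C]_n) : 0 <= qtrace u.
Proof. exact: sqr_ge0. Qed.

Lemma qtrace1 n : qtrace (1%:M : 'M[C]_n) = (1 + n%:R) ^+ 2.
Proof.
rewrite /qtrace mxtrace1 -(rmorph_nat (@real_complex_def R (Phant R))).
by rewrite -[1 in LHS](rmorph1 (@real_complex_def R (Phant R))) -rmorphD /= expr0n addr0 sqrtr_sqr real_normK ?num_real.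
Qed.

Lemma qtrace_complex n (u : 'M[C]_n) :
  (1 + \tr u) * Num.conj (1 + \tr u) = (qtrace u)%:C%C.
Proof. by rewrite -[LHS]sqr_normc normcE -rmorphXn. Qed.

(** Equality forces Re tr u >= n, while each diagonal entry has modulus at most 1; so these have
    real part 1, and rows of norm 1 leave nothing elsewhere. *)
Lemma qtrace_lt n (u : 'U[R]_n) : u != 1%g -> qtrace (unitary_val u) < (1 + n%:R) ^+ 2.
Proof.
move=> u1; rewrite ltNge; apply: contra u1 => hq; apply/eqP.
pose t := \tr (unitary_val u).
have tn : normc t <= n%:R.
  apply: le_trans (normc_sum _ _) _; rewrite -[n in n%:R]card_ord -sumr_const.
  by apply: ler_sum => i _; exact: unitary_entry_le1.
have ht : qtrace (unitary_val u) = 1 + 2 * complex.Re t + normc t ^+ 2.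
  rewrite /qtrace -/t; case: (t) => a c /=.
  by rewrite !sqr_sqrtr ?addr_ge0 ?sqr_ge0//; ring.
have Ret : n%:R <= complex.Re t.
  move: hq; rewrite ht; have := normc_ge0 t; have : 0 <= n%:R :> R by [].
  nra.
have Rele i : complex.Re (unitary_val u i i) <= 1.
  by apply: le_trans (unitary_entry_le1 u i i); apply: le_trans (normc_geRe _); exact: ler_norm.
have Re1 i : complex.Re (unitary_val u i i) = 1.
  have : \sum_i (1 - complex.Re (unitary_val u i i)) = 0.
    apply/eqP; rewrite eq_le; apply/andP; split; last first.
      by apply: sumr_ge0 => j _; rewrite subr_ge0.
    rewrite sumrB sumr_const card_ord subr_le0; apply: le_trans Ret _.
    by rewrite /t /mxtrace (raddf_sum (@complex.Re R : {additive Rcomplex R -> R})).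
  move=> /eqP; rewrite psumr_eq0 => [|j _]; last by rewrite subr_ge0.
  by move=> /allP/(_ i (mem_index_enum _)); rewrite /= subr_eq0 => /eqP <-.
have row i k : normc (unitary_val u i k - (i == k)%:R) = 0.
  have h := unitary_row_norm u i; rewrite (bigD1 i)//= in h.
  have h2 : normc (unitary_val u i i) ^+ 2 = 1 + complex.Im (unitary_val u i i) ^+ 2.
    move: (Re1 i); case: (unitary_val u i i) => a c /= ->.
    by rewrite sqr_sqrtr ?addr_ge0 ?sqr_ge0// expr1n.
  have h3 : 0 <= \sum_(j | j != i) normc (unitary_val u i j) ^+ 2.
    by apply: sumr_ge0 => j _; exact: sqr_ge0.
  have [ik|ik] := eqVneq i k.
    have : complex.Im (unitary_val u i i) ^+ 2 = 0.
      by have := sqr_ge0 (complex.Im (unitary_val u i i)); lra.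
    move=> /eqP; rewrite sqrf_eq0 -ik; move: (Re1 i); case: (unitary_val u i i) => a c /= -> /eqP ->.
    by rewrite subrr subr0 expr0n addr0 sqrtr0.
  have : \sum_(j | j != i) normc (unitary_val u i j) ^+ 2 = 0.
    by have := sqr_ge0 (complex.Im (unitary_val u i i)); lra.
  move=> /eqP; rewrite psumr_eq0 => [|j _]; last exact: sqr_ge0.
  move=> /allP/(_ k (mem_index_enum _)); rewrite eq_sym ik /= sqrf_eq0 => /eqP.
  by rewrite subr0.
apply: val_inj; apply/matrixP => i k; rewrite /= [RHS]mxE.
by apply/eqP; rewrite -subr_eq0; apply/eqP/eq0_normc/row.
Qed.

Lemma mxtrace_tens m n (A : 'M[C]_m) (B : 'M[C]_n) : \tr (tensmx A B) = \tr A * \tr B.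
Proof. by rewrite /mxtrace mulr_sum; apply: eq_bigr => i _; rewrite !mxE. Qed.

Lemma mxtrace_conj n (A : 'M[C]_n) : \tr (map_mx Num.conj A) = Num.conj (\tr A).
Proof. by rewrite /mxtrace rmorph_sum; apply: eq_bigr => i _; rewrite mxE. Qed.

End character_bound.

Section tensor_powers.
Context {R : realType} {G : topologicalGroupType}.
Variable p : quasi_dual R G.
Local Notation P := (quasi_comp p).

(* E is the k-th tensor power of F (x) conj(F), with F = 1 (+) D. *)
Lemma tensor_powers m (D : rep R G m.+1) k : exists n (E : rep R G n.+1), forall x,
  \tr (unitary_val (E x)) = (qtrace (unitary_val (D x)) ^+ k)%:C%C /\
  \tr (unitary_val (P E) *m unitary_val (E x)) =
    (qtrace (unitary_val (P D) *m unitary_val (D x)) ^+ k)%:C%C.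
Proof.
elim: k => [|k [n [E EP]]].
  exists 0%N, (trivial_rep (R := R) (G := G)) => x.
  by rewrite quasi_comp_trivial !expr0 /= mulmx1 mxtrace1.
pose k1 := (0.+1 + m.+1).-1; pose F : rep R G k1.+1 := rep_dsum (trivial_rep (R := R) (G := G)) D.
pose k2 := (k1.+1 * k1.+1).-1; pose F2 : rep R G k2.+1 := rep_tens F (contragredient F).
pose E' : rep R G ((k2.+1 * n.+1).-1).+1 := rep_tens F2 E.
exists (k2.+1 * n.+1).-1, E' => x; have [h1 h2] := EP x.
have trF (A : 'M[R[i]]_m.+1) : \tr (block_mx (1%:M : 'M[R[i]]_1) 0 0 A) = 1 + \tr A.
  by rewrite mxtrace_block mxtrace1.
have bM (A B : 'M[R[i]]_m.+1) : block_mx (1%:M : 'M[R[i]]_1) 0 0 A *m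
    block_mx (1%:M : 'M[R[i]]_1) 0 0 B = block_mx (1%:M : 'M[R[i]]_1) 0 0 (A *m B).
  by rewrite mulmx_block !mulmx0 !mul0mx !addr0 !add0r mulmx1.
have hF : \tr (unitary_val (F x)) = 1 + \tr (unitary_val (D x)) by exact: trF.
have hPF : \tr (unitary_val (P F) *m unitary_val (F x)) =
    1 + \tr (unitary_val (P D) *m unitary_val (D x)).
  rewrite [P F](quasi_comp_dsum p (trivial_rep (R := R) (G := G)) D) quasi_comp_trivial.
  rewrite -trF -bM; exact: erefl.
split.
  transitivity (\tr (unitary_val (F x)) * \tr (map_mx Num.conj (unitary_val (F x))) *
      \tr (unitary_val (E x))); first by rewrite -!mxtrace_tens.
  by rewrite mxtrace_conj hF qtrace_complex h1 -rmorphM -exprS.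
have -> : P E' = unitary_tens (unitary_tens (P F) (unitary_conj (P F))) (P E).
  rewrite [P E'](quasi_comp_tens p F2 E) [P F2](quasi_comp_tens p F (contragredient F)).
  by rewrite quasi_comp_contragredient.
have -> : unitary_val (E' x) = unitary_val (unitary_tens (unitary_tens (F x) (unitary_conj (F x))) (E x)).
  by [].
have tT a c (A A' : 'M[R[i]]_a) (B B' : 'M[R[i]]_c) :
    \tr (tensmx A B *m tensmx A' B') = \tr (A *m A') * \tr (B *m B').
  by rewrite tensmx_mul mxtrace_tens.
transitivity (\tr (unitary_val (P F) *m unitary_val (F x)) *
    \tr (map_mx Num.conj (unitary_val (P F)) *m map_mx Num.conj (unitary_val (F x))) *
    \tr (unitary_val (P E) *m unitary_val (E x))); first by rewrite -!tT.
rewrite -map_mxM mxtrace_conj h2 hPF qtrace_complex.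
by rewrite -rmorphM -exprS.
Qed.

End tensor_powers.

(** * Quasi-representations come from points of bG *)

Section tannaka.
Context {R : realType} {G bG : topologicalGroupType} {b : G -> bG}.
Hypothesis bohrG : is_bohr_compactification b.
Local Notation ext := (bohr_rep bohrG).
Local Notation C := R[i].
Let cK := bohr_compact bohrG.
Variable p : quasi_dual R G.
Local Notation P := (quasi_comp p).

Let bohr_eqC (f g : bG -> C) : continuous f -> continuous g ->
  (forall x, f (b x) = g (b x)) -> f =1 g.
Proof.
move=> cf cg fg y; apply/eqP; rewrite -subr_eq0; apply/eqP/eq0_normc/eqP.
rewrite eq_le normc_ge0 andbT.
apply: (bohr_closed bohrG (P := [set y | normc (f y - g y) <= 0])) => [|x].
  have cd : continuous (fun y => normc (f y - g y)).
    apply: continuous_comp_fun continuous_normc.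
    apply: complexD_continuous; first exact: cf.
    by apply: continuous_opp; exact: cg.
  by apply: (iffLR (continuous_closedP _) cd [set r | r <= 0]); exact: num_normedtype.closed_le.
by rewrite /= fg subrr normc0.
Qed.

Let cext n (E : rep R G n) i j : continuous (fun y => unitary_val (ext E y) i j).
Proof. by move: i j; apply/unitary_continuousP; exact: rep_continuous. Qed.

Let cmulext n (A : 'M[C]_n) (E : rep R G n) i j :
  continuous (fun y => (A *m unitary_val (ext E y)) i j).
Proof.
under eq_fun do rewrite mxE; apply: complex_sum_continuous => k.
by apply: complexM_continuous; [exact: cst_continuous|exact: cext].
Qed.

Let ctr n (F : bG -> 'M[C]_n) : (forall i j, continuous (fun y => F y i j)) ->
  continuous (fun y => \tr (F y)).
Proof. by move=> cF; apply: complex_sum_continuous => i; exact: cF. Qed.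

Let cqtrace n (F : bG -> 'M[C]_n) : (forall i j, continuous (fun y => F y i j)) ->
  continuous (fun y => qtrace (F y)).
Proof.
move=> cF; under eq_fun do rewrite /qtrace expr2.
have h : continuous (fun y => normc (1 + \tr (F y))).
  apply: continuous_comp_fun continuous_normc; apply: complexD_continuous; last exact: ctr.
  exact: cst_continuous.
exact: continuous_mulr.
Qed.

Let cpow (f : bG -> R) k : continuous f -> continuous (fun y => f y ^+ k).
Proof. by move=> cf; exact: (continuous_comp_fun cf (@exprn_continuous R k)). Qed.

Lemma cmean_real (f : bG -> R) : cmean cK (fun y => (f y)%:C%C) = (haar cK f)%:C%C.
Proof. by rewrite /cmean /= haar_cst. Qed.

(* The mean of a representation is the projection on its fixed vectors, which
   p preserves. *)
Lemma quasi_comp_mean n (E : rep R G n.+1) :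
  unitary_val (P E) *m mxmean cK (fun y => unitary_val (ext E y)) =
  mxmean cK (fun y => unitary_val (ext E y)).
Proof.
set T := mxmean _ _.
have ET x : unitary_val (E x) *m T = T.
  rewrite -(bohr_repE bohrG) /T mulmx_mxmean; last exact: cext.
  rewrite -[RHS](mxmean_translate cK (b x)); last exact: cext.
  by congr mxmean; apply/funext => y; rewrite repM.
have Tj j : unitary_val (P E) *m col j T = col j T.
  by apply: quasi_comp_fixed => x; rewrite !colE mulmxA ET.
apply/matrixP => i j.
have e (M : 'M[C]_n.+1) : M i j = col j M i ord0 by rewrite mxE.
by rewrite [LHS]e [RHS]e -[in RHS](Tj j) !colE mulmxA.
Qed.

(** These are the traces of the two sides of [quasi_comp_mean] for a tensor power; the trace
    formulas, known on G, extend to bG by density. *)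
Lemma qtrace_mean m (D : rep R G m.+1) k :
  haar cK (fun y => qtrace (unitary_val (P D) *m unitary_val (ext D y)) ^+ k) =
  haar cK (fun y => qtrace (unitary_val (ext D y)) ^+ k).
Proof.
have [n [E EP]] := tensor_powers p D k.
have := congr1 mxtrace (quasi_comp_mean E).
rewrite mulmx_mxmean; last exact: cext.
rewrite mxmean_tr; last exact: cmulext.
rewrite mxmean_tr; last exact: cext.
have h1 : (fun y => \tr (unitary_val (ext E y))) = fun y => (qtrace (unitary_val (ext D y)) ^+ k)%:C%C.
  apply/funext; apply: bohr_eqC => [||x]; last by rewrite !bohr_repE; have [] := EP x.
    by apply: ctr; exact: cext.
  by apply: continuous_comp_fun real_complex_continuous; apply: cpow; apply: cqtrace; exact: cext.
have h2 : (fun y => \tr (unitary_val (P E) *m unitary_val (ext E y))) =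
   fun y => (qtrace (unitary_val (P D) *m unitary_val (ext D y)) ^+ k)%:C%C.
  apply/funext; apply: bohr_eqC => [||x]; last by rewrite !bohr_repE; have [] := EP x.
    by apply: ctr; exact: cmulext.
  by apply: continuous_comp_fun real_complex_continuous; apply: cpow; apply: cqtrace; exact: cmulext.
by rewrite h1 h2 !cmean_real => /complexI.
Qed.

Lemma quasi_comp_range m (D : rep R G m.+1) : exists y, ext D y = P D.
Proof.
apply: contrapT => /forallNP nD.
have u1 y : (P D * ext D y)%g != 1%g.
  apply/eqP => h; apply: (nD y^-1%g); apply: (@mulIg _ (ext D y)).
  by rewrite -repM mulVg rep1 h.
pose N : R := (1 + m.+1%:R) ^+ 2.
have cF := @cmulext _ (unitary_val (P D)) D.
pose f y := qtrace (unitary_val (P D) *m unitary_val (ext D y)).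
have cf : continuous f by exact: cqtrace.
have fN y : f y < N by exact: (qtrace_lt (u1 y)).
have f0 y : 0 <= f y by exact: qtrace_ge0.
(* A bound on the continuous function [(N - f y)^-1] turns [f y < N] into the uniform gap
   [f y <= N - B^-1]. *)
have [B hB] : exists B, forall y, `|(N - f y)^-1| <= B.
  apply: (continuous_bounded cK) => y; apply: cvgV; first by rewrite gt_eqF// subr_gt0.
  by apply: cvgB; [exact: cvg_cst|exact: cf].
have B0 : 0 < B.
  by apply: lt_le_trans (hB 1%g); rewrite normr_gt0 invr_eq0 gt_eqF// subr_gt0.
pose r := N - B^-1.
have fr y : f y <= r.
  have h : 0 < N - f y by rewrite subr_gt0.
  have := hB y; rewrite gtr0_norm ?invr_gt0//.
  by rewrite -lef_pV2 ?posrE ?invr_gt0// invrK /r; lra.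
have r0 : 0 <= r by apply: le_trans (fr 1%g).
have rN : r < N by rewrite /r ltrBlDr ltrDl invr_gt0.
pose s := (r + N) / 2.
have [s0 rs sN] : [/\ 0 < s, r < s & s < N] by split; rewrite /s; lra.
pose g y := qtrace (unitary_val (ext D y)).
have cg : continuous g by apply: cqtrace; exact: cext.
have g0 y : 0 <= g y by exact: qtrace_ge0.
(* Finitely many translates of the set where g exceeds s cover bG, so [s ^+ k] is at most [size t]
   times the mean of [g ^+ k]. That mean equals the mean of [f ^+ k], which is at most [r ^+ k];
   this is absurd for large k since [r < s]. *)
have [|t tV] := @finite_translate_cover _ cK [set y | s < g y].
  have g1 : g 1%g = N by rewrite /g rep1 qtrace1.
  have e0 : 0 < N - s by lra.
  have /cvgrPdist_lt/(_ _ e0) := cg 1%g; apply: filterS => y /=.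
  by rewrite g1 ltr_norml; lra.
have key k : s ^+ k <= (size t)%:R * r ^+ k.
  have cgk : continuous (fun y => g y ^+ k) by exact: cpow.
  have ct a : continuous (fun y => g (a * y)%g ^+ k).
    exact: (@translate_continuous R bG a (fun y => g y ^+ k) cgk).
  have [h1 h2] := haar_sum cK t ct.
  have : s ^+ k <= haar cK (fun y => \sum_(a <- t) g (a * y)%g ^+ k).
    rewrite -[leLHS](haar_cst cK); apply: haar_le => //; first exact: cst_continuous.
    move=> y; have [a at_] := tV 1%g y^-1%g; rewrite /= mul1g invgK => /ltW h.
    rewrite (perm_big _ (perm_to_rem at_)) big_cons /=.
    apply: (@le_trans _ _ (g (a * y)%g ^+ k)); first by rewrite lerXn2r ?nnegrE// ltW.
    by rewrite lerDl sumr_ge0// => c _; rewrite exprn_ge0.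
  rewrite h1 (eq_bigr (fun=> haar cK (fun y => g y ^+ k))) => [|a _]; last first.
    exact: (@haar_translate R bG cK a (fun y => g y ^+ k) cgk).
  rewrite big_const_seq count_predT iter_addr_0 -[_ *+ _]mulr_natl => h.
  apply: (le_trans h); rewrite ler_wpM2l// -qtrace_mean -[leRHS](haar_cst cK).
  apply: haar_le; [by apply: cpow; exact: cf|exact: cst_continuous|] => y.
  by apply: lerXn2r; rewrite ?nnegrE; [exact: f0|exact: r0|exact: fr].
have : (fun k => (size t)%:R * (r / s) ^+ k) @ \oo --> ((size t)%:R * 0 : R).
  apply: cvgM; first exact: cvg_cst.
  by apply: cvg_expr; rewrite ger0_norm ?ltr_pdivrMr ?mul1r// divr_ge0// (ltW s0).
rewrite mulr0 => /cvgrPdist_lt/(_ _ ltr01)[k _ /(_ k (leqnn k))] /=.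
rewrite sub0r normrN ger0_norm; last by rewrite mulr_ge0// exprn_ge0// divr_ge0// ltW.
rewrite expr_div_n mulrA ltr_pdivrMr ?exprn_gt0// mul1r => /(le_lt_trans (key k)).
by rewrite ltxx.
Qed.

Theorem tannaka : exists y, forall m (D : rep R G m.+1), ext D y = P D.
Proof.
pose S (E : chu_dual R G) := [set y | ext (tagged E) y = P (tagged E)].
have cS E : closed (S E).
  have -> : S E = [set y | mxnorm (unitary_val (ext (tagged E) y) - unitary_val (P (tagged E))) <= 0].
    apply/seteqP; split=> y; rewrite /S /=; first by move=> ->; rewrite subrr mxnorm0.
    by move=> /mxnorm_eq0/eqP; rewrite subr_eq0 => /eqP h; exact: val_inj.
  have cd : continuous (fun y => mxnorm (unitary_val (ext (tagged E) y) - unitary_val (P (tagged E)))).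
    by apply: continuous_unitary_dist; [exact: rep_continuous|exact: cst_continuous].
  by apply: (iffLR (continuous_closedP _) cd [set r | r <= 0]); exact: num_normedtype.closed_le.
(* The sets S are directed: the one of a direct sum lies in those of both summands. *)
pose F := filter_from [set: chu_dual R G] S.
have FF : ProperFilter F.
  apply: filter_from_proper; last by move=> E _; exact: quasi_comp_range.
  apply: filter_from_filter; first by exists (rep_of (trivial_rep (R := R) (G := G))).
  move=> [m D] [n E] _ _; exists (@rep_of R G (m.+1 + n.+1).-1 (rep_dsum D E)) => // y.
  rewrite /S /= => h.
  have : unitary_dsum (ext D y) (ext E y) = unitary_dsum (P D) (P E).
    by rewrite -(bohr_rep_dsum bohrG D E y) -(quasi_comp_dsum p D E).
  move=> /(congr1 val) /= /eq_block_mx [h1 _ _ h2].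
  by split; exact: val_inj.
have [y [_ yF]] := cK FF (@filterT _ F _).
exists y => m D; apply: (cS (rep_of D)) => A Ay.
by apply: yF => //; exists (rep_of D).
Qed.

End tannaka.

(** * Separation of the bidual and the final equivalence *)

Lemma quasi_comp_eval_continuous (R : realType) (G : topologicalGroupType) n
    (D : rep R G n.+1) :
  continuous (fun p : quasi_dual R G => quasi_comp p D).
Proof.
move=> p A /nbhs_unitaryP[e e0 eA].
have cD : compact [set rep_of D] by exact: compact_set1.
pose O := @unitary_of R n @` uball (quasi_comp p D) e.
have oO : open O by apply: existT_open_map; exact: open_uball.
have : nbhs (set_val p : {compact-open, chu_dual R G -> unitary_sum R})
    [set g | g @` [set rep_of D] `<=` O].
  apply: open_nbhs_nbhs; split; first exact: compact_open_open.
  move=> _ [_ -> <-]; rewrite [X in O X](_ : _ = unitary_of (quasi_comp p D)); last exact: quasi_compE.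
  by exists (quasi_comp p D) => //; exact: uball_center.
move=> /(@initial_continuous _ _ (set_val : quasi_dual R G -> _)) hF.
apply: (@filterS _ (nbhs p) _ _ _ _ hF) => q qO; apply: eA.
have [|u up] := qO ((q : quasi_dual R G) (rep_of D)); first by exists (rep_of D).
by rewrite quasi_compE => /unitary_of_inj <-.
Qed.

Lemma quasi_dual_hausdorff (R : realType) (G : topologicalGroupType) :
  hausdorff_space (quasi_dual R G).
Proof.
move=> p q pq; apply: quasi_comp_eq => n D; apply: (@unitary_hausdorff R n.+1) => A B Ap Bq.
have ev := @quasi_comp_eval_continuous R G n D.
have [u [h1 h2]] := pq _ _ (ev p A Ap) (ev q B Bq).
by exists (quasi_comp u D).
Qed.

Theorem theorem4p2 (R : realType) (G : topologicalGroupType)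
    (lcG : locally_compact [set: G]) (hG : hausdorff_space G)
    (bG : topologicalGroupType) (b : G -> bG)
    (bohrG : is_bohr_compactification b) :
  topologically_isomorphic (quasi_dual R G) bG <->
  (forall n : nat, (1 <= n)%N -> discrete_space (rep_classes R G n)).
Proof.
split=> [|discG]; first exact: (isomorphic_discrete bohrG lcG).
pose phi := dual_map bohrG discG.
have surj (q : quasi_dual R G) : exists y, phi y = q.
  have [y yP] := tannaka bohrG q; exists y; apply: quasi_comp_eq => n D.
  by rewrite quasi_comp_dual_map yP.
have /choice[psi psiK] := surj.
have phiK : cancel phi psi by move=> y; apply: (@dual_map_inj _ _ _ _ bohrG discG); exact: psiK.
have hX := @quasi_dual_hausdorff R G.
exists psi, phi; split=> //.
- move=> q q'; rewrite -{1}(psiK q) -{1}(psiK q').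
  have phiM := @dual_mapM _ _ _ _ bohrG discG.
  by rewrite -[X in psi X]phiM phiK.
(* Preimages under psi are images under phi, and phi is closed as a continuous map from a compact
   space to a Hausdorff space. *)
- apply/continuous_closedP => A cA.
  have -> : psi @^-1` A = phi @` A.
    apply/seteqP; split=> [q Aq|_ [y Ay <-]]; first by exists (psi q).
    by rewrite /preimage /= phiK.
  apply: compact_closed => //; apply: continuous_compact.
    by apply: continuous_subspaceT; exact: dual_map_continuous.
  exact: (subclosed_compact cA (bohr_compact bohrG)).
- exact: dual_map_continuous.
Qed.
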